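(* Let $d\in\{1,2,3\}$, let $(B^d_t;\ t\ge 0)$ be a $d$-dimensional standard Brownian motion, and let $$\mathrm{Span}(d):=\{t-s;\ B^d_t=B^d_s\ \text{for some}\ 0\le s\le t\}\subset\mathbb{R}_+ .$$ For each $d\in\{1,2,3\}$, almost surely the random set $\mathrm{Span}(d)$ is $\sigma$-compact and dense in $\mathbb{R}_+$. Furthermore: (1) $\mathrm{Span}(1)=\mathbb{R}_+$ almost surely; (2) $\mathrm{Leb}\,\mathrm{Span}(2)=0$ almost surely and $\dim_H \mathrm{Span}(2)=1$ almost surely; (3) $\dim_H \mathrm{Span}(3)=\frac12$ almost surely.
   Context: $\mathbb{R}_+=[0,\infty)$. $\mathrm{Leb}$ denotes Lebesgue measure on $\mathbb{R}$ and $\dim_H$ denotes Hausdorff dimension. A set is $\sigma$-compact if it is a countable union of compact sets. Loops of zero duration are allowed, so $0\in\mathrm{Span}(d)$. The Brownian motion starts from $0$ and has continuous paths. *)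

(* Defs.v *)
From HB Require Import structures.
From mathcomp Require Import all_boot all_order all_algebra.
From mathcomp Require Import all_classical all_reals all_analysis.

Set Implicit Arguments.
Unset Strict Implicit.
Unset Printing Implicit Defensive.

Import Order.TTheory GRing.Theory Num.Theory.
Import numFieldNormedType.Exports.

Local Open Scope classical_set_scope.
Local Open Scope ring_scope.

Section Independence.
Context {R : realType} {disp : measure_display} {Omega : measurableType disp}.
Variable P : probability Omega R.

Definition independent_set_systems (I : finType) (F : I -> set_system Omega) :=
  forall (J : {set I}) (E : I -> set Omega),
    (forall i, i \in J -> F i (E i)) ->
    P (\bigcap_(i in [set` J]) E i) = (\prod_(i in J) P (E i))%E.

Definition independent_RVs (I : finType) (X : I -> Omega -> R) :=
  independent_set_systems
    (fun i => preimage_set_system setT (X i) (@measurable _ R)).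

End Independence.

(* Processes are functions on all of R, but only their values at times t >= 0
   are ever used. *)

Section BrownianMotion.
Context {R : realType} {disp : measure_display} {Omega : measurableType disp}.
Variable P : probability Omega R.

Definition process_sigma_algebra (X : R -> Omega -> R) : set_system Omega :=
  <<s [set E | exists2 t : R, 0 <= t &
         preimage_set_system setT (X t) (@measurable _ R) E] >>.

(* The second parameter of normal_prob is the standard deviation. *)
Record brownian_motion1 (X : R -> Omega -> R) : Prop := BrownianMotion1 {
  bm1_measurable : forall t : R, 0 <= t -> measurable_fun [set: Omega] (X t) ;
  bm1_start : forall w, X 0 w = 0 ;
  bm1_continuous :
    forall w, {within [set t : R | 0 <= t], continuous (fun t => X t w)} ;
  bm1_independent_increments :
    forall (n : nat) (t : nat -> R), 0 <= t 0%N -> nondecreasing_seq t ->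
      independent_RVs P
        (fun (k : 'I_n) (w : Omega) => X (t k.+1) w - X (t k) w) ;
  bm1_gaussian_increments :
    forall s t : R, 0 <= s -> s < t -> forall A : set R, measurable A ->
      P ((fun w => X t w - X s w) @^-1` A) = normal_prob 0 (Num.sqrt (t - s)) A
}.

Record brownian_motion (d : nat) (B : R -> Omega -> 'rV[R]_d) : Prop :=
  BrownianMotion {
  bm_coordinates :
    forall i : 'I_d, brownian_motion1 (fun t w => B t w ord0 i) ;
  bm_independent_coordinates :
    independent_set_systems P
      (fun i : 'I_d => process_sigma_algebra (fun t w => B t w ord0 i))
}.

Definition Span (d : nat) (B : R -> Omega -> 'rV[R]_d) (w : Omega) : set R :=
  [set u | exists s t : R, [/\ 0 <= s, s <= t, B t w = B s w & u = t - s]].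

End BrownianMotion.

Definition sigma_compact (T : topologicalType) (A : set T) :=
  exists K : nat -> set T, (forall n, compact (K n)) /\ A = \bigcup_n K n.

Definition dense_in (T : topologicalType) (D A : set T) :=
  A `<=` D /\ D `<=` closure A.

Section HausdorffDimension.
Context {R : realType}.
Local Open Scope ereal_scope.
Implicit Types (A : set R) (s delta : R).

(* diam set0 = -oo. *)
Definition diam A : \bar R := ereal_sup [set `|x - y|%:E | x in A & y in A].

(* The library has 0 `^ 0 = 1, so that for s = 0 a nonempty set counts for 1,
   whatever its diameter, and the empty set for 0. *)
Definition diam_pow s A : \bar R := if A == set0 then 0 else diam A `^ s.

Definition hausdorff_premeasure s delta A : \bar R :=
  ereal_inf [set \sum_(0 <= k <oo) diam_pow s (U k) |
    U in [set U : nat -> set R |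
      A `<=` \bigcup_k U k /\ forall k, diam (U k) <= delta%:E]].

Definition hausdorff_measure s A : \bar R :=
  ereal_sup [set hausdorff_premeasure s delta A |
    delta in [set delta : R | (0 < delta)%R]].

Definition hausdorff_dim A : \bar R :=
  ereal_inf [set s%:E | s in [set s : R | (0 <= s)%R /\
    hausdorff_measure s A = 0]].

End HausdorffDimension.

(* Main.v *)
Require Import Defs.
From HB Require Import structures.
From mathcomp Require Import all_boot all_order all_algebra.
From mathcomp Require Import all_classical all_reals all_analysis.
From mathcomp Require Import measurable_realfun real_interval.
From mathcomp Require Import ring lra zify.

(** Time is discretised at the scale [2 ^- n]: the grid times [j < k] hit each
    other when [B] moves by at most [r] between them in every coordinate, which
    for [r = 2 ^ (- n / 2)] has probability of order [(k - j) ^ (- d / 2)].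

    Lower bounds: charge the lag [k - j] of every hitting pair of a block. For
    [g < 2 - d / 2] the second moment method shows that, with a probability
    bounded below at all scales, the mass is bounded below and the [g]-energy
    bounded above. Independent disjoint blocks make this happen almost surely, in
    some block, at infinitely many scales, and a compactness version of Frostman's
    lemma gives positive [g]-dimensional Hausdorff measure to [Span] on every
    interval: hence the density and the lower bound [2 - d / 2] on the dimension.

    Upper bounds: almost surely every loop is close to a grid pair on which [B]
    moves by at most [C * n * 2 ^ (- n / 2)], and the expected number of such pairs
    shows that [Span] has null [s]-dimensional measure for [s > 2 - d / 2]. When
    [d = 2] the case [s = 1] needs a logarithmic gain. For a fixed lag, the loop
    increment is an independent Gaussian variable plus a planar random walk, so
    that the chance of a hit is governed by the number of cells visited by the
    walk; a walk of [H] steps visits only [O(H / log H)] cells, because each newly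
    visited one is revisited order [log H] times.

    When [d = 1] and [u] is not in [Span], [B (t + u) - B t] keeps a constant sign
    and [B] is bounded on one side, which almost surely does not happen. *)

Set Implicit Arguments.
Unset Strict Implicit.
Unset Printing Implicit Defensive.
Import Order.TTheory GRing.Theory Num.Theory.
Import numFieldNormedType.Exports.
Local Open Scope classical_set_scope.
Local Open Scope ring_scope.

(** * Independence and Gaussian estimates *)

Section Independence.
Context {R : realType} {disp : measure_display} {Omega : measurableType disp}.
Variable P : probability Omega R.
Local Open Scope ereal_scope.

(** No local time or random measure is constructed: probability enters through finite sums over grid
    hits, and compactness is applied afterwards to a fixed path. Two loops of a block share a middle
    stretch of length of order [H]; when both are hits, the displacement between their starts nearly
    equals the one between their ends, which costs a factor [m ^ (- d / 2)] if they are [m] apart.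
    Summed against the kernel [|lag difference| ^ (- g)], this stays bounded after normalisation for
    [g <= d / 2] and [g + d / 2 < 2]: this is where [2 - d / 2] comes from. Positive probability
    becomes probability one without a zero-one law, but the number of blocks inspected must not grow
    with the scale: starting times have to stay in a compact interval for the hits to accumulate at
    true loops. In the upper bounds, short loops are set apart because hits of small lag are likely.
    The power of [n] lost in the modulus of continuity is harmless above the critical exponent, but
    not at [s = 1] in the plane, where the gain is only a factor [1 / n]. *)

Lemma indep_event_sigma (A : set Omega) (C : set_system Omega) :
  measurable A -> setI_closed C -> C `<=` measurable ->
  (forall B, C B -> P (A `&` B) = P A * P B) ->
  forall B, <<s C >> B -> P (A `&` B) = P A * P B.
Proof.
move=> mA IC mC AC.
pose H : set_system Omega := [set B | measurable B /\ P (A `&` B) = P A * P B].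
suff : <<s C >> `<=` H by move=> CH B /CH[].
have PAfin : P A \is a fin_num by exact: fin_num_measure.
apply: (@lambda_system_subset _ C IC setT H) => //.
- apply/dynkin_lambda_system; split.
  + by split; [exact: measurableT|rewrite setIT probability_setT mule1].
  + move=> B [mB AB]; split; first exact: measurableC.
    have PBfin : P B \is a fin_num by exact: fin_num_measure.
    rewrite -setDE measureD//; last by rewrite ltey_eq PAfin.
    rewrite probability_setC//.
    apply: (@eq_trans _ _ (P A - P A * P B)).
      exact: (congr1 (fun x => P A - x) AB).
    by rewrite -(fineK PAfin) -(fineK PBfin) -EFinM -!EFinB -EFinM mulrBr mulr1.
  + move=> F tF HF; split; first by apply: bigcupT_measurable => n; case: (HF n).
    rewrite setI_bigcupr measure_bigcup//=; last 2 first.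
    * by move=> n _; apply: measurableI => //; case: (HF n).
    * exact: trivIset_setIl.
    rewrite measure_bigcup//=; last by move=> n _; case: (HF n).
    rewrite -(fineK PAfin) -nneseriesZl//.
    by apply: eq_eseriesr => n _; rewrite (fineK PAfin); case: (HF n).
- by move=> B CB; split; [exact: mC|exact: AC].
Qed.

Lemma indep_sigma (C1 C2 : set_system Omega) :
  setI_closed C1 -> setI_closed C2 -> C1 `<=` measurable -> C2 `<=` measurable ->
  (forall A B, C1 A -> C2 B -> P (A `&` B) = P A * P B) ->
  forall A B, <<s C1 >> A -> <<s C2 >> B -> P (A `&` B) = P A * P B.
Proof.
move=> I1 I2 m1 m2 H A B sA sB.
have sm2 : <<s C2 >> `<=` measurable.
  by apply: smallest_sub => //; exact: sigma_algebra_measurable.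
rewrite setIC muleC; apply: (@indep_event_sigma B C1) => //; first exact: sm2.
move=> A' CA'; rewrite setIC muleC.
apply: (@indep_event_sigma A' C2) => //; first exact: m1.
by move=> B' CB'; exact: H.
Qed.

(** Only generators: the sigma-algebra of the variables indexed by [J] is [<<s sigX X J >>], and a
    functional of these variables is one measurable on [g_sigma_algebraType (sigX X J)]. *)
Definition sigX (I : finType) (X : I -> Omega -> R) (J : {set I}) :
    set_system Omega :=
  [set E | exists2 i, i \in J & preimage_set_system setT (X i) measurable E].

Lemma sigX_measurable (I : finType) (X : I -> Omega -> R) (J : {set I}) :
  (forall i, measurable_fun setT (X i)) -> <<s sigX X J >> `<=` measurable.
Proof.
move=> mX; apply: smallest_sub; first exact: sigma_algebra_measurable.
by move=> E [i _ [A mA <-]]; exact: mX.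
Qed.

Lemma sigX_sub (I : finType) (X : I -> Omega -> R) (J J' : {set I}) :
  J \subset J' -> <<s sigX X J >> `<=` <<s sigX X J' >>.
Proof.
move=> JJ'; apply: smallest_sub; first exact: smallest_sigma_algebra.
move=> E [i iJ mE]; apply: sub_sigma_algebra; exists i => //.
exact: (fintype.subsetP JJ').
Qed.

Lemma sigX_measurable_fun (I : finType) (X : I -> Omega -> R) (J : {set I}) i :
  i \in J -> measurable_fun (T := g_sigma_algebraType (sigX X J)) setT (X i).
Proof.
by move=> iJ _ A mA; apply: sub_sigma_algebra; exists i => //; exists A.
Qed.

(** The generators [sigX] are not stable under intersection; the finite rectangles [C J] are, and
    they generate the same events, so independence is checked on them. *)
Lemma indep_sigX (I : finType) (X : I -> Omega -> R) (J1 J2 : {set I}) :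
  (forall i, measurable_fun setT (X i)) -> independent_RVs P X ->
  (forall i, i \in J1 -> i \notin J2) ->
  forall A B, <<s sigX X J1 >> A -> <<s sigX X J2 >> B ->
    P (A `&` B) = P A * P B.
Proof.
move=> mX iX dJ.
pose C (J : {set I}) : set_system Omega := [set E | exists A : I -> set R,
  (forall i, measurable (A i)) /\ E = \bigcap_(i in [set` J]) (X i @^-1` A i)].
have IC J : setI_closed (C J).
  move=> _ _ [A [mA ->]] [B [mB ->]]; exists (fun i => A i `&` B i); split.
    by move=> i; exact: measurableI.
  by rewrite -bigcapI.
have mC J : C J `<=` measurable.
  move=> _ [A [mA ->]]; apply: fin_bigcap_measurable; first exact: finite_finset.
  by move=> i _; rewrite -[X in measurable X]setTI; exact: mX.
have sC J : <<s sigX X J >> `<=` <<s C J >>.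
  apply: smallest_sub; first exact: smallest_sigma_algebra.
  move=> E [i iJ [A mA <-]]; apply: sub_sigma_algebra.
  exists (fun i' => if i' == i then A else setT); split.
    by move=> i'; case: ifP.
  rewrite setTI; apply/seteqP; split => w /=.
    by move=> Aw i' _; case: eqP => [->|].
  by move/(_ i iJ); rewrite eqxx.
move=> A B sA sB; apply: (@indep_sigma (C J1) (C J2)) => //; last 2 first.
- exact: sC.
- exact: sC.
move=> _ _ [A1 [mA1 ->]] [A2 [mA2 ->]].
(* Since [J1] and [J2] are disjoint, both rectangles are cut out by a single family of sets, to
   which independence over the union of [J1] and [J2] applies. *)
pose A' i := if i \in J1 then A1 i else A2 i.
have mA' i : measurable (A' i) by rewrite /A'; case: ifP.
have E1 : \bigcap_(i in [set` J1]) (X i @^-1` A1 i) =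
          \bigcap_(i in [set` J1]) (X i @^-1` A' i).
  by apply: eq_bigcapr => i /= iJ; rewrite /A' iJ.
have E2 : \bigcap_(i in [set` J2]) (X i @^-1` A2 i) =
          \bigcap_(i in [set` J2]) (X i @^-1` A' i).
  apply: eq_bigcapr => i /= iJ; rewrite /A'.
  by rewrite ifN//; apply: contraL iJ => /dJ.
rewrite E1 E2.
have pA' (J : {set I}) : P (\bigcap_(i in [set` J]) (X i @^-1` A' i)) =
    \prod_(i in J) P (X i @^-1` A' i).
  by apply: iX => i _; exists (A' i) => //; rewrite setTI.
rewrite !pA' -bigU/=; last first.
  by rewrite disjoint_subset; apply/fintype.subsetP => i /dJ.
transitivity (\prod_(i in (J1 :|: J2)%SET) P (X i @^-1` A' i)); last first.
  by apply: eq_bigl => i; rewrite /= !inE.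
rewrite -pA' -bigcap_setU; congr (P (\bigcap_(i in _) _)).
by apply/seteqP; split => i /=; rewrite inE => /orP.
Qed.

Lemma indep_sigX_family (I : finType) (X : I -> Omega -> R) (K : nat)
    (J : nat -> {set I}) (E : nat -> set Omega) :
  (forall i, measurable_fun setT (X i)) -> independent_RVs P X ->
  (forall k l, (k < l)%N -> forall i, i \in J k -> i \notin J l) ->
  (forall k, <<s sigX X (J k) >> (E k)) ->
  P (\bigcap_(k < K) E k) = \prod_(k < K) P (E k).
Proof.
move=> mX iX dJ sE.
suff [] : <<s sigX X (\bigcup_(k < K) J k) >> (\bigcap_(k < K) E k) /\
  P (\bigcap_(k < K) E k) = \prod_(k < K) P (E k) by [].
have sgm J' : sigma_algebra setT <<s sigX X J' >> by exact: smallest_sigma_algebra.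
elim: K => [|K [IH1 IH2]].
  have -> : \bigcap_(k < 0) E k = setT by apply/seteqP; split.
  rewrite !big_ord0 probability_setT; split => //.
  by have := @measurableT _ (g_sigma_algebraType (sigX X finset.set0)).
rewrite !big_ord_recr/= IIS bigcap_setU bigcap_set1.
rewrite (@indep_sigX _ X (\bigcup_(k < K) J k) (J K))// ?IH2; last first.
  by move=> i /bigcupP[k _]; exact: dJ.
split => //.
apply: (@measurableI _ (g_sigma_algebraType (sigX X (\bigcup_(k < K) J k :|: J K)))).
  by apply: (sigX_sub _ IH1); exact: finset.subsetUl.
by apply: (sigX_sub _ (sE K)); exact: finset.subsetUr.
Qed.

End Independence.

Section NormalBounds.
Context {R : realType}.
Implicit Types s x l lam : R.

Lemma normal_peak_le s : 0 < s -> normal_peak s <= s^-1.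
Proof.
move=> s0; rewrite /normal_peak lef_pV2 ?posrE//; last first.
  by rewrite sqrtr_gt0 mulrn_wgt0// mulr_gt0 ?pi_gt0 ?exprn_gt0.
have {1}<- : Num.sqrt (s ^+ 2) = s by rewrite sqrtr_sqr ger0_norm ?ltW.
apply: ler_wsqrtr; rewrite -mulrnAr ler_peMr ?sqr_ge0//.
by have := @pi_ge2 R; lra.
Qed.

Lemma normal_peak_ge s : 0 < s -> (3 * s)^-1 <= normal_peak s.
Proof.
move=> s0; rewrite /normal_peak lef_pV2 ?posrE ?mulr_gt0//; last first.
  by rewrite sqrtr_gt0 mulrn_wgt0// mulr_gt0 ?pi_gt0 ?exprn_gt0.
have <- : Num.sqrt ((3 * s) ^+ 2) = 3 * s.
  by rewrite sqrtr_sqr ger0_norm// mulr_ge0// ltW.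
apply: ler_wsqrtr; rewrite exprMn -mulrnAr mulrC ler_wpM2r ?sqr_ge0//.
have := @pihalf_lt2 R; lra.
Qed.

Lemma normal_prob_itv_le s x l : 0 < s -> 0 <= l ->
  (normal_prob 0 s `[x, (x + l)%R]%classic <= (l / s)%:E)%E.
Proof.
move=> s0 l0.
apply: (@le_trans _ _ (\int[lebesgue_measure]_(y in `[x, (x + l)%R]) (cst (normal_peak s)%:E y))%E).
  apply: ge0_le_integral => //=.
  - by move=> y _; rewrite lee_fin normal_pdf_ge0.
  - by apply/measurable_EFinP; apply: measurable_funTS; exact: measurable_normal_pdf.
  - by move=> y _; rewrite lee_fin normal_pdf_ub ?gt_eqF.
rewrite integral_cst//= lebesgue_measure_itv/= lte_fin.
case: ifPn => [_|_]; last by rewrite mule0 lee_fin divr_ge0// ltW.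
rewrite -EFinB -EFinM lee_fin (_ : x + l - x = l); last by ring.
by rewrite mulrC ler_wpM2l// normal_peak_le.
Qed.

(** On [[- 2 s, 2 s]] the Gaussian exponent is at least [- 2], and the square root of [2 pi] is at
    most 3: hence the constant [expR (- 2) / 3]. *)
Lemma normal_prob_itv_ge s x l : 0 < s -> 0 <= l ->
  - (2 * s) <= x -> x + l <= 2 * s ->
  ((expR (- 2) / 3 * l / s)%:E <= normal_prob 0 s `[x, (x + l)%R]%classic)%E.
Proof.
move=> s0 l0 xs xls.
have key (z : R) : x <= z -> z <= x + l -> z ^+ 2 <= 2 * (s ^+ 2 *+ 2).
  move=> xz zl; have : 0 <= (2 * s - z) * (2 * s + z) by apply: mulr_ge0; lra.
  by rewrite -subr_sqr exprMn subr_ge0 -mulr_natr; lra.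
apply: (@le_trans _ _ (\int[lebesgue_measure]_(y in `[x, (x + l)%R]) (cst (expR (- 2) / (3 * s))%:E y))%E).
  rewrite integral_cst//= lebesgue_measure_itv/= lte_fin.
  case: ifPn => [_|]; last first.
    rewrite -leNgt => h; have -> : l = 0 by apply/eqP; rewrite eq_le l0 andbT; lra.
    by rewrite mulr0 mul0r mule0.
  rewrite -EFinB -EFinM lee_fin (_ : x + l - x = l); last by ring.
  by rewrite invfM; lra.
apply: ge0_le_integral => //=.
- by move=> y _; rewrite lee_fin divr_ge0 ?expR_ge0// mulr_ge0// ltW.
- by apply/measurable_EFinP; apply: measurable_funTS; exact: measurable_normal_pdf.
- move=> y; rewrite in_itv/= => /andP[xy yl]; rewrite lee_fin.
  rewrite normal_pdfE ?gt_eqF// mulrC ler_pM ?expR_ge0 ?invr_ge0 ?normal_peak_ge//.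
    by rewrite mulr_ge0// ltW.
  rewrite /normal_fun ler_expR subr0 mulNr lerN2 ler_pdivrMr ?mulrn_wgt0 ?exprn_gt0//.
  exact: key.
Qed.

(** Half of the exponent is spent on the bound: beyond [lam * s] the density is at most
    [2 * expR (- (lam ^+ 2 / 4))] times the normal density of standard deviation [Num.sqrt 2 * s],
    whose total mass is 1. *)
Lemma normal_prob_tail_le s lam : 0 < s -> 0 <= lam ->
  (normal_prob 0 s [set x : R | (lam * s < `|x|)%R] <= (2 * expR (- (lam ^+ 2 / 4)))%:E)%E.
Proof.
move=> s0 lam0; set A := [set x | _].
have mA : measurable A.
  by rewrite -[A]setTI; apply: measurable_fun_ltr => //; exact: normr_measurable.
pose c := 2 * expR (- (lam ^+ 2 / 4)).
pose t := Num.sqrt 2 * s.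
have t0 : 0 < t by rewrite mulr_gt0// sqrtr_gt0.
have t2 : t ^+ 2 = 2 * s ^+ 2 by rewrite exprMn sqr_sqrtr.
have pk : normal_peak s <= 2 * normal_peak t.
  rewrite /normal_peak t2; set u := s ^+ 2 * pi *+ 2.
  have u0 : 0 < u by rewrite mulrn_wgt0// mulr_gt0 ?pi_gt0 ?exprn_gt0.
  have -> : 2 * s ^+ 2 * pi *+ 2 = 2 * u by rewrite /u mulrnAr mulrA.
  rewrite sqrtrM// invfM mulrA ler_peMl ?invr_ge0 ?sqrtr_ge0//.
  rewrite ler_pdivlMr ?sqrtr_gt0// mul1r.
  have {2}<- : Num.sqrt (2 ^+ 2) = 2 :> R by rewrite sqrtr_sqr ger0_norm.
  by apply: ler_wsqrtr; rewrite expr2; lra.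
apply: (@le_trans _ _ (\int[lebesgue_measure]_(y in A) (c%:E * (normal_pdf 0 t y)%:E))%E).
  apply: ge0_le_integral => //=.
  - by move=> y _; rewrite lee_fin normal_pdf_ge0.
  - by apply/measurable_EFinP; apply: measurable_funTS; exact: measurable_normal_pdf.
  - by apply: measurable_funeM; apply/measurable_EFinP; apply: measurable_funTS; exact: measurable_normal_pdf.
  - move=> y Ay; rewrite -EFinM lee_fin !normal_pdfE ?gt_eqF//.
    rewrite /c mulrACA ler_pM ?expR_ge0 ?normal_peak_ge0//.
    rewrite /normal_fun -expRD ler_expR subr0 t2.
    have y2 : lam ^+ 2 * s ^+ 2 <= y ^+ 2.
      by rewrite -exprMn -(real_normK (num_real y)) lerXn2r ?nnegrE ?mulr_ge0 ?(ltW s0)// ltW.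
    have s20 : s ^+ 2 != 0 by rewrite gt_eqF// exprn_gt0.
    rewrite -subr_ge0 [X in 0 <= X](_ : _ = (y ^+ 2 - lam ^+ 2 * s ^+ 2) / (4 * s ^+ 2)).
      by rewrite divr_ge0 ?subr_ge0// mulr_ge0 ?sqr_ge0.
    by field; rewrite gt_eqF.
rewrite ge0_integralZl//=; last 3 first.
  by apply/measurable_EFinP; apply: measurable_funTS; exact: measurable_normal_pdf.
  by move=> y _; rewrite lee_fin normal_pdf_ge0.
  by rewrite lee_fin mulr_ge0 ?expR_ge0.
rewrite -[leRHS]mule1 lee_wpmul2l ?lee_fin ?mulr_ge0 ?expR_ge0//.
exact: (@probability_le1 _ _ _ (normal_prob 0 t)).
Qed.

End NormalBounds.

(** * Conditioning on an independent variable by Fubini's theorem *)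

Section ProductBounds.
Context {R : realType} {disp d1 d2 : measure_display}.
Context {Omega : measurableType disp} {T1 : measurableType d1}.
Context {T2 : measurableType d2}.
Variable P : probability Omega R.
Variables (Y : Omega -> T1) (U : Omega -> T2) (G : set Omega).
Hypotheses (mY : measurable_fun setT Y) (mU : measurable_fun setT U).
Hypothesis mG : measurable G.
Local Open Scope ereal_scope.
Hypothesis indYU : forall A B, measurable A -> measurable B ->
  P (G `&` Y @^-1` A `&` U @^-1` B) = P (G `&` Y @^-1` A) * P (U @^-1` B).

Let YU : Omega -> (T1 * T2)%type := fun w => (Y w, U w).

(* Found by unification when [m'] is declared a measure. *)
Let mYU : measurable_fun setT YU.
Proof. exact: measurable_fun_pair. Qed.

Let mPre d (T : measurableType d) (V : Omega -> T) A :
  measurable_fun setT V -> measurable A -> measurable (V @^-1` A).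
Proof. by move=> mV mA; rewrite -[_ @^-1` _]setTI; exact: mV. Qed.

Let m1 := pushforward (mrestr P mG) Y.
Let m2 := pushforward P U.
Let m' := pushforward (mrestr P mG) YU.

Let m1_0 : m1 set0 = 0. Proof. exact: measure0. Qed.
Let m1_ge0 A : 0 <= m1 A. Proof. exact: measure_ge0. Qed.
Let m1_sa : semi_sigma_additive m1.
Proof. exact: (@measure_semi_sigma_additive _ _ _ (pushforward (mrestr P mG) Y)). Qed.
HB.instance Definition _ := isMeasure.Build _ _ _ m1 m1_0 m1_ge0 m1_sa.
Let m1_fin : fin_num_fun m1.
Proof.
move=> A mA; rewrite /m1 /pushforward /mrestr fin_num_measure//.
by apply: measurableI => //; exact: mPre.
Qed.
HB.instance Definition _ := @Measure_isFinite.Build _ _ _ m1 m1_fin.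

Let m2_0 : m2 set0 = 0. Proof. exact: measure0. Qed.
Let m2_ge0 A : 0 <= m2 A. Proof. exact: measure_ge0. Qed.
Let m2_sa : semi_sigma_additive m2.
Proof. exact: (@measure_semi_sigma_additive _ _ _ (pushforward P U)). Qed.
HB.instance Definition _ := isMeasure.Build _ _ _ m2 m2_0 m2_ge0 m2_sa.
Let m2_fin : fin_num_fun m2.
Proof. by move=> A mA; apply: fin_num_measure; exact: mPre. Qed.
HB.instance Definition _ := @Measure_isFinite.Build _ _ _ m2 m2_fin.

Let m'_0 : m' set0 = 0. Proof. exact: measure0. Qed.
Let m'_ge0 A : 0 <= m' A. Proof. exact: measure_ge0. Qed.
Let m'_sa : semi_sigma_additive m'.
Proof. exact: (@measure_semi_sigma_additive _ _ _ (pushforward (mrestr P mG) YU)). Qed.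
HB.instance Definition _ := isMeasure.Build _ _ _ m' m'_0 m'_ge0 m'_sa.

(** Under [P] restricted to [G], the law of [(Y, U)] is the product of the law of [Y] and the
    unrestricted law of [U], by uniqueness of product measures. Carrying [G] as a restriction avoids
    conditional probabilities. *)
Lemma indep_fubini (S : set (T1 * T2)) : measurable S ->
  P (G `&` [set w | S (Y w, U w)]) =
  \int[m1]_y P (U @^-1` (xsection S y)).
Proof.
move=> mS.
have := @product_measure_unique _ _ _ _ _ m1 m2 m'.
have h A B : measurable A -> measurable B -> m' (A `*` B) = m1 A * m2 B.
  move=> mA mB; rewrite /m' /m1 /m2 /pushforward /mrestr.
  rewrite [X in P X](_ : _ = G `&` Y @^-1` A `&` U @^-1` B).
    by rewrite indYU// (setIC G).
  by apply/seteqP; split => w /=; tauto.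
move=> /(_ h S mS) /=.
rewrite /product_measure1/= => ->.
by rewrite /m' /pushforward /mrestr setIC.
Qed.

Lemma indep_prob_le (S : set (T1 * T2)) (q : R) : measurable S ->
  (forall y, P (U @^-1` (xsection S y)) <= q%:E) ->
  P (G `&` [set w | S (Y w, U w)]) <= q%:E * P G.
Proof.
move=> mS Sq; rewrite indep_fubini//.
apply: (@le_trans _ _ (\int[m1]_y cst q%:E y)).
  apply: ge0_le_integral => //.
  exact: (measurable_fun_xsection m2).
rewrite integral_cst//= /m1 /pushforward /mrestr/=.
by rewrite preimage_setT setTI.
Qed.

Lemma indep_prob_ge (S : set (T1 * T2)) (D : set T1) (q : R) :
  measurable S -> measurable D -> (0 <= q)%R ->
  (forall y, D y -> q%:E <= P (U @^-1` (xsection S y))) ->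
  q%:E * P (G `&` Y @^-1` D) <= P (G `&` [set w | S (Y w, U w)]).
Proof.
move=> mS mD q0 Sq; rewrite indep_fubini//.
apply: (@le_trans _ _ (\int[m1]_(y in D) P (U @^-1` (xsection S y)))); last first.
  by apply: ge0_subset_integral => //; exact: (measurable_fun_xsection m2).
apply: (@le_trans _ _ (\int[m1]_(y in D) cst q%:E y)).
  by rewrite integral_cst//= /m1 /pushforward /mrestr/= setIC.
apply: ge0_le_integral => //.
apply: measurable_funTS; exact: (measurable_fun_xsection m2).
Qed.

End ProductBounds.

Section Concentration.
Context {R : realType} {disp : measure_display} {Omega : measurableType disp}.
Variable P : probability Omega R.
Variables (I : finType) (X : I -> Omega -> R) (J1 J2 : {set I}).
Hypotheses (mX : forall i, measurable_fun setT (X i)) (iX : independent_RVs P X).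
Hypothesis dJ : forall i, i \in J1 -> i \notin J2.
Variables (U Y : Omega -> R) (G : set Omega) (r : R).
Hypothesis mU : measurable_fun (T := g_sigma_algebraType (sigX X J1)) setT U.
Hypothesis mY : measurable_fun (T := g_sigma_algebraType (sigX X J2)) setT Y.
Hypothesis mG : <<s sigX X J2 >> G.
Local Open Scope ereal_scope.

Let mW (J : {set I}) (V : Omega -> R) :
  measurable_fun (T := g_sigma_algebraType (sigX X J)) setT V ->
  measurable_fun setT V.
Proof. by move=> mV _ A mA; apply: (sigX_measurable mX); exact: mV. Qed.

Let indYU (A B : set R) : measurable A -> measurable B ->
  P (G `&` Y @^-1` A `&` U @^-1` B) = P (G `&` Y @^-1` A) * P (U @^-1` B).
Proof.
move=> mA mB; rewrite setIC muleC.
apply: (indep_sigX mX iX dJ).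
  by rewrite -[U @^-1` _]setTI; exact: mU.
apply: (@measurableI _ (g_sigma_algebraType (sigX X J2))) => //.
by rewrite -[Y @^-1` _]setTI; exact: mY.
Qed.

Let S : set (R * R) := [set yu | (`|yu.2 + yu.1| <= r)%R].

Let mS : measurable S.
Proof.
rewrite -[S]setTI; apply: measurable_fun_ler => //.
apply: measurableT_comp; first exact: normr_measurable.
by apply: measurable_funD; [exact: measurable_snd|exact: measurable_fst].
Qed.

Let xS y : U @^-1` xsection S y = U @^-1` `[(- y - r)%R, (- y - r + 2 * r)%R]%classic.
Proof.
apply/seteqP; split=> w /=; rewrite /xsection/= in_itv/= inE /S/= ler_norml => /andP[? ?].
  by apply/andP; split; lra.
by apply/andP; split; lra.
Qed.

(* Conditionally on [Y] and [G], the event asks that [U] lie in an interval of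
   length [2 * r]. *)
Lemma concentration_le (q : R) :
  (forall x, P (U @^-1` `[x, (x + 2 * r)%R]%classic) <= q%:E) ->
  P (G `&` [set w | (`|U w + Y w| <= r)%R]) <= q%:E * P G.
Proof.
move=> Uq; apply: (@indep_prob_le _ _ _ _ _ _ _ P Y U G _ _ _ _ S) => //.
- exact: mW mY.
- exact: mW mU.
- exact: (sigX_measurable mX mG).
- by move=> y; rewrite xS.
Qed.

(** A Gaussian [U] charges an interval substantially only near its mean, so the shift [Y] is
    confined to a set [D] on which the lower bound is available. *)
Lemma concentration_ge (D : set R) (q : R) : measurable D -> (0 <= q)%R ->
  (forall y, D y -> q%:E <= P (U @^-1` `[(- y - r)%R, (- y - r + 2 * r)%R]%classic)) ->
  q%:E * P (G `&` Y @^-1` D) <= P (G `&` [set w | (`|U w + Y w| <= r)%R]).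
Proof.
move=> mD q0 Uq; apply: (@indep_prob_ge _ _ _ _ _ _ _ P Y U G _ _ _ _ S) => //.
- exact: mW mY.
- exact: mW mU.
- exact: (sigX_measurable mX mG).
- by move=> y Dy; rewrite xS; exact: Uq.
Qed.

End Concentration.

(** * Independent grid increments *)

Section Grid.
Context {R : realType} {disp : measure_display} {Omega : measurableType disp}.
Variable P : probability Omega R.
Variables (d : nat) (B : R -> Omega -> 'rV[R]_d).
Hypothesis hB : brownian_motion P B.

Definition gridt (n j : nat) : R := j%:R / 2 ^+ n.

Definition gridB n (c : 'I_d) j w : R := B (gridt n j) w ord0 c.

(** All coordinates and all grid steps form one finite independent family, so that independence of
    path functionals reduces to disjointness of index sets [gridJ N Q]. *)
Definition gridI n N (x : 'I_d * 'I_N) w : R :=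
  gridB n x.1 x.2.+1 w - gridB n x.1 x.2 w.

Definition gridJ N (Q : 'I_d -> nat -> bool) : {set 'I_d * 'I_N} :=
  [set x : 'I_d * 'I_N | Q x.1 x.2]%SET.

Lemma gridt_ge0 n j : 0 <= gridt n j.
Proof. by rewrite divr_ge0// exprn_ge0. Qed.

Lemma gridt_S n j : gridt n j.+1 = gridt n j + 2 ^- n.
Proof. by rewrite /gridt -[j.+1%:R]natr1 mulrDl mul1r. Qed.

Lemma gridt_nd n : nondecreasing_seq (gridt n).
Proof. by move=> j k jk; rewrite ler_wpM2r ?invr_ge0 ?exprn_ge0// ler_nat. Qed.

Lemma gridtB n j k : (j <= k)%N -> gridt n k - gridt n j = (k - j)%:R / 2 ^+ n.
Proof. by move=> jk; rewrite /gridt -mulrBl natrB. Qed.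

Lemma gridI_measurable n N (x : 'I_d * 'I_N) : measurable_fun setT (gridI n x).
Proof.
by apply: measurable_funB; apply: (bm1_measurable (bm_coordinates hB _)); exact: gridt_ge0.
Qed.

(** The event is regrouped by coordinate: each group lies in the sigma-algebra of its coordinate,
    which gives a product over coordinates, and the increments of one coordinate then split each
    factor. *)
Lemma gridI_indep n N : independent_RVs P (@gridI n N).
Proof.
move=> J E hE.
pose Jc (c : 'I_d) := [set j | (c, j) \in J]%SET.
pose F (c : 'I_d) := \bigcap_(j in [set` Jc c]) E (c, j).
have hE' c j : j \in Jc c -> preimage_set_system setT (@gridI n N (c, j)) measurable (E (c, j)).
  by rewrite inE => /hE.
have -> : \bigcap_(i in [set` J]) E i = \bigcap_(c in [set` (finset.setTfor 'I_d)]) F c.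
  apply/seteqP; split => w /=.
    by move=> h c _ j /=; rewrite inE => /h.
  by move=> h [c j] /= cj; apply: (h c) => //=; rewrite inE.
have -> : P (\bigcap_(c in [set` (finset.setTfor 'I_d)]) F c) =
    (\prod_(c in finset.setTfor 'I_d) P (F c))%E.
  apply: (bm_independent_coordinates hB) => c _.
  set sg := process_sigma_algebra _.
  have msg (t : R) : 0 <= t -> measurable_fun (T := g_sigma_algebraType
      [set E | exists2 t : R, 0 <= t &
         preimage_set_system setT (fun w => B t w ord0 c) measurable E])
      setT (fun w => B t w ord0 c).
    move=> t0 _ A mA; apply: sub_sigma_algebra; exists t => //; exists A => //.
  apply: (@fin_bigcap_measurable _ (g_sigma_algebraType
      [set E | exists2 t : R, 0 <= t &
         preimage_set_system setT (fun w => B t w ord0 c) measurable E])).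
    exact: finite_finset.
  move=> j /= jJ; have [A mA <-] := hE' _ _ jJ.
  by apply: measurable_funB => //; exact: msg (gridt_ge0 _ _).
transitivity (\prod_(c in finset.setTfor 'I_d) \prod_(j in Jc c) P (E (c, j)))%E.
  apply: eq_bigr => c _.
  have := @bm1_independent_increments _ _ _ _ _ (bm_coordinates hB c) N _ (gridt_ge0 n 0%N) (gridt_nd n).
  by move=> /(_ (Jc c) (fun j => E (c, j))); apply => j /hE'.
rewrite pair_big_dep/=; apply: eq_big => [[c j]|[c j] _]//=.
by rewrite !inE.
Qed.

Lemma gridB_measurable_fun n N (Q : 'I_d -> nat -> bool) c j k : (j <= k <= N)%N ->
  (forall i, (j <= i < k)%N -> Q c i) ->
  measurable_fun (T := g_sigma_algebraType (sigX (@gridI n N) (gridJ N Q))) setT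
    (fun w => gridB n c k w - gridB n c j w).
Proof.
move=> /andP[jk kN] hQ.
rewrite (_ : (fun w => _) = (fun w => \sum_(i <- enum 'I_N)
   if (j <= i < k)%N then gridI n (c, i) w else 0)); last first.
  apply/funext => w; rewrite -(telescope_sumr (fun i => gridB n c i w))//.
  rewrite -big_mkcond/= big_enum_cond/=.
  rewrite big_nat_cond (big_nat_widen _ _ N)//.
  rewrite (big_nat_widenl j 0%N)// big_mkord.
  apply: eq_bigl => i /=.
  by rewrite andbT; lia.
apply: (@measurable_sum _ (g_sigma_algebraType (sigX (@gridI n N) (gridJ N Q)))
  R setT 'I_N (enum 'I_N) (fun (i : 'I_N) (w : Omega) =>
  if (j <= i < k)%N then gridI n (c, i) w else 0)) => i.
case E : (j <= i < k)%N; last exact: measurable_cst.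
by apply: sigX_measurable_fun; rewrite inE; exact: hQ.
Qed.

Lemma gridB_gauss n c j k (A : set R) : (j < k)%N -> measurable A ->
  P ((fun w => gridB n c k w - gridB n c j w) @^-1` A) =
  normal_prob 0 (Num.sqrt ((k - j)%:R / 2 ^+ n)) A.
Proof.
move=> jk mA.
have h : gridt n j < gridt n k.
  by rewrite -subr_gt0 gridtB ?(ltnW jk)// divr_gt0 ?exprn_gt0// ltr0n subn_gt0.
have := @bm1_gaussian_increments _ _ _ _ _ (bm_coordinates hB c) _ _ (gridt_ge0 n j) h A mA.
by rewrite gridtB// ltnW.
Qed.

End Grid.

(** * Grid times, hits and second moments *)

Section SecondMoment.
Context {R : realType} {disp : measure_display} {Omega : measurableType disp}.
Variable P : probability Omega R.

Definition prob (A : set Omega) : R := fine (P A).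

Lemma probE A : measurable A -> P A = (prob A)%:E.
Proof. by move=> mA; rewrite /prob fineK// fin_num_measure. Qed.

Lemma prob_ge0 A : 0 <= prob A.
Proof. exact/fine_ge0/measure_ge0. Qed.

Lemma prob_eq0 A : measurable A -> prob A <= 0 -> P A = 0%E.
Proof. by move=> mA A0; rewrite probE//; congr _%:E; apply/le_anti; rewrite A0 prob_ge0. Qed.

Lemma prob_le1 A : measurable A -> prob A <= 1.
Proof. by move=> mA; rewrite -lee_fin -probE// probability_le1. Qed.

Lemma le_prob A B : measurable A -> measurable B -> A `<=` B -> prob A <= prob B.
Proof. by move=> mA mB AB; rewrite -lee_fin -!probE// le_measure ?inE. Qed.

Lemma prob_setC A : measurable A -> prob (~` A) = 1 - prob A.
Proof.
move=> mA; apply: EFin_inj; rewrite -probE; last exact: measurableC.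
by rewrite probability_setC// probE.
Qed.

Lemma integral_sum_indic (I : finType) (E : I -> set Omega) (a : I -> R) :
  (forall i, measurable (E i)) -> (forall i, 0 <= a i) ->
  (\int[P]_w (\sum_i a i * \1_(E i) w)%:E = (\sum_i a i * prob (E i))%:E)%E.
Proof.
move=> mE a0; under eq_integral do rewrite -sumEFin.
rewrite ge0_integral_sum//=; last 2 first.
- by move=> i; apply/measurable_EFinP; apply: measurable_funM.
- by move=> i w _; rewrite lee_fin mulr_ge0.
rewrite -sumEFin; apply: eq_bigr => i _.
under eq_integral do rewrite EFinM.
rewrite ge0_integralZl_EFin//=; last first.
  by apply/measurable_EFinP; exact: measurable_indic.
by rewrite integral_indic// setIT EFinM; congr (_ * _)%E; exact: probE.
Qed.

Lemma prob_sum_le (I : finType) (E : I -> set Omega) (a : I -> R)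
    (A : set Omega) (b : R) :
  (forall i, measurable (E i)) -> (forall i, 0 <= a i) -> measurable A ->
  0 <= b ->
  (forall w, A w -> b <= \sum_i a i * \1_(E i) w) ->
  b * prob A <= \sum_i a i * prob (E i).
Proof.
move=> mE a0 mA b0 h.
have -> : b * prob A = \sum_(i < 1) b * prob A by rewrite big_ord1.
rewrite -lee_fin -!integral_sum_indic//.
have ms (J : finType) (F : J -> set Omega) (f : J -> R) :
    (forall j, measurable (F j)) ->
    measurable_fun setT (fun w => (\sum_j f j * \1_(F j) w)%:E : \bar R).
  move=> mF; apply/measurable_EFinP; apply: measurable_sum => j.
  by apply: measurable_funM => //; exact: measurable_indic.
apply: ge0_le_integral => //.
- by move=> w _; rewrite lee_fin big_ord1 mulr_ge0.
- exact: ms.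
- exact: ms.
- move=> w _; rewrite lee_fin big_ord1 indicE.
  have [/set_mem Aw|_] := boolP (w \in A); first by rewrite mulr1 h.
  by rewrite mulr0 sumr_ge0// => i _; rewrite mulr_ge0// indicE.
Qed.

Lemma prob_bigcup_le (I : finType) (E : I -> set Omega) (A : set Omega) :
  measurable A -> (forall i, measurable (E i)) ->
  (forall w, A w -> exists i, E i w) -> prob A <= \sum_i prob (E i).
Proof.
move=> mA mE AE; rewrite -[leLHS]mul1r.
under eq_bigr do rewrite -[prob _]mul1r.
apply: prob_sum_le => // w /AE[i Ei].
rewrite (bigD1 i)//= indicE mem_set// mulr1 lerDl.
by apply: sumr_ge0 => j _; rewrite mul1r indicE.
Qed.

(** Let [M] be the mass, [Q] the energy and [b = 4 * C / c]. As [1 <= k], [M ^+ 2 <= Q], so that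
    [M <= c / 2 + Q / b + b * \1_A] pointwise: off the target event either [M < c / 2], or
    [b ^+ 2 < Q] and then [b * M <= Q]. Integrating, [c <= c / 2 + c / 4 + b * prob A]. A single
    event thus controls mass and energy together. *)
Lemma second_moment (I : finType) (E : I -> set Omega) (v c C : R)
    (k : I -> I -> R) :
  (forall i, measurable (E i)) -> 0 <= v -> 0 < c -> 0 < C ->
  (forall i j, 1 <= k i j) ->
  c <= v * \sum_i prob (E i) ->
  v ^+ 2 * \sum_i \sum_j k i j * prob (E i `&` E j) <= C ->
  c ^+ 2 / (16 * C) <=
  prob [set w | c / 2 <= v * \sum_i \1_(E i) w /\
    v ^+ 2 * \sum_i \sum_j k i j * (\1_(E i) w * \1_(E j) w) <= (4 * C / c) ^+ 2].
Proof.
move=> mE v0 c0 C0 k1 hM hQ; set A := [set w | _].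
have k0 i j : 0 <= k i j by rewrite (le_trans _ (k1 i j)).
pose M w := v * \sum_i \1_(E i) w : R.
pose Q w := v ^+ 2 * \sum_i \sum_j k i j * (\1_(E i) w * \1_(E j) w) : R.
have mI (F : set Omega) : measurable F -> measurable_fun setT (\1_F : Omega -> R).
  by move=> mF; exact: measurable_indic.
have mM : measurable_fun setT M.
  by apply: measurable_funM => //; apply: measurable_sum => i; exact: mI.
have mQ : measurable_fun setT Q.
  apply: measurable_funM => //; apply: measurable_sum => i; apply: measurable_sum => j.
  by apply: measurable_funM => //; apply: measurable_funM; exact: mI.
have mA : measurable A.
  rewrite [A](_ : _ = [set w | c / 2 <= M w] `&` [set w | Q w <= (4 * C / c) ^+ 2])//.
  apply: measurableI; rewrite -[X in measurable X]setTI.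
    exact: measurable_fun_ler.
  exact: measurable_fun_ler.
have i01 (F : set Omega) w : 0 <= \1_F w :> R by rewrite indicE.
have M0 w : 0 <= M w by rewrite mulr_ge0// sumr_ge0.
have Q0 w : 0 <= Q w.
  rewrite mulr_ge0 ?sqr_ge0// sumr_ge0// => i _; rewrite sumr_ge0// => j _.
  by rewrite mulr_ge0// mulr_ge0.
have MQ w : M w ^+ 2 <= Q w.
  rewrite /M /Q exprMn ler_wpM2l ?sqr_ge0// expr2 mulr_suml ler_sum// => i _.
  rewrite mulr_sumr ler_sum// => j _.
  by rewrite ler_peMl ?mulr_ge0.
pose b := 4 * C / c.
have b0 : 0 < b by rewrite divr_gt0// mulr_gt0.
have bi0 : 0 <= b^-1 by rewrite invr_ge0 ltW.
have mQE : measurable_fun setT (fun w => (Q w)%:E : \bar R) by exact/measurable_EFinP.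
have mAE : measurable_fun setT (fun w => (\1_A w : R)%:E : \bar R) by apply/measurable_EFinP; exact: mI.
have key w : M w <= c / 2 + b^-1 * Q w + b * \1_A w.
  have [Aw|nAw] := pselect (A w).
    rewrite indicE mem_set//= mulr1.
    have : M w <= b.
      rewrite -(@ler_pXn2r _ 2)// ?nnegrE ?M0 ?(ltW b0)//.
      by apply: le_trans (MQ w) _; case: Aw.
    have : 0 <= b^-1 * Q w by rewrite mulr_ge0// invr_ge0 ltW.
    have : 0 <= c / 2 by rewrite divr_ge0// ltW.
    lra.
  rewrite indicE memNset//= mulr0 addr0.
  have [Mc|cM] := ltP (M w) (c / 2).
    have : 0 <= b^-1 * Q w by rewrite mulr_ge0// invr_ge0 ltW.
    lra.
  have bQ : b ^+ 2 < Q w by rewrite ltNge; apply/negP => Qb; apply: nAw.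
  have : M w <= b^-1 * Q w.
    rewrite mulrC ler_pdivlMr//.
    have [Mb|bM] := leP (M w) b.
      by apply: le_trans (ltW bQ); rewrite expr2 ler_wpM2r// ltW.
    by apply: le_trans (MQ w); rewrite expr2 ler_wpM2l// ltW.
  have : 0 <= c / 2 by rewrite divr_ge0// ltW.
  lra.
have EM : (\int[P]_w (M w)%:E = (v * \sum_i prob (E i))%:E)%E.
  rewrite mulr_sumr -integral_sum_indic//.
  by apply: eq_integral => w _; rewrite /M mulr_sumr.
have EQ : (\int[P]_w (Q w)%:E = (v ^+ 2 * \sum_i \sum_j k i j * prob (E i `&` E j))%:E)%E.
  rewrite pair_bigA/= mulr_sumr.
  rewrite [X in X%:E](eq_bigr (fun x => v ^+ 2 * k x.1 x.2 * prob (E x.1 `&` E x.2))); last first.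
    by move=> x _; rewrite mulrA.
  rewrite -(@integral_sum_indic _ (fun x : I * I => E x.1 `&` E x.2) (fun x : I * I => v ^+ 2 * k x.1 x.2))//; last 2 first.
  - by move=> x; exact: measurableI.
  - by move=> x; rewrite mulr_ge0// sqr_ge0.
  apply: eq_integral => w _; rewrite /Q pair_bigA/= mulr_sumr; congr (_%:E).
  by apply: eq_bigr => x _; rewrite indicI mulrA.
have : (\int[P]_w (M w)%:E <= \int[P]_w (c / 2 + b^-1 * Q w + b * \1_A w)%:E)%E.
  apply: ge0_le_integral => //=.
  - by move=> w _; rewrite lee_fin.
  - exact/measurable_EFinP.
  - apply/measurable_EFinP; apply: measurable_funD.
      by apply: measurable_funD => //; exact: measurable_funM.
    by apply: measurable_funM => //; exact: mI.
  - by move=> w _; rewrite lee_fin.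
have -> : (\int[P]_w (c / 2 + b^-1 * Q w + b * \1_A w)%:E =
  (c / 2 + b^-1 * (v ^+ 2 * \sum_i \sum_j k i j * prob (E i `&` E j)) + b * prob A)%:E)%E.
  under eq_integral do rewrite !EFinD.
  rewrite ge0_integralD//=; last 4 first.
  - move=> w _; rewrite -EFinD lee_fin addr_ge0 ?divr_ge0 ?(ltW c0)//.
    by rewrite mulr_ge0// invr_ge0 ltW.
  - apply/measurable_EFinP.
    by apply: measurable_funD => //; exact: measurable_funM.
  - by move=> w _; rewrite lee_fin mulr_ge0// ltW.
  - by apply/measurable_EFinP; apply: measurable_funM => //; exact: mI.
  rewrite ge0_integralD//=; last 3 first.
  - by move=> w _; rewrite lee_fin divr_ge0// ltW.
  - by move=> w _; rewrite lee_fin mulr_ge0// invr_ge0 ltW.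
  - by apply/measurable_EFinP; exact: measurable_funM.
  rewrite integral_cst//= probability_setT mule1.
  under eq_integral do rewrite EFinM.
  rewrite ge0_integralZl_EFin//=; last by move=> w _; rewrite lee_fin.
  under [X in (_ + X)%E]eq_integral do rewrite EFinM.
  rewrite ge0_integralZl_EFin//=; last exact: ltW.
  rewrite integral_indic// setIT EQ !EFinD !EFinM; congr (_ + _ * _)%E.
  exact: probE.
rewrite EM lee_fin => h.
have {h} : c <= c / 2 + b^-1 * C + b * prob A.
  apply: le_trans hM _; apply: le_trans h _; rewrite lerD2r lerD2l.
  by rewrite ler_wpM2l// invr_ge0 ltW.
have -> : b^-1 * C = c / 4 by rewrite /b; field; rewrite !gt_eqF.
move=> h.
have {}h : c / 4 <= b * prob A by lra.
rewrite ler_pdivrMr ?mulr_gt0//.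
have -> : c ^+ 2 = 4 * c * (c / 4) by field.
have -> : prob A * (16 * C) = 4 * c * (b * prob A).
  by rewrite /b; field; rewrite gt_eqF.
by rewrite ler_wpM2l// mulr_ge0// ltW.
Qed.

End SecondMoment.

Section Hits.
Context {R : realType} {disp : measure_display} {Omega : measurableType disp}.
Variable P : probability Omega R.
Variables (d : nat) (B : R -> Omega -> 'rV[R]_d).
Hypothesis hB : brownian_motion P B.

(** The standard deviation of one grid step. *)
Definition rad n : R := Num.sqrt (2 ^- n).

Lemma rad_gt0 n : 0 < rad n.
Proof. by rewrite sqrtr_gt0 invr_gt0 exprn_gt0. Qed.

Lemma sqrt_rad n m : Num.sqrt (m%:R / 2 ^+ n) = Num.sqrt m%:R * rad n.
Proof. by rewrite sqrtrM. Qed.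

Definition gridD n c j k w : R := gridB B n c k w - gridB B n c j w.

Lemma gridD_measurable n c j k : measurable_fun setT (gridD n c j k).
Proof.
by apply: measurable_funB; apply: (bm1_measurable (bm_coordinates hB _)); exact: gridt_ge0.
Qed.

Lemma gridD_measurable_fun n N (Q : 'I_d -> nat -> bool) c j k :
  (j <= N)%N -> (k <= N)%N ->
  (forall i, (minn j k <= i < maxn j k)%N -> Q c i) ->
  measurable_fun (T := g_sigma_algebraType (sigX (@gridI R _ _ d B n N) (gridJ N Q))) setT
    (gridD n c j k).
Proof.
move=> jN kN hQ; have [jk|kj] := leqP j k.
  apply: gridB_measurable_fun; rewrite ?jk//.
  by move=> i /andP[? ?]; apply: hQ; lia.
rewrite (_ : gridD _ _ _ _ = (fun w => - gridD n c k j w)); last first.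
  by apply/funext => w; rewrite opprB.
apply: measurableT_comp => //; apply: gridB_measurable_fun; rewrite ?jN ?(ltnW kj)//.
by move=> i /andP[? ?]; apply: hQ; lia.
Qed.

Lemma gridD_itv_le n c j k m (x l : R) : (0 < m)%N -> (j + m = k \/ k + m = j)%N -> 0 <= l ->
  (P (gridD n c j k @^-1` `[x, (x + l)%R]%classic) <=
  (l / (Num.sqrt m%:R * rad n))%:E)%E.
Proof.
move=> m0 jkm l0.
have s0 : 0 < Num.sqrt m%:R * rad n by rewrite mulr_gt0 ?rad_gt0 ?sqrtr_gt0 ?ltr0n.
have h y j' : (P (gridD n c j' (j' + m)%N @^-1` `[y, (y + l)%R]%classic) <=
  (l / (Num.sqrt m%:R * rad n))%:E)%E.
  rewrite (gridB_gauss hB)//; last by rewrite -[X in (X < _)%N]addn0 ltn_add2l.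
  by rewrite addKn sqrt_rad normal_prob_itv_le.
case: jkm => <-; first exact: h.
rewrite (_ : _ @^-1` _ = gridD n c k (k + m)%N @^-1` `[(- x - l)%R, (- x - l + l)%R]%classic); first exact: h.
apply/seteqP; split => w /=; rewrite /gridD !in_itv/= => /andP[? ?];
  apply/andP; split; lra.
Qed.

Lemma gridD_itv_ge n c j m (x l : R) : (0 < m)%N -> 0 <= l ->
  - (2 * (Num.sqrt m%:R * rad n)) <= x -> x + l <= 2 * (Num.sqrt m%:R * rad n) ->
  ((expR (- 2) / 3 * l / (Num.sqrt m%:R * rad n))%:E <=
  P (gridD n c j (j + m)%N @^-1` `[x, (x + l)%R]%classic))%E.
Proof.
move=> m0 l0 xs xls.
have s0 : 0 < Num.sqrt m%:R * rad n by rewrite mulr_gt0 ?rad_gt0 ?sqrtr_gt0 ?ltr0n.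
rewrite (gridB_gauss hB)//; last by rewrite -[X in (X < _)%N]addn0 ltn_add2l.
by rewrite addKn sqrt_rad normal_prob_itv_ge.
Qed.

Definition hit1 n (r : R) c j k : set Omega :=
  [set w | `|gridD n c j k w| <= r].

Definition hit n (r : R) j k : set Omega := \bigcap_(c in setT) hit1 n r c j k.

Lemma hit1_measurable n r c j k : measurable (hit1 n r c j k).
Proof.
rewrite -[hit1 _ _ _ _ _]setTI; apply: measurable_fun_ler => //.
by apply: measurableT_comp; [exact: normr_measurable|exact: gridD_measurable].
Qed.

Lemma hit_measurable n r j k : measurable (hit n r j k).
Proof.
apply: fin_bigcap_measurable => //; last by move=> c _; exact: hit1_measurable.
Qed.

Lemma hit1_process n r c j k :
  process_sigma_algebra (fun t w => B t w ord0 c) (hit1 n r c j k).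
Proof.
pose T := g_sigma_algebraType [set E | exists2 t : R, 0 <= t &
         preimage_set_system setT (fun w => B t w ord0 c) measurable E].
have msg (t : R) : 0 <= t ->
    measurable_fun (T := T) setT (fun w => B t w ord0 c).
  by move=> t0 _ A mA; apply: sub_sigma_algebra; exists t => //; exists A.
have : @measurable _ T (hit1 n r c j k).
  rewrite -[hit1 _ _ _ _ _]setTI; apply: measurable_fun_ler => //.
  apply: measurableT_comp; first exact: normr_measurable.
  by apply: measurable_funB; exact: msg (gridt_ge0 _ _).
by [].
Qed.

Lemma prob_coord (E : 'I_d -> set Omega) :
  (forall c, process_sigma_algebra (fun t w => B t w ord0 c) (E c)) ->
  prob P (\bigcap_(c in setT) E c) = \prod_c prob P (E c).
Proof.
move=> hE; have mE c : measurable (E c).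
  apply: (smallest_sub (sigma_algebra_measurable _) _ (hE c)).
  move=> F [t t0 [A mA <-]].
  exact: (bm1_measurable (bm_coordinates hB c)).
have := bm_independent_coordinates hB (J := finset.setTfor 'I_d) (E := E).
move=> /(_ (fun c _ => hE c)).
rewrite (_ : [set` finset.setTfor 'I_d] = setT); last first.
  by apply/seteqP; split => c //= _; rewrite inE.
move=> h; apply: EFin_inj; rewrite -probE; last first.
  by apply: fin_bigcap_measurable => // c _; exact: mE.
rewrite h -prodEFin; apply: eq_big => [c|c _]; first by rewrite inE.
exact: probE.
Qed.

(** If both loops are hits, the displacements from [x] to [x'] and from [y] to [y'] differ by at
    most [2 * rad n]: this event [G] ignores the increments over [[p, q)] and has probability at
    most [4 / Num.sqrt m]. Given the outside increments, a hit confines the increment over [[p, q)]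
    to an interval of length [2 * rad n]. The constant 8 covers [m = 0] and the passage from [m] to
    [m.+1]. *)
Lemma pair_hit1_le n c p q x x' y y' m :
  (x <= p)%N -> (x' <= p)%N -> (p < q)%N -> (q <= y)%N -> (q <= y')%N ->
  [\/ m = 0%N, (y + m = y' \/ y' + m = y)%N | (x + m = x' \/ x' + m = x)%N] ->
  prob P (hit1 n (rad n) c x y `&` hit1 n (rad n) c x' y') <=
  2 / Num.sqrt (q - p)%:R * (8 / Num.sqrt m.+1%:R).
Proof.
move=> xp x'p pq qy qy' hm.
have r0 := rad_gt0 n.
pose N := (y + y')%N.
pose X := @gridI R _ _ d B n N.
have mX : forall i, measurable_fun setT (X i) by move=> i; exact: (gridI_measurable hB).
have iX : independent_RVs P X by exact: (gridI_indep hB).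
have disJ (Q1 Q2 : 'I_d -> nat -> bool) : (forall c i, Q1 c i -> ~~ Q2 c i) ->
    forall i, i \in gridJ N Q1 -> i \notin gridJ N Q2.
  by move=> h [c' i]; rewrite !inE/=; exact: h.
pose Q1 (_ : 'I_d) i := (p <= i < q)%N.
pose Q2 (_ : 'I_d) i := (i < p)%N || (q <= i)%N.
pose D w := gridD n c y y' w - gridD n c x x' w.
pose G := [set w | `|D w| <= 2 * rad n].
have mD : measurable_fun (T := g_sigma_algebraType (sigX X (gridJ N Q2))) setT D.
  apply: measurable_funB.
    apply: gridD_measurable_fun; rewrite ?leq_addr ?leq_addl// => i ?; rewrite /Q2; lia.
  by apply: gridD_measurable_fun; rewrite /N; try lia; move=> i ?; rewrite /Q2; lia.
have mG2 : <<s sigX X (gridJ N Q2) >> G.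
  rewrite -[G]setTI.
  apply: (@measurable_fun_ler _ (g_sigma_algebraType (sigX X (gridJ N Q2)))) => //.
  by apply: measurableT_comp; [exact: normr_measurable|exact: mD].
have mG : measurable G by exact: (sigX_measurable mX mG2).
pose U := gridD n c p q.
pose Y w := gridD n c q y w + gridD n c x p w.
have sq0 : 0 < Num.sqrt (q - p)%:R :> R by rewrite sqrtr_gt0 ltr0n subn_gt0.
have step1 : (P (G `&` [set w | (`|U w + Y w| <= rad n)%R]) <= (2 / Num.sqrt (q - p)%:R)%:E * P G)%E.
  apply: (concentration_le mX iX (disJ Q1 Q2 _)) => //.
  - by move=> c' i; rewrite /Q1 /Q2; lia.
  - apply: gridD_measurable_fun; rewrite /N; try lia.
    by move=> i; rewrite /Q1; lia.
  - apply: measurable_funD; apply: gridD_measurable_fun; rewrite /N; try lia.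
      by move=> i; rewrite /Q2; lia.
    by move=> i; rewrite /Q2; lia.
  - move=> z; apply: le_trans (gridD_itv_le _ _ (m := (q - p)%N) _ _ _ _) _.
    + by rewrite subn_gt0.
    + by left; lia.
    + by rewrite mulr_ge0// ltW.
    + by rewrite lee_fin -mulf_div divff ?mulr1// gt_eqF.
have step2 : prob P G <= 8 / Num.sqrt m.+1%:R.
  have [m0|m0] := posnP m.
    by rewrite m0 sqrtr1 divr1 (le_trans (prob_le1 _ mG))//; lra.
  have h4 : (P G <= (4 / Num.sqrt m%:R)%:E)%E.
    (* The end at which the loops are [m] steps apart supplies the Gaussian variable, the other end
       an independent shift. *)
    have [y0 [y0' [x0 [x0' [eqD hm' [lty lty' ltx ltx'] hd]]]]] :
      exists y0 y0' x0 x0' : nat,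
       [/\ (forall w, `|D w| = `|gridD n c y0 y0' w + - gridD n c x0 x0' w|),
         (y0 + m = y0' \/ y0' + m = y0)%N,
         ([/\ y0 <= N, y0' <= N, x0 <= N & x0' <= N]%N) &
        (forall i, (minn x0 x0' <= i < maxn x0 x0')%N -> ~~ (minn y0 y0' <= i < maxn y0 y0')%N)].
      case: hm => [h|h|h]; first by rewrite h in m0.
        exists y, y', x, x'; split => //; first by rewrite /N; split; lia.
        by move=> i; lia.
      exists x, x', y, y'; split => //.
      - by move=> w; rewrite /D distrC.
      - by rewrite /N; split; lia.
      - by move=> i; lia.
    pose R1 (_ : 'I_d) i := (minn y0 y0' <= i < maxn y0 y0')%N.
    pose R2 (c' : 'I_d) i := ~~ R1 c' i.
    have -> : G = setT `&` [set w | `|gridD n c y0 y0' w + - gridD n c x0 x0' w| <= 2 * rad n].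
      by rewrite setTI; apply/seteqP; split => w; rewrite /G/= eqD.
    rewrite -[leRHS]mule1 -[X in (_ <= _ * X)%E](probability_setT P).
    apply: (concentration_le mX iX (disJ R1 R2 _)) => //.
    - by move=> c' i; rewrite /R2 => ->.
    - exact: gridD_measurable_fun.
    - apply: measurableT_comp => //; exact: gridD_measurable_fun.
    - exact: (@measurableT _ (g_sigma_algebraType (sigX X (gridJ N R2)))).
    - move=> z; apply: le_trans (gridD_itv_le _ _ _ m0 hm' _) _.
        by rewrite !mulr_ge0// ltW.
      rewrite lee_fin mulrA -mulf_div divff ?mulr1 ?gt_eqF//.
      by rewrite -natrM.
  rewrite probE// lee_fin in h4; apply: le_trans h4 _.
  have s1 : 0 < Num.sqrt m%:R :> R by rewrite sqrtr_gt0 ltr0n.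
  rewrite ler_pdivrMr// mulrAC ler_pdivlMr ?sqrtr_gt0//.
  have : Num.sqrt m.+1%:R <= 2 * Num.sqrt m%:R :> R.
    have <- : Num.sqrt 4 = 2 :> R.
      by rewrite (_ : 4 = 2 ^+ 2) ?sqrtr_sqr ?ger0_norm// expr2 -natrM.
    rewrite -sqrtrM// ler_wsqrtr// -natrM ler_nat; lia.
  lra.
apply: (@le_trans _ _ (prob P (G `&` [set w | (`|U w + Y w| <= rad n)%R]))).
  apply: le_prob.
  - by apply: measurableI; exact: hit1_measurable.
  - apply: measurableI => //; rewrite -[X in measurable X]setTI.
    apply: measurable_fun_ler => //; apply: measurableT_comp; first exact: normr_measurable.
    apply: measurable_funD; first exact: gridD_measurable.
    by apply: measurable_funD; exact: gridD_measurable.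
  - move=> w [h1 h2]; split; rewrite /G/= /D /U /Y.
      move: h1 h2; rewrite /hit1/= => h1 h2.
      have -> : gridD n c y y' w - gridD n c x x' w = gridD n c x' y' w - gridD n c x y w.
        by rewrite /gridD; lra.
      by apply: le_trans (ler_normB _ _) _; lra.
    have -> : gridD n c p q w + (gridD n c q y w + gridD n c x p w) = gridD n c x y w.
      by rewrite /gridD; lra.
    exact: h1.
rewrite -lee_fin -probE; last first.
  apply: measurableI => //; rewrite -[X in measurable X]setTI.
  apply: measurable_fun_ler => //; apply: measurableT_comp; first exact: normr_measurable.
  apply: measurable_funD; first exact: gridD_measurable.
  by apply: measurable_funD; exact: gridD_measurable.
apply: le_trans step1 _; rewrite probE// -EFinM lee_fin.
by rewrite ler_wpM2l// divr_ge0// ltW.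
Qed.

End Hits.

(** * Sums of powers of distances *)

Section PowerSums.
Context {R : realType}.
Implicit Types (x p a : R).

Lemma gt0_powRD x r s : 0 < x -> x `^ (r + s) = x `^ r * x `^ s.
Proof. by move=> x0; rewrite powRD//; apply/implyP => _; rewrite gt_eqF. Qed.

(** The right-hand side [y] is the mean of [x] and 1 with weights [p] and [1 - p]. The bound
    [ln z <= z - 1], taken at [x / y] and [1 / y] with these weights, has right-hand sides of sum
    zero. *)
Lemma powR_bernoulli x p : 0 <= x -> 0 < p -> p <= 1 ->
  x `^ p <= 1 + p * (x - 1).
Proof.
move=> x0 p0 p1; have [->|xn0] := eqVneq x 0.
  by rewrite powR0 ?gt_eqF//; lra.
have {xn0} x0 : 0 < x by rewrite lt_def xn0.
set y := 1 + p * (x - 1).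
have y0 : 0 < y.
  have : 0 < p * x by exact: mulr_gt0.
  by rewrite /y; lra.
have lnle (z : R) : 0 < z -> ln z <= z - 1.
  move=> z0; have := @le_ln1Dx R (z - 1).
  by rewrite (_ : 1 + (z - 1) = z); [apply; lra|ring].
have h1 := lnle _ (divr_gt0 x0 y0).
have h2 := lnle _ (divr_gt0 ltr01 y0).
rewrite ln_div ?posrE// in h1; rewrite ln_div ?posrE// ln1 sub0r in h2.
rewrite -ler_ln ?posrE ?powR_gt0// ln_powR.
have h3 : p * (ln x - ln y) <= p * (x / y - 1) by rewrite ler_wpM2l// ltW.
have h4 : (1 - p) * (- ln y) <= (1 - p) * (1 / y - 1) by rewrite ler_wpM2l// subr_ge0.
have : p * (x / y - 1) + (1 - p) * (1 / y - 1) = 0.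
  have yn0 : y != 0 by rewrite gt_eqF.
  have -> : p * (x / y - 1) + (1 - p) * (1 / y - 1) = (1 + p * (x - 1) - y) / y by field.
  by rewrite /y subrr mul0r.
lra.
Qed.

(** A discrete substitute for the integral of [x ^ (- a)]: the induction step is Bernoulli's
    inequality at [L / (L + 1)]. *)
Lemma sum_powR_le a L : 0 <= a -> a < 1 ->
  \sum_(i < L) i.+1%:R `^ (- a) <= L%:R `^ (1 - a) / (1 - a).
Proof.
move=> a0 a1; have b0 : 0 < 1 - a by rewrite subr_gt0.
rewrite ler_pdivlMr//.
elim: L => [|L IH]; first by rewrite big_ord0 mul0r powR_ge0.
rewrite big_ord_recr/= mulrDl; apply: le_trans (lerD IH (lexx _)) _.
set y : R := L.+1%:R.
have y0 : 0 < y by rewrite ltr0n.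
have -> : L%:R = y * (1 - y^-1) :> R.
  by rewrite mulrBr mulr1 divff ?gt_eqF// /y -natr1 addrK.
have z0 : 0 <= 1 - y^-1 by rewrite subr_ge0 invf_le1// ler1n.
rewrite powRM ?(ltW y0)//.
have -> : y `^ (- a) = y `^ (1 - a) * y^-1.
  rewrite -(powR_inv1 (ltW y0)) -gt0_powRD//.
  by congr (_ `^ _); ring.
rewrite -mulrA -mulrDr -[leRHS]mulr1 ler_wpM2l ?powR_ge0//.
have := powR_bernoulli z0 b0; rewrite lerBlDr lerDl => /(_ a0).
move: (y^-1) (_ `^ _) => z v h; nra.
Qed.

(** The distance [|x - y|]: one of the truncated differences vanishes. *)
Definition dst (x y : nat) : nat := (x - y + (y - x))%N.

Lemma dst_natrB (x y : nat) : `|y%:R - x%:R| = (dst x y)%:R :> R.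
Proof.
rewrite /dst; have [h|/ltnW h] := leqP y x.
  by rewrite distrC -natrB// ger0_norm// (eqP (h : (y - x == 0)%N)) addn0.
by rewrite -natrB// ger0_norm// (eqP (h : (x - y == 0)%N)) add0n.
Qed.

Lemma sum_dst_le (f : nat -> R) H j t L : (forall i, 0 <= f i) ->
  (forall k, (k < H)%N -> (dst (k + j) t < L)%N) ->
  \sum_(k < H) f (dst (k + j) t) <= 2 * \sum_(i < L) f i.
Proof.
move=> f0 hL.
apply: (@le_trans _ _ (\sum_(k < H) \sum_(i < L)
   f i * (((k : nat) == (t + i - j)%N)%:R + ((k : nat) == (t - i - j)%N)%:R))).
  apply: ler_sum => k _.
  rewrite (bigD1 (Ordinal (hL _ (ltn_ord k))))//=.
  apply: (@le_trans _ _ (f (dst (k + j) t) *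
     (((k : nat) == (t + dst (k + j) t - j)%N)%:R + ((k : nat) == (t - dst (k + j) t - j)%N)%:R))).
    rewrite ler_peMr// -natrD ler1n /dst; lia.
  by rewrite lerDl sumr_ge0// => i _; rewrite mulr_ge0// addr_ge0.
rewrite exchange_big/= mulr_sumr ler_sum// => i _.
rewrite -mulr_sumr mulrC ler_wpM2r//.
have cnt z : \sum_(k < H) ((k : nat) == z)%:R <= 1 :> R.
  have [zH|Hz] := ltnP z H.
    rewrite (bigD1 (Ordinal zH))//= eqxx big1 ?addr0// => k.
    by rewrite -val_eqE/= => /negbTE ->.
  by rewrite big1// => k _; rewrite ltn_eqF// (leq_trans (ltn_ord k)).
rewrite big_split/=.
by have := cnt (t + i - j)%N; have := cnt (t - i - j)%N; lra.
Qed.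

(** For fixed [x.1] the sum over [x.2] is bounded uniformly in the translation, so the double sum is
    at most a product. The constant 6 has a factor 2 because a distance is attained at most twice,
    and a factor 3 because all distances are below [3 * H]. *)
Lemma energy_sum_le a H j k : 0 <= a -> a < 1 -> (j < H)%N -> (k < H)%N ->
  \sum_(x : 'I_H * 'I_H)
    (dst x.1 j).+1%:R `^ (- a) * (dst (x.2 + j) (k + x.1)).+1%:R `^ (- a) <=
  (6 / (1 - a)) ^+ 2 * (H%:R `^ (1 - a)) ^+ 2.
Proof.
move=> a0 a1 jH kH; have b0 : 0 < 1 - a by rewrite subr_gt0.
pose S := 6 / (1 - a) * H%:R `^ (1 - a).
have S0 : 0 <= S by rewrite mulr_ge0 ?powR_ge0// divr_ge0// ltW.
have base j' t : (j' < H)%N -> (t < 2 * H)%N ->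
    \sum_(i < H) (dst (i + j') t).+1%:R `^ (- a) <= S.
  move=> jH' tH.
  apply: (le_trans (@sum_dst_le (fun i => i.+1%:R `^ (- a)) H j' t (3 * H) _ _)).
  - by move=> i; exact: powR_ge0.
  - by move=> i iH; rewrite /dst; lia.
  apply: (@le_trans _ _ (2 * ((3 * H)%:R `^ (1 - a) / (1 - a)))).
    by rewrite ler_wpM2l// sum_powR_le.
  rewrite /S natrM powRM// (_ : 6 = 2 * 3 :> R); last by rewrite -natrM.
  set u := H%:R `^ (1 - a); set t3 := 3 `^ (1 - a).
  have h3 : t3 <= 3 by rewrite -[leRHS]powRr1//; apply: ler_powR; lra.
  have e (v1 v2 v3 : R) : 2 * (v2 * v1 * v3) = 2 * v1 * v3 * v2 by ring.
  have -> : 2 * 3 / (1 - a) * u = 2 * u / (1 - a) * 3.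
    by move: u ((1 - a)^-1) => u bi; ring.
  rewrite e.
  by rewrite ler_wpM2l// divr_ge0 ?(ltW b0)// mulr_ge0// powR_ge0.
rewrite -exprMn -/S expr2.
rewrite -(pair_bigA _ (fun x1 x2 : 'I_H => (dst x1 j).+1%:R `^ (- a) *
    (dst (x2 + j) (k + x1)).+1%:R `^ (- a)))/=.
apply: (@le_trans _ _ (\sum_(x1 < H) (dst x1 j).+1%:R `^ (- a) * S)).
  apply: ler_sum => x1 _; rewrite -mulr_sumr ler_wpM2l ?powR_ge0//.
  apply: base => //; have := ltn_ord x1; lia.
rewrite -mulr_suml ler_wpM2r//.
have := base 0%N j; under eq_bigr do rewrite addn0; apply; lia.
Qed.

(** The energy kernel in grid units: [dst] is here the difference of the lags [p.2 - p.1] and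
    [q.2 - q.1]. The factor [(2 * H) ^ g] makes it at least 1, as [second_moment] requires. *)
Definition kapp (g : R) (H : nat) (p q : 'I_H * 'I_H) : R :=
  (2 * H)%:R `^ g * (dst (q.2 + p.1) (p.2 + q.1)).+1%:R `^ (- g).

Lemma kapp_ge1 g H (p q : 'I_H * 'I_H) : 0 <= g -> 1 <= kapp g p q.
Proof.
move=> g0; rewrite /kapp powRN ler_pdivlMr ?powR_gt0 ?ltr0n// mul1r.
apply: ge0_ler_powR; rewrite ?nnegrE ?ler0n// ler_nat.
case: p q => [[p1 ?] [p2 ?]] [[q1 ?] [q2 ?]] /=; rewrite /dst; lia.
Qed.

End PowerSums.

(** * Mass and energy of the hits of a block *)

Section Block.
Context {R : realType} {disp : measure_display} {Omega : measurableType disp}.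
Variable P : probability Omega R.
Variables (d : nat) (B : R -> Omega -> 'rV[R]_d).
Hypothesis hB : brownian_motion P B.

(* In the block [b] the loops start at an index in [b, b + H) and end at one in
   [b + M * H, b + (M + 1) * H). *)
Definition bhit n M H b (x : 'I_H * 'I_H) : set Omega :=
  hit B n (rad n) (b + x.1) (b + M * H + x.2).

Definition bmass n M H b (v : R) w : R := v * \sum_x \1_(@bhit n M H b x) w.

Definition benergy (g : R) n M H b (v : R) w : R :=
  v ^+ 2 * \sum_x \sum_y kapp g x y * (\1_(@bhit n M H b x) w * \1_(@bhit n M H b y) w).

Definition bgood (g : R) n M H b (v c C : R) : set Omega :=
  [set w | c <= bmass n M H b v w /\ benergy g n M H b v w <= C].

Lemma prob_bhit_ge n M H b (x : 'I_H * 'I_H) : (2 <= M)%N ->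
  (2 * expR (- 2) / 3 / Num.sqrt (M.+1 * H)%:R) ^+ d <= prob P (bhit n M b x).
Proof.
move=> M2; case: x => [[j jH] [k kH]]; rewrite /bhit/=.
rewrite (prob_coord hB)//; last by move=> c; exact: hit1_process.
rewrite -[X in _ ^+ X]card_ord -prodr_const; apply: ler_prod => c _.
have r0 := rad_gt0 (R := R) n.
pose m := (M * H + k - j)%N.
have m0 : (0 < m)%N by rewrite /m; nia.
have mM : (m <= M.+1 * H)%N by rewrite /m; nia.
have sm : 0 < Num.sqrt m%:R :> R by rewrite sqrtr_gt0 ltr0n.
have sm1 : 1 <= Num.sqrt m%:R :> R by rewrite -[leLHS]sqrtr1 ler_wsqrtr// ler1n.
have e20 := expR_ge0 (- 2 : R).
apply/andP; split; first by rewrite !mulr_ge0// invr_ge0 sqrtr_ge0.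
have -> : hit1 B n (rad n) c (b + j) (b + M * H + k) =
   gridD B n c (b + j) (b + j + m) @^-1` `[(- rad n)%R, (- rad n + 2 * rad n)%R]%classic.
  have -> : (b + M * H + k = b + j + m)%N by rewrite /m; nia.
  apply/seteqP; split => w; rewrite /hit1/= in_itv/= ler_norml => /andP[? ?];
    apply/andP; split; lra.
rewrite -lee_fin -probE; last first.
  by rewrite -[X in measurable X]setTI; exact: (gridD_measurable hB).
have rs : (rad n : R) <= Num.sqrt m%:R * rad n.
  by apply: ler_peMl => //; exact: ltW.
apply: (@le_trans _ _ (expR (- 2) / 3 * (2 * rad n) / (Num.sqrt m%:R * rad n))%:E); last first.
  by apply: (gridD_itv_ge hB) => //; [rewrite mulr_ge0// ltW|lra|lra].
rewrite lee_fin (_ : expR (- 2) / 3 * _ / _ = 2 * expR (- 2) / 3 / Num.sqrt m%:R).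
  apply: ler_wpM2l; first by rewrite !mulr_ge0.
  by rewrite lef_pV2 ?posrE ?sqrtr_gt0 ?ltr0n ?ler_wsqrtr ?ler_nat//; nia.
move: r0 sm; move: (rad n) (Num.sqrt _) (expR _) => u1 u2 u3 u10 u20.
by field; rewrite !gt_eqF.
Qed.

(** All loops of the block straddle [[b + H, b + M * H)], of length at least [H] because [2 <= M].
    In [pair_hit1_le], [m] is read at the end where the loops are furthest apart, and
    [16 = 2 * 8]. *)
Lemma prob_bhit2_le n M H b (x y : 'I_H * 'I_H) : (2 <= M)%N ->
  prob P (bhit n M b x `&` bhit n M b y) <=
  16 ^+ d * H%:R `^ (- (d%:R / 2)) *
  (maxn (dst x.1 y.1) (dst x.2 y.2)).+1%:R `^ (- (d%:R / 2)).
Proof.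
move=> M2; case: x y => [[j jH] [k kH]] [[j' jH'] [k' kH']]; rewrite /bhit/=.
set m := maxn _ _.
have -> : hit B n (rad n) (b + j) (b + M * H + k) `&` hit B n (rad n) (b + j') (b + M * H + k') =
  \bigcap_(c in setT) (hit1 B n (rad n) c (b + j) (b + M * H + k) `&`
    hit1 B n (rad n) c (b + j') (b + M * H + k')) by rewrite -bigcapI.
rewrite (prob_coord hB)//; last first.
  move=> c; pose T := g_sigma_algebraType [set E | exists2 t : R, 0 <= t &
         preimage_set_system setT (fun w => B t w ord0 c) measurable E].
  by apply: (@measurableI _ T); exact: hit1_process.
have H0 : (0 < H)%N by lia.
have sH : 0 < Num.sqrt H%:R :> R by rewrite sqrtr_gt0 ltr0n.
apply: (@le_trans _ _ (\prod_(c < d) (16 * (H%:R `^ (- 2^-1) * m.+1%:R `^ (- 2^-1))))).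
  apply: ler_prod => c _; rewrite prob_ge0/=.
  apply: le_trans (pair_hit1_le hB n c (p := b + H) (q := b + M * H) (m := m) _ _ _ _ _ _) _.
  - lia.
  - lia.
  - nia.
  - lia.
  - lia.
  - rewrite /m /dst; have [h|h] := leqP (j - j' + (j' - j)) (k - k' + (k' - k)).
      by apply: Or32; lia.
    by apply: Or33; lia.
  rewrite !powRN !powR12_sqrt// mulf_div -natrM -invfM ler_wpM2l//.
  rewrite lef_pV2 ?posrE ?mulr_gt0// ?sqrtr_gt0 ?ltr0n//; last by nia.
  by rewrite ler_wpM2r ?sqrtr_ge0// ler_wsqrtr// ler_nat; nia.
rewrite prodr_const card_ord !exprMn -!powR_mulrn ?powR_ge0// -!powRrM.
rewrite mulrA le_eqVlt; apply/orP; left; apply/eqP.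
by congr (_ * _ `^ _ * _ `^ _); rewrite mulNr mulrC.
Qed.

(** The exponent is split as [d / 2 = a + b] with [a - b = g]. The power [a] of the maximum is
    bounded through the distance of the starts; the power [b] through the lag difference [D], at
    most twice the maximum, and it raises the exponent of the kernel from [g] to [a]. Both factors
    then have the exponent [a], and [a < 1] because [g + d / 2 < 2]. *)
Lemma benergy_sum_le (g : R) (H : nat) (x : 'I_H * 'I_H) :
  0 <= g -> g <= d%:R / 2 -> g < 2 - d%:R / 2 ->
  \sum_(y : 'I_H * 'I_H) kapp g x y *
    (maxn (dst x.1 y.1) (dst x.2 y.2)).+1%:R `^ (- (d%:R / 2)) <=
  (2 * H)%:R `^ g * 2 `^ ((d%:R / 2 - g) / 2) *
    ((6 / (1 - (g + d%:R / 2) / 2)) ^+ 2 * (H%:R `^ (1 - (g + d%:R / 2) / 2)) ^+ 2).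
Proof.
move=> g0 gd g2.
set e := d%:R / 2; set a := (g + e) / 2; set b := (e - g) / 2.
have a0 : 0 <= a by rewrite /a /e; lra.
have a1 : a < 1 by rewrite /a /e; lra.
have b0 : 0 <= b by rewrite /b /e; lra.
case: x => [[j jH] [k kH]] /=.
apply: le_trans (ler_wpM2l _ (energy_sum_le a0 a1 jH kH)); last first.
  by rewrite mulr_ge0 ?powR_ge0.
rewrite mulr_sumr; apply: ler_sum => y _.
case: y => [[j' jH'] [k' kH']] /=; rewrite /kapp/=.
set D := dst (k' + j) (k + j'); set m := maxn _ _.
rewrite -!mulrA ler_wpM2l ?powR_ge0//.
have -> : m.+1%:R `^ (- e) = m.+1%:R `^ (- a) * m.+1%:R `^ (- b) :> R.
  rewrite -gt0_powRD ?ltr0n//.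
  by congr (_ `^ _); rewrite /a /b; lra.
have anti (p q : nat) (t : R) : 0 <= t -> (p <= q)%N -> (0 < p)%N -> q%:R `^ (- t) <= p%:R `^ (- t) :> R.
  move=> t0 pq p0; rewrite !powRN lef_pV2 ?posrE ?powR_gt0 ?ltr0n//; last exact: leq_trans pq.
  by apply: ge0_ler_powR; rewrite ?nnegrE// ler_nat.
have h1 : m.+1%:R `^ (- a) <= (dst j' j).+1%:R `^ (- a) :> R.
  by apply: anti => //; rewrite /m /dst; lia.
have h2 : m.+1%:R `^ (- b) <= 2 `^ b * D.+1%:R `^ (- b) :> R.
  have -> : 2 `^ b * D.+1%:R `^ (- b) = (D.+1%:R / 2) `^ (- b) :> R.
    rewrite powRM ?invr_ge0// mulrC; congr (_ * _).
    by rewrite -[2^-1]powR_inv1// -powRrM mulN1r opprK.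
  rewrite !powRN lef_pV2 ?posrE ?powR_gt0 ?divr_gt0 ?ltr0n//.
  apply: ge0_ler_powR => //; first by rewrite nnegrE divr_ge0.
    by rewrite nnegrE.
  by rewrite ler_pdivrMr// -natrM ler_nat /D /m /dst; lia.
apply: (@le_trans _ _ (D.+1%:R `^ (- g) * ((dst j' j).+1%:R `^ (- a) * (2 `^ b * D.+1%:R `^ (- b))))).
  by rewrite ler_wpM2l ?powR_ge0// ler_pM ?powR_ge0.
have -> : D.+1%:R `^ (- a) = D.+1%:R `^ (- g) * D.+1%:R `^ (- b) :> R.
  rewrite -gt0_powRD ?ltr0n//.
  by congr (_ `^ _); rewrite /a /b; lra.
rewrite le_eqVlt; apply/orP; left; apply/eqP.
by move: (_ `^ _) (_ `^ _) (_ `^ _) (_ `^ _) => u1 u2 u3 u4; ring.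
Qed.

(** There are [H ^ 2] pairs, each hit with probability of order [H ^ (- d / 2)]: the weight
    normalises the expected mass. All powers of [H] cancel in both moments, so the constants do not
    depend on the scale or on the block. *)
Lemma bgood_prob (g : R) (M : nat) : (2 <= M)%N -> 0 <= g -> g <= d%:R / 2 ->
  g < 2 - d%:R / 2 ->
  exists c C p : R, [/\ 0 < c, 0 < C, 0 < p & forall n H b, (0 < H)%N ->
    p <= prob P (bgood g n M H b (H%:R `^ (d%:R / 2 - 2)) c C)].
Proof.
move=> M2 g0 gd g2.
pose c := (2 * expR (- 2) / 3 / Num.sqrt M.+1%:R) ^+ d : R.
pose e : R := d%:R / 2.
pose a := (g + e) / 2.
pose C := 16 ^+ d * 2 `^ g * 2 `^ ((e - g) / 2) * (6 / (1 - a)) ^+ 2 : R.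
have a1 : a < 1 by rewrite /a /e; lra.
have c0 : 0 < c by rewrite exprn_gt0// !mulr_gt0 ?expR_gt0// invr_gt0 sqrtr_gt0 ltr0n.
have C0 : 0 < C.
  have ai : 0 < (1 - a)^-1 by rewrite invr_gt0 subr_gt0.
  by rewrite /C !mulr_gt0 ?powR_gt0 ?exprn_gt0 ?mulr_gt0.
exists (c / 2), ((4 * C / c) ^+ 2), (c ^+ 2 / (16 * C)).
split; first exact: divr_gt0.
- by rewrite exprn_gt0// divr_gt0// mulr_gt0.
- by apply: divr_gt0; [exact: exprn_gt0|exact: mulr_gt0].
move=> n H b H0.
have HR : 0 < H%:R :> R by rewrite ltr0n.
have Hp (r s : R) : H%:R `^ (r + s) = H%:R `^ r * H%:R `^ s.
  exact: gt0_powRD.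
have HH (z : R) : \sum_(x : 'I_H * 'I_H) z = z * H%:R `^ 2.
  by rewrite sumr_const card_prod card_ord -[z *+ _]mulr_natr natrM -expr2 powR_mulrn.
apply: (second_moment (E := @bhit n M H b)) => //.
- by move=> x; exact: (hit_measurable hB).
- by move=> x y; exact: kapp_ge1.
- apply: (@le_trans _ _ (H%:R `^ (e - 2) * \sum_(x : 'I_H * 'I_H) (2 * expR (- 2) / 3 / Num.sqrt (M.+1 * H)%:R) ^+ d)); last first.
    rewrite ler_wpM2l ?powR_ge0//; apply: ler_sum => x _; exact: prob_bhit_ge.
  rewrite HH natrM sqrtrM// (_ : 2 * expR (- 2) / 3 / _ = 2 * expR (- 2) / 3 / Num.sqrt M.+1%:R * (Num.sqrt H%:R)^-1); last first.
    by rewrite invfM mulrA.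
  rewrite exprMn -/c.
  have -> : (Num.sqrt H%:R)^-1 ^+ d = H%:R `^ (- e) :> R.
    rewrite -powR12_sqrt// -powRN -powR_mulrn ?powR_ge0// -powRrM.
    by congr (_ `^ _); rewrite /e; lra.
  rewrite [leRHS](_ : _ = c * (H%:R `^ (e - 2) * H%:R `^ (- e) * H%:R `^ 2)); last first.
    have E1 (u1 u2 u3 u4 : R) : u1 * (u4 * u2 * u3) = u4 * (u1 * u2 * u3) by ring.
    exact: E1.
  by rewrite -!Hp (_ : e - 2 - e + 2 = 0) ?powRr0 ?mulr1//; ring.
- apply: (@le_trans _ _ ((H%:R `^ (e - 2)) ^+ 2 * \sum_(x : 'I_H * 'I_H)
    (16 ^+ d * H%:R `^ (- e) * ((2 * H)%:R `^ g * 2 `^ ((e - g) / 2) *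
    ((6 / (1 - a)) ^+ 2 * (H%:R `^ (1 - a)) ^+ 2))))).
    rewrite ler_wpM2l ?sqr_ge0//; apply: ler_sum => x _.
    apply: le_trans (ler_wpM2l _ (benergy_sum_le x g0 gd g2)); last first.
      by rewrite mulr_ge0 ?powR_ge0// exprn_ge0.
    rewrite mulr_sumr; apply: ler_sum => y _.
    rewrite [leRHS]mulrCA ler_wpM2l//; last exact: prob_bhit2_le.
    by rewrite (le_trans _ (kapp_ge1 x y g0)).
  rewrite HH.
  rewrite natrM powRM// -(powR_mulrn 2 (powR_ge0 _ (e - 2))) -(powR_mulrn 2 (powR_ge0 _ (1 - a))) -!powRrM.
  rewrite [leLHS](_ : _ = C * (H%:R `^ ((e - 2) * 2) * H%:R `^ (- e) * H%:R `^ g * H%:R `^ ((1 - a) * 2) * H%:R `^ 2)); last first.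
    have E2 (u1 u2 u3 u4 u5 v1 v2 v3 v4 : R) :
      u1 * (v1 * u2 * (v2 * u3 * v3 * (v4 * u4)) * u5) =
      v1 * v2 * v3 * v4 * (u1 * u2 * u3 * u4 * u5) by ring.
    exact: E2.
  by rewrite -!Hp (_ : _ + 2 = 0) ?powRr0 ?mulr1// /a; field.
Qed.

End Block.

(** * A discrete Frostman lemma *)

Section Hausdorff.
Context {R : realType}.
Implicit Types (A : set R) (g : R).

Lemma powR_subadd (a b g : R) : 0 <= a -> 0 <= b -> 0 < g -> g <= 1 ->
  (a + b) `^ g <= a `^ g + b `^ g.
Proof.
move=> a0 b0 g0 g1; have [ab0|abn0] := eqVneq (a + b) 0.
  by rewrite ab0 powR0 ?gt_eqF// addr_ge0 ?powR_ge0.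
have ab : 0 < a + b by rewrite lt_def abn0 addr_ge0.
have key (z : R) : 0 <= z -> z <= a + b -> z * (a + b) `^ (g - 1) <= z `^ g.
  move=> z0 zab; have [->|zn0] := eqVneq z 0; first by rewrite mul0r powR_ge0.
  have zp : 0 < z by rewrite lt_def zn0.
  have -> : z `^ g = z * z `^ (g - 1).
    rewrite -{2}(powRr1 z0) -gt0_powRD//; congr (_ `^ _); ring.
  rewrite ler_wpM2l// -opprB !powRN lef_pV2 ?posrE ?powR_gt0//.
  by apply: ge0_ler_powR; rewrite ?nnegrE ?subr_ge0 ?addr_ge0.
have -> : (a + b) `^ g = a * (a + b) `^ (g - 1) + b * (a + b) `^ (g - 1).
  rewrite -mulrDl -{2}(powRr1 (ltW ab)) -gt0_powRD//; congr (_ `^ _); ring.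
by rewrite lerD// key// ?lerDl ?lerDr.
Qed.

Lemma diam_ub A x y : A x -> A y -> (`|x - y|%:E <= diam A)%E.
Proof. by move=> Ax Ay; apply: ereal_sup_ubound; exists x => //; exists y. Qed.

Lemma diam_fin A x : A x -> (diam A <= 1%:E)%E -> diam A \is a fin_num.
Proof.
move=> Ax A1; rewrite fin_numE; apply/andP; split.
  have := diam_ub Ax Ax; case: (diam A) => //.
by apply/eqP => E; rewrite E in A1.
Qed.

Lemma sum_sqr_partition (I : finType) (S : {set I}) (k : I -> nat) (N : nat)
    (K : I -> I -> R) : (forall i, i \in S -> (k i < N)%N) ->
  (forall i j, 0 <= K i j) ->
  \sum_(l < N) \sum_(i in S | k i == l) \sum_(j in S | k j == l) K i j <=
  \sum_(i in S) \sum_(j in S) K i j.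
Proof.
move=> kN K0.
rewrite [leRHS](partition_big (fun i => inord (k i) : 'I_N.+1) predT)//=.
rewrite big_ord_recr/= -[leLHS]addr0 lerD//; last first.
  by rewrite sumr_ge0// => i _; rewrite sumr_ge0.
apply: ler_sum => l _.
rewrite (eq_bigl (fun i => (i \in S) && (inord (k i) == widen_ord (leqnSn N) l))); last first.
  move=> i; case: (boolP (i \in S)) => //= iS.
  by rewrite -val_eqE/= inordK// ltnS ltnW// kN.
apply: ler_sum => i _; rewrite [leRHS](bigID (fun j => k j == l))/= lerDl.
by rewrite sumr_ge0.
Qed.

(* Weighted finite sets accumulating on [A] with mass at least [c] and
   [g]-energy at most [C]: they replace a weak limit of random measures. *)
Definition spread A g c C := forall O, open O -> A `<=` O -> forall eta : R, 0 < eta ->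
  exists (I : finType) (S : {set I}) (x : I -> R) (v delta : R),
  [/\ 0 <= v, 0 < delta /\ delta < eta, (forall i, i \in S -> O (x i)),
    c <= v * #|S|%:R &
    v ^+ 2 * \sum_(i in S) \sum_(j in S) (`|x i - x j| + delta) `^ (- g) <= C].

(* By Cauchy-Schwarz the squared mass of the points is at most the sum over a
   cover of [diam (U k) `^ g] times their energy. *)
Lemma frostman A g c C : compact A -> 0 < g -> g <= 1 -> 0 < c -> 0 < C ->
  spread A g c C -> hausdorff_measure g A <> 0%E.
Proof.
move=> cA g0 g1 c0 C0 hA hm.
(* With this [e] the final estimate reads [c <= (c / 4 + c) / 2], which is absurd. *)
have [e e0 eE] : exists2 e, 0 < e & e * (16 * C) = c ^+ 2.
  exists (c ^+ 2 / (16 * C)); first by rewrite divr_gt0 ?exprn_gt0 ?mulr_gt0.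
  by rewrite divfK// gt_eqF// mulr_gt0.
have : (hausdorff_premeasure g 1 A < e%:E)%E.
  apply: (@le_lt_trans _ _ 0%E); last by rewrite lte_fin.
  by rewrite -hm; apply: ereal_sup_ubound; exists 1 => //=.
move=> /ereal_inf_lt[_ [U [AU U1] <-] Ue].
(* Radii by which the sets of the cover are fattened into open ones, so that compactness leaves
   finitely many; the powers [eta k ^ g] have sum at most [e]. *)
pose eta k := (e / (2 ^+ k.+1)) `^ g^-1.
have eta0 k : 0 < eta k by rewrite powR_gt0// divr_gt0// exprn_gt0.
have etag k : eta k `^ g = e / (2 ^+ k.+1).
  by rewrite /eta -powRrM mulVf ?gt_eqF// powRr1// divr_ge0 ?exprn_ge0// ltW.
have eta_le k N : (k <= N)%N -> eta N <= eta k.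
  move=> kN; apply: ge0_ler_powR; rewrite ?nnegrE ?invr_ge0 ?(ltW g0) ?divr_ge0 ?exprn_ge0 ?(ltW e0)//.
  by rewrite ler_pM2l// lef_pV2 ?posrE ?exprn_gt0// ler_weXn2l// ler1n.
pose V k := \bigcup_(y in U k) ball y (eta k).
have oV k : open (V k) by apply: bigcup_open => y _; exact: ball_open.
have AV : A `<=` cover setT V.
  move=> x /AU[k _ Ux]; exists k => //; exists x => //; exact: ballxx.
move: cA; rewrite compact_cover => /(_ _ setT V (fun k _ => oV k) AV)[D _ AD].
pose N := (\max_(k <- finmap.enum_fset D) k.+1)%N.
have DN k : k \in finmap.enum_fset D -> (k < N)%N by move=> kD; rewrite /N (big_rem k kD)/= leq_max leqnn.
pose O := \bigcup_(k in `I_N) V k.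
have AO : A `<=` O by move=> x /AD[k /= kD Vx]; exists k => //=; exact: DN.
have oO : open O by exact: bigcup_open.
have [I [S [x [v [delta [v0 [d0 dN] xO hc hC]]]]]] := hA O oO AO (eta N) (eta0 N).
have /choice[kf hkf] i : exists k, i \in S -> (k < N)%N /\ V k (x i).
  have [/xO[k /= kN Vk]|] := boolP (i \in S); first by exists k.
  by exists 0%N.
pose ld k := fine (diam (U k)).
(* Bounds [|x i - x j| + delta] for two points charged to [U k]: each lies within [eta k] of [U k],
   and [delta < eta k]. *)
pose ell k := ld k + 3 * eta k.
pose K i j := (`|x i - x j| + delta) `^ (- g).
have K0 i j : 0 <= K i j by exact: powR_ge0.
pose M (l : nat) := #|[set i in S | kf i == l]%SET|%:R : R.
have M0 l : 0 <= M l by [].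
have kfN i : i \in S -> (kf i < N)%N by move=> /hkf[].
have sM : #|S|%:R = \sum_(l < N) M l.
  have ME l : M l = \sum_(i in S) (kf i == l)%:R.
    rewrite /M -sum1_card natr_sum [RHS](bigID (fun i => kf i == l))/=.
    rewrite [X in _ + X]big1 ?addr0; last by move=> i /andP[_ /negbTE ->].
    by apply: eq_big => [i|i]; rewrite !inE// => /andP[_ ->].
  under eq_bigr do rewrite ME.
  rewrite exchange_big/= -sum1_card natr_sum; apply: eq_bigr => i iS.
  rewrite (bigD1 (Ordinal (kfN _ iS)))//= eqxx big1 ?addr0// => l.
  by rewrite -val_eqE/= eq_sym => /negbTE ->.
pose Q (l : nat) := \sum_(i in S | kf i == l) \sum_(j in S | kf j == l) K i j.
have sQ : \sum_(l < N) Q l <= \sum_(i in S) \sum_(j in S) K i j.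
  exact: sum_sqr_partition.
have near i k : i \in S -> kf i = k -> exists2 y, U k y & `|x i - y| < eta k.
  move=> /hkf[_]; move=> [y Uy xy] <-; exists y => //.
  by rewrite distrC.
have Ufin k y : U k y -> diam (U k) \is a fin_num by move=> Uy; exact: diam_fin Uy (U1 k).
have ld_ub k y z : U k y -> U k z -> `|y - z| <= ld k.
  by move=> Uy Uz; rewrite -lee_fin /ld fineK ?(Ufin _ _ Uy)//; exact: diam_ub.
have Kell i j k : i \in S -> j \in S -> kf i = k -> kf j = k ->
    ell k `^ (- g) <= K i j.
  move=> iS jS ik jk.
  have [y Uy xy] := near _ _ iS ik; have [z Uz xz] := near _ _ jS jk.
  have ld0 := ld_ub _ _ _ Uy Uz.
  have dk : delta < eta k by apply: lt_le_trans dN _; rewrite eta_le// ltnW// -ik kfN.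
  have xij : `|x i - x j| + delta <= ell k.
    have : `|x i - x j| <= `|x i - y| + `|y - z| + `|x j - z|.
      rewrite (_ : x i - x j = (x i - y) + (y - z) + (z - x j)); last by ring.
      by rewrite (le_trans (ler_normD _ _))// (distrC z) lerD2r ler_normD.
    rewrite /ell; lra.
  have p0 : 0 < `|x i - x j| + delta by rewrite ltr_wpDl.
  rewrite /K !powRN lef_pV2 ?posrE ?powR_gt0//; last exact: lt_le_trans xij.
  by apply: ge0_ler_powR; rewrite ?nnegrE ?(ltW g0) ?(ltW p0) ?(le_trans (ltW p0) xij).
pose Sl (l : nat) := [set i in S | kf i == l]%SET.
have SlE l (F : I -> R) : \sum_(i in S | kf i == l) F i = \sum_(i in Sl l) F i.
  by apply: eq_bigl => i; rewrite inE.
have SlP l i : i \in Sl l -> i \in S /\ kf i = l.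
  by rewrite inE => /andP[? /eqP].
have Q0 l : 0 <= Q l by rewrite sumr_ge0// => i _; rewrite sumr_ge0.
have MQ l : (M l) ^+ 2 * ell l `^ (- g) <= Q l.
  rewrite /Q SlE; under eq_bigr do rewrite SlE.
  apply: (@le_trans _ _ (\sum_(i in Sl l) \sum_(j in Sl l) ell l `^ (- g))).
    rewrite !sumr_const -/(Sl l) /M; set z := _ `^ _.
    by rewrite -[z *+ _ *+ _]mulr_natr -[z *+ _]mulr_natr expr2 mulrC mulrA.
  apply: ler_sum => i /SlP[iS il]; apply: ler_sum => j /SlP[jS jl].
  exact: Kell.
have Une l : M l != 0 -> exists y, U l y.
  rewrite /M pnatr_eq0 cards_eq0 => /set0Pn[i /SlP[iS il]].
  by have [y Uy _] := near _ _ iS il; exists y.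
have geo : \sum_(l < N) e / 2 ^+ l.+1 = e - e / 2 ^+ N.
  elim: (N) => [|n IH]; first by rewrite big_ord0 expr0 divr1 subrr.
  rewrite big_ord_recr/= IH exprS invfM.
  by move: (2 ^+ n)^-1 => z; lra.
have ellU : \sum_(l < N | M l != 0) ell l `^ g <= 4 * e.
  apply: (@le_trans _ _ (\sum_(l < N | M l != 0) (ld l `^ g + 3 * (e / 2 ^+ l.+1)))).
    apply: ler_sum => l Ml; rewrite -etag.
    have [y Uy] := Une _ Ml; have l0 : 0 <= ld l by exact: le_trans (ld_ub _ _ _ Uy Uy).
    apply: le_trans (powR_subadd _ _ g0 g1) _ => //; first by rewrite mulr_ge0// ltW.
    rewrite lerD2l powRM// ?(ltW (eta0 _))// ler_wpM2r ?powR_ge0//.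
    by rewrite -[leRHS]powRr1//; apply: ler_powR => //; lra.
  rewrite big_split/=.
  have h1 : \sum_(l < N | M l != 0) ld l `^ g <= e.
    rewrite -lee_fin; apply: le_trans (ltW Ue).
    apply: le_trans (nneseries_lim_ge N _); last first.
      by move=> k _ _; rewrite /diam_pow; case: ifP => // _; exact: poweR_ge0.
    rewrite big_mkord -sumEFin big_mkcond/=; apply: lee_sum => l _.
    case: ifPn => [Ml|_]; last by rewrite /diam_pow; case: ifP => // _; exact: poweR_ge0.
    have [y Uy] := Une _ Ml; rewrite /diam_pow ifF; last first.
      by apply/eqP => U0; rewrite U0 in Uy.
    by rewrite -(fineK (Ufin _ _ Uy)) poweR_EFin.
  have h2 : \sum_(l < N | M l != 0) 3 * (e / 2 ^+ l.+1) <= 3 * e.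
    apply: (@le_trans _ _ (\sum_(l < N) 3 * (e / 2 ^+ l.+1))).
      rewrite [leRHS](bigID (fun l : 'I_N => M l != 0))/= lerDl sumr_ge0// => l _.
      by rewrite mulr_ge0// divr_ge0 ?exprn_ge0// ltW.
    rewrite -mulr_sumr geo ler_wpM2l// gerBl divr_ge0 ?exprn_ge0//; exact: ltW.
  lra.
(* Weight of the inequality between arithmetic and geometric means applied to each class: it makes
   the energy term [C / lam] equal to [c]. *)
pose lam := C / c.
have lam0 : 0 < lam by exact: divr_gt0.
have step l : v * M l <= (lam * (if M l != 0 then ell l `^ g else 0) + v ^+ 2 * Q l / lam) / 2.
  case: ifPn => [Ml|]; last first.
    have vQ : 0 <= v ^+ 2 * Q l by rewrite mulr_ge0 ?sqr_ge0.
    by rewrite negbK => /eqP ->; rewrite !mulr0 add0r divr_ge0// divr_ge0// ltW.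
  have [y Uy] := Une _ Ml; have l0 : 0 <= ld l by exact: le_trans (ld_ub _ _ _ Uy Uy).
  have el0 : 0 < ell l by rewrite ltr_wpDl// mulr_gt0.
  pose L := ell l `^ g; have L0 : 0 < L by exact: powR_gt0.
  have aQ : (v * M l) ^+ 2 / L <= v ^+ 2 * Q l.
    by rewrite exprMn -mulrA ler_wpM2l ?sqr_ge0// -powRN.
  have : (v * M l) ^+ 2 / L / lam <= v ^+ 2 * Q l / lam.
    by rewrite ler_wpM2r// invr_ge0 ltW.
  have : 0 <= (lam * L - v * M l) ^+ 2 / (lam * L).
    by rewrite divr_ge0 ?sqr_ge0// ltW// mulr_gt0.
  have -> : (lam * L - v * M l) ^+ 2 / (lam * L) =
     lam * L - 2 * (v * M l) + (v * M l) ^+ 2 / L / lam.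
    move: (v * M l) lam0 L0; move: (lam) (L) => u1 u2 u3 u10 u20.
    by field; rewrite !gt_eqF.
  have comb (u1 u2 u3 u4 : R) :
    0 <= u1 - 2 * u2 + u3 -> u3 <= u4 -> u2 <= (u1 + u4) / 2 by lra.
  exact: comb.
have fin : c <= (lam * (4 * e) + C / lam) / 2.
  apply: le_trans hc _; rewrite sM mulr_sumr.
  apply: (@le_trans _ _ (\sum_(l < N) ((lam * (if M l != 0 then ell l `^ g else 0) + v ^+ 2 * Q l / lam) / 2))).
    by apply: ler_sum => l _; exact: step.
  rewrite -mulr_suml ler_wpM2r// big_split/= -mulr_sumr -mulr_suml -mulr_sumr -big_mkcond/=.
  apply: lerD; first by rewrite ler_wpM2l// ltW.
  rewrite ler_wpM2r ?invr_ge0 ?(ltW lam0)//; apply: le_trans hC.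
  by rewrite ler_wpM2l ?sqr_ge0.
have : C / lam = c by rewrite /lam invf_div mulrC divfK// gt_eqF.
have : lam * (4 * e) = c / 4.
  have Cn0 : C != 0 by rewrite gt_eqF.
  have -> : e = c ^+ 2 / (16 * C) by rewrite -eE mulfK// mulf_neq0.
  by rewrite /lam; field; rewrite Cn0 gt_eqF.
lra.
Qed.

End Hausdorff.

(** * Lower bounds *)

Section ZeroSets.
Context {R : realType} {disp : measure_display} {Omega : measurableType disp}.
Variable P : probability Omega R.
Variables (d : nat) (B : R -> Omega -> 'rV[R]_d).
Hypothesis hB : brownian_motion P B.
Variable w : Omega.

(* Freezing the path at negative times makes it continuous on the whole line. *)
Definition posp (t : R) : R := (t + `|t|) / 2.

Lemma posp_id t : 0 <= t -> posp t = t.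
Proof. by move=> t0; rewrite /posp ger0_norm//; lra. Qed.

Lemma posp_ge0 t : 0 <= posp t.
Proof. by rewrite /posp; have := ler_norm (- t); rewrite normrN; lra. Qed.

Lemma posp_continuous : continuous posp.
Proof.
move=> t; apply: cvgM; last exact: cvg_cst.
by apply: cvgD; [exact: cvg_id|exact: norm_continuous].
Qed.

Lemma coord_continuous c : continuous (fun t => B (posp t) w ord0 c).
Proof.
move=> t.
have h := @bm1_continuous _ _ _ _ _ (bm_coordinates hB c) w (posp t).
move=> S hS; have h' := h S hS.
have : within [set t : R | 0 <= t] (nbhs (posp t)) ((fun t => B t w ord0 c) @^-1` S).
  by rewrite (nbhs_subspace_in (posp_ge0 t : [set t : R | 0 <= t] _)).
rewrite /within/= => hS'.
have {}hS' : \forall x \near t, 0 <= posp x -> S (B (posp x) w ord0 c).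
  exact: (posp_continuous hS').
change (nbhs t [set x | S (B (posp x) w ord0 c)]).
by apply: filterS hS' => x; apply; exact: posp_ge0.
Qed.

Definition loopd (p : R * R) : R :=
  \sum_c `|B (posp (p.1 + p.2)) w ord0 c - B (posp p.1) w ord0 c|.

Lemma sum_continuous (T : topologicalType) (I : Type) (s : seq I)
    (f : I -> T -> R) : (forall i, continuous (f i)) ->
  continuous (fun x => \sum_(i <- s) f i x).
Proof.
move=> cf; elim: s => [|i s IH].
  rewrite (_ : (fun x => _) = cst 0); first exact: cst_continuous.
  by apply/funext => x; rewrite big_nil.
rewrite (_ : (fun x => _) = (fun x => f i x + \sum_(j <- s) f j x)).
  by move=> x; apply: cvgD; [exact: cf|exact: IH].
by apply/funext => x; rewrite big_cons.
Qed.

Lemma loopd_continuous : continuous loopd.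
Proof.
apply: sum_continuous => c p.
apply: cvg_norm; apply: cvgB.
  apply: (@continuous_comp _ _ _ (fun p : R * R => p.1 + p.2) (fun t => B (posp t) w ord0 c)).
    by apply: cvgD; [exact: cvg_fst|exact: cvg_snd].
  exact: coord_continuous.
apply: (@continuous_comp _ _ _ (fun p : R * R => p.1) (fun t => B (posp t) w ord0 c)).
  exact: cvg_fst.
exact: coord_continuous.
Qed.

Lemma loopd_eq0 s u : 0 <= s -> 0 <= u ->
  loopd (s, u) = 0 <-> B (s + u) w = B s w.
Proof.
move=> s0 u0; rewrite /loopd/= !posp_id ?addr_ge0//; split => [h|->].
  apply/rowP => c; apply/eqP; rewrite -subr_eq0 -normr_eq0.
  move: h => /eqP; rewrite psumr_eq0// => /allP /(_ c).
  by rewrite mem_index_enum => /(_ isT).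
by rewrite big1// => c _; rewrite subrr normr0.
Qed.

(** Bounding the starting times as well as the durations makes this the projection of a compact set,
    the zeros of [loopd] in a rectangle. *)
Definition loops (S lo hi : R) : set R :=
  [set u | lo <= u <= hi /\ exists s, 0 <= s <= S /\ B (s + u) w = B s w].

Lemma loops_compact S lo hi : 0 <= lo -> compact (loops S lo hi).
Proof.
move=> lo0.
pose Z := (`[0, S]%classic `*` `[lo, hi]%classic) `&` loopd @^-1` [set 0].
have cZ : compact Z.
  apply: compact_closedI; first by apply: compact_setX; exact: segment_compact.
  apply: preimage_closed; last exact: closed_eq.
  by move=> x _; exact: loopd_continuous.
rewrite (_ : loops S lo hi = snd @` Z).
  apply: continuous_compact => //; apply: continuous_subspaceT => x; exact: cvg_snd.
apply/seteqP; split => [u [/andP[u1 u2] [s [/andP[s1 s2] e]]]|_ [[s u] [[/= + +] e] <-]]/=.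
  exists (s, u) => //; split; first by split => /=; rewrite in_itv/=; apply/andP.
  by apply/loopd_eq0 => //; exact: le_trans u1.
rewrite !in_itv/= => /andP[s1 s2] /andP[u1 u2]; split; first exact/andP.
exists s; split; first exact/andP.
by apply/loopd_eq0 => //; exact: le_trans u1.
Qed.

(** On the compact set of pairs whose duration lies outside [O], [loopd] does not vanish, so its
    values stay away from 0. This places the lags of near-loops of the grid in [O]. *)
Lemma loops_near S lo hi (O : set R) : 0 <= lo -> open O -> loops S lo hi `<=` O ->
  exists2 e, 0 < e & forall s u, 0 <= s <= S -> lo <= u <= hi ->
    loopd (s, u) < e -> O u.
Proof.
move=> lo0 oO LO.
pose K := (`[0, S]%classic `*` `[lo, hi]%classic) `&` snd @^-1` (~` O).
have cK : compact K.
  apply: compact_closedI; first by apply: compact_setX; exact: segment_compact.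
  apply: preimage_closed; last exact: open_closedC.
  by move=> x _; exact: cvg_snd.
have /compact_closed : compact (loopd @` K).
  by apply: continuous_compact => //; apply: continuous_subspaceT; exact: loopd_continuous.
move=> /(_ (@Rhausdorff R)) /closed_openC.
rewrite openE => /(_ 0)[].
  move=> [[s u] [[/= + +] nO] e]; rewrite !in_itv/= => /andP[s1 s2] /andP[u1 u2].
  apply: nO; apply: LO; split; first exact/andP.
  exists s; split; first exact/andP.
  by apply/loopd_eq0 => //; exact: le_trans u1.
move=> e /= e0 he; exists e => // s u hs hu hl; apply: contrapT => nO.
apply: (he (loopd (s, u))).
  rewrite /ball/= sub0r normrN ger0_norm//.
  by rewrite sumr_ge0.
exists (s, u) => //; split => //.
Qed.

Lemma sigma_compact_Span : sigma_compact (Span B w).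
Proof.
exists (fun n => loops n%:R 0 n%:R); split; first by move=> n; exact: loops_compact.
apply/seteqP; split => [u [s [t [s0 st e ->]]]|u [n _ [/andP[u0 un] [s [/andP[s0 sn] e]]]]]; last first.
  exists s, (s + u); split => //; first by rewrite lerDl.
  by rewrite addrAC subrr add0r.
have [n hn] : exists n : nat, t <= n%:R.
  by exists (Num.truncn t).+1; apply/ltW; rewrite truncnS_gt.
exists n => //; split; first by rewrite subr_ge0 st/=; lra.
exists s; split; first by rewrite s0/=; lra.
by rewrite addrC subrK.
Qed.

Lemma exp2V_small (x : R) : 0 < x -> exists n1, forall n, (n1 <= n)%N -> 2 ^- n < x.
Proof.
move=> x0; exists (Num.truncn x^-1).+1 => n hn.
rewrite -[ltRHS]invrK ltf_pV2 ?posrE ?exprn_gt0 ?invr_gt0//.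
apply: (lt_le_trans (truncnS_gt _)); apply: (@le_trans _ _ n%:R); first by rewrite ler_nat.
by rewrite -natrX ler_nat ltnW// ltn_expl.
Qed.

(** A block has [2 ^ (n - q)] indices per unit of [M], hence real length [M.+1 / 2 ^ q] at every
    scale: durations and starting times of the hits stay in fixed compact intervals. The points of
    the spread are the durations of the hits, and [(2 ^+ q) ^ g] converts the kernel from grid units
    to real time. *)
Lemma bgood_spread (g : R) (q M K : nat) (c C : R) :
  0 < g -> (1 <= M)%N ->
  (forall n0, exists n k, [/\ (n0 <= n)%N, (q <= n)%N, (k < K)%N &
    bgood B g n M (2 ^ (n - q)) (k * (M.+1 * 2 ^ (n - q)))
      ((2 ^ (n - q))%:R `^ (d%:R / 2 - 2)) c C w]) ->
  spread (loops ((K * M.+1)%:R / 2 ^+ q) ((M - 1)%:R / 2 ^+ q) (M.+1%:R / 2 ^+ q))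
    g c ((2 ^+ q) `^ g * C).
Proof.
move=> g0 M1 hgood O oO LO eta eta0.
have lo0 : 0 <= (M - 1)%:R / 2 ^+ q :> R by rewrite divr_ge0// exprn_ge0.
have [e e0 he] := loops_near lo0 oO LO.
have [n1 hn1] : exists n1, forall n, (n1 <= n)%N -> d%:R * rad n < e :> R /\ 2 ^- n < eta :> R.
  have [n1 h1] := exp2V_small eta0.
  have ed0 : 0 < e / d.+1%:R by rewrite divr_gt0 ?ltr0n.
  have [n2 h2] := exp2V_small (exprn_gt0 2 ed0).
  exists (maxn n1 n2) => n; rewrite geq_max => /andP[n1n n2n]; split; last exact: h1.
  have : rad n < e / d.+1%:R.
    rewrite -(ger0_norm (ltW ed0)) -sqrtr_sqr /rad ltr_sqrt ?exprn_gt0//.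
    exact: h2.
  rewrite ltr_pdivlMr ?ltr0n// mulrC; apply: le_lt_trans.
  by rewrite ler_wpM2r ?ler_nat//; exact/ltW/rad_gt0.
have [n [k [n1n qn kK [hM hE]]]] := hgood n1.
have [drn dn] := hn1 n n1n.
set H := (2 ^ (n - q))%N in hM hE *.
have H0 : (0 < H)%N by rewrite expn_gt0.
have dH : 2 ^- n = 2 ^- q / H%:R :> R.
  by rewrite /H natrX -{1}(subnKC qn) exprD invfM.
pose b := (k * (M.+1 * H))%N.
pose S := [set x : 'I_H * 'I_H | w \in @bhit R disp Omega d B n M H b x]%SET.
have indS x : \1_(@bhit R disp Omega d B n M H b x) w = (x \in S)%:R :> R.
  by rewrite indicE inE.
pose pos (x : 'I_H * 'I_H) : R := (M * H + x.2 - x.1)%:R * 2 ^- n.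
have le_pos (x : 'I_H * 'I_H) : (x.1 <= M * H + x.2)%N.
  apply: (leq_trans (ltnW (ltn_ord x.1))); apply: leq_trans (leq_addr _ _).
  by rewrite leq_pmull.
have sumS (F : 'I_H * 'I_H -> R) : \sum_x F x * (x \in S)%:R = \sum_(x in S) F x.
  rewrite [RHS]big_mkcond/=; apply: eq_bigr => x _.
  by case: (x \in S); rewrite ?mulr1 ?mulr0.
exists ('I_H * 'I_H)%type, S, pos, (H%:R `^ (d%:R / 2 - 2)), (2 ^- n).
split.
- exact: powR_ge0.
- by rewrite invr_gt0 exprn_gt0.
- move=> x; rewrite inE => /set_mem hx.
  apply: (he ((b + x.1)%:R * 2 ^- n)).
  + rewrite mulr_ge0 ?invr_ge0 ?exprn_ge0//= dH mulrA ler_pdivrMr ?ltr0n//.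
    rewrite mulrAC ler_wpM2r ?invr_ge0 ?exprn_ge0// -natrM ler_nat /b.
    case: x {hx} => [[j jH] ?] /=; nia.
  + rewrite /pos dH !mulrA ler_pdivlMr ?ltr0n// ler_pdivrMr ?ltr0n//.
    rewrite ![_ / 2 ^+ q * _]mulrAC !ler_wpM2r ?invr_ge0 ?exprn_ge0// -natrM ler_nat.
      by case: x {hx} => [[j jH] [k' kH]] /=; nia.
    by case: x {hx} => [[j jH] [k' kH]] /=; nia.
  + apply: le_lt_trans drn; rewrite /loopd/= -mulrDl -natrD.
    rewrite !posp_id ?mulr_ge0 ?invr_ge0 ?exprn_ge0//.
    have -> : (b + x.1 + (M * H + x.2 - x.1) = b + M * H + x.2)%N.
      by case: x {hx} => [[j jH] [k' kH]] /=; nia.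
    rewrite (_ : d%:R * rad n = \sum_(c' < d) rad n); last first.
      by rewrite sumr_const card_ord mulr_natl.
    apply: ler_sum => c' _.
    exact: (hx c' I).
- move: hM; rewrite /bmass; under eq_bigr do rewrite indS -[_%:R]mul1r.
  by rewrite (sumS (fun=> 1)) sumr_const.
- have q0 : 0 < (2 ^+ q) `^ g :> R by rewrite powR_gt0// exprn_gt0.
  have Kle x y : (`|pos x - pos y| + 2 ^- n) `^ (- g) <= (2 ^+ q) `^ g * kapp g x y :> R.
    have -> : `|pos x - pos y| + 2 ^- n = (dst (y.2 + x.1) (x.2 + y.1)).+1%:R * 2 ^- n.
      have e1 : pos x - pos y = ((x.2 + y.1)%:R - (y.2 + x.1)%:R) * 2 ^- n.
        rewrite /pos -mulrBl; congr (_ * _).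
        by rewrite !natrB ?le_pos// !natrD; ring.
      have e2 := dst_natrB (y.2 + x.1) (x.2 + y.1) : _ = _ :> R.
      rewrite e1 normrM e2 (ger0_norm (_ : 0 <= 2 ^- n)) ?invr_ge0 ?exprn_ge0//.
      by rewrite -[X in _ = X * _]natr1 mulrDl mul1r.
    rewrite powRM ?invr_ge0 ?exprn_ge0// /kapp mulrC mulrA ler_wpM2r ?powR_ge0//.
    have qH : 0 < 2 ^+ q * H%:R :> R by rewrite mulr_gt0 ?exprn_gt0 ?ltr0n.
    rewrite dH -invfM -(powR_inv1 (ltW qH)) -powRrM mulrNN mul1r.
    rewrite powRM ?exprn_ge0// ler_wpM2l ?powR_ge0//.
    by apply: ge0_ler_powR; rewrite ?nnegrE ?(ltW g0)// ler_nat leq_pmull.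
  apply: (@le_trans _ _ ((2 ^+ q) `^ g * benergy B g n M H b (H%:R `^ (d%:R / 2 - 2)) w)); last first.
    by rewrite ler_wpM2l// ltW.
  rewrite /benergy mulrCA ler_wpM2l ?sqr_ge0// mulr_sumr.
  under [leRHS]eq_bigr do under eq_bigr do rewrite !indS mulrA mulrAC.
  under [leRHS]eq_bigr do rewrite -mulr_suml mulrA.
  rewrite sumS; apply: ler_sum => x _; rewrite sumS mulr_sumr.
  by apply: ler_sum => y _; exact: Kle.
Qed.

End ZeroSets.

Section HausdorffMono.
Context {R : realType}.
Implicit Types (A : set R) (g s delta : R).

Lemma diam_pow_ge0 s A : (0 <= diam_pow s A)%E.
Proof. by rewrite /diam_pow; case: ifP => // _; exact: poweR_ge0. Qed.

Lemma hausdorff_premeasure_ge0 s delta A : (0 <= hausdorff_premeasure s delta A)%E.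
Proof.
apply/ereal_infP => _ [U _ <-]; apply: nneseries_ge0 => k _ _.
exact: diam_pow_ge0.
Qed.

Lemma hausdorff_measure_ge0 s A : (0 <= hausdorff_measure s A)%E.
Proof.
apply: (@le_trans _ _ (hausdorff_premeasure s 1 A)); first exact: hausdorff_premeasure_ge0.
by apply: ereal_sup_ubound; exists 1 => //=.
Qed.

Lemma hausdorff_measure_eq0 s A :
  hausdorff_measure s A = 0%E <->
  forall delta, 0 < delta -> hausdorff_premeasure s delta A = 0%E.
Proof.
split => [A0 delta d0|A0].
  apply/eqP; rewrite eq_le hausdorff_premeasure_ge0 andbT -A0.
  by apply: ereal_sup_ubound; exists delta.
apply/eqP; rewrite eq_le hausdorff_measure_ge0 andbT.
by apply: ub_ereal_sup => _ [delta /= d0 <-]; rewrite A0.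
Qed.

Lemma hausdorff_measure_sub s A A' : A' `<=` A ->
  hausdorff_measure s A = 0%E -> hausdorff_measure s A' = 0%E.
Proof.
move=> sA /hausdorff_measure_eq0 A0; apply/hausdorff_measure_eq0 => delta d0.
apply/eqP; rewrite eq_le hausdorff_premeasure_ge0 andbT -(A0 _ d0).
apply: le_ereal_inf => _ [U [AU Ud] <-]; exists U => //; split => //.
exact: subset_trans AU.
Qed.

Lemma hausdorff_measure_exp s g A : 0 <= s -> s <= g ->
  hausdorff_measure s A = 0%E -> hausdorff_measure g A = 0%E.
Proof.
move=> s0 sg /hausdorff_measure_eq0 A0; apply/hausdorff_measure_eq0 => delta d0.
have m0 : 0 < Num.min delta 1 by rewrite lt_min d0/=.
apply/eqP; rewrite eq_le hausdorff_premeasure_ge0 andbT -(A0 _ m0).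
apply/ereal_infP => _ [U [AU Ud] <-].
apply: (@le_trans _ _ (\big[+%E/0%R]_(0 <= k <oo) diam_pow g (U k))%E).
  apply: ereal_inf_lbound; exists U => //; split => // k.
  by apply: le_trans (Ud k) _; rewrite lee_fin ge_min lexx.
apply: lee_nneseries => [k _ _|k _]; first exact: diam_pow_ge0.
rewrite /diam_pow; case: ifPn => // /set0P[x Ux].
have U1 : (diam (U k) <= 1%:E)%E by apply: le_trans (Ud k) _; rewrite lee_fin ge_min lexx orbT.
have := diam_fin Ux U1; have := diam_ub Ux Ux; rewrite subrr normr0.
case: (diam (U k)) U1 => // r; rewrite !lee_fin => r1 r0 _.
(* Diameter 0 is treated apart because of [0 ^ 0 = 1]: monotonicity in the exponent survives, as the
   value can only drop from 1 to 0 when the exponent grows. *)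
have [->|rn0] := eqVneq r 0.
  have [->|sn0] := eqVneq s 0; first by rewrite powRr0; have [->|gn0] := eqVneq g 0; rewrite ?powRr0 ?powR0.
  by rewrite !powR0// gt_eqF// (lt_le_trans _ sg)// lt_def sn0.
have rp : 0 < r by rewrite lt_def rn0.
rewrite /powR !gt_eqF// ler_expR ler_wnM2r// -ln1 ler_ln// ?posrE//.
Qed.

Lemma hausdorff_measure_set0 s : hausdorff_measure s (set0 : set R) = 0%E.
Proof.
apply/hausdorff_measure_eq0 => delta d0.
apply/eqP; rewrite eq_le hausdorff_premeasure_ge0 andbT.
apply: ereal_inf_lbound; exists (fun=> set0).
  split => // k; rewrite /diam [X in ereal_sup X](_ : _ = set0) ?ereal_sup0 ?leNye//.
  by apply/seteqP; split => // y [].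
by rewrite eseries0// => k _ _; rewrite /diam_pow eqxx.
Qed.

End HausdorffMono.

Section LowerBound.
Context {R : realType} {disp : measure_display} {Omega : measurableType disp}.
Variable P : probability Omega R.
Variables (d : nat) (B : R -> Omega -> 'rV[R]_d).
Hypothesis hB : brownian_motion P B.

Lemma bgood_sigma (g : R) n N M H b (v c C : R) :
  (1 <= M)%N -> (b + M.+1 * H <= N)%N ->
  <<s sigX (@gridI R _ _ d B n N) (gridJ N (fun _ i => b <= i < b + M.+1 * H)%N) >>
    (bgood B g n M H b v c C).
Proof.
move=> M1 bN; set J := gridJ _ _.
pose T := g_sigma_algebraType (sigX (@gridI R _ _ d B n N) J).
have mhit (x : 'I_H * 'I_H) : @measurable _ T (@bhit R disp Omega d B n M H b x).
  apply: (@fin_bigcap_measurable _ T) => // c' _.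
  rewrite -[hit1 _ _ _ _ _ _]setTI; apply: (@measurable_fun_ler _ T) => //.
  apply: measurableT_comp; first exact: normr_measurable.
  have h1 := ltn_ord x.1; have h2 := ltn_ord x.2.
  have h3 : (H <= M * H)%N by rewrite leq_pmull.
  rewrite mulSn in bN *.
  apply: gridD_measurable_fun; [lia|lia|].
  by move=> i; lia.
have mI (F : set Omega) : @measurable _ T F -> measurable_fun (T := T) setT (\1_F : Omega -> R).
  by move=> mF; exact: (@measurable_indic _ T).
have mM : measurable_fun (T := T) setT (bmass B n M H b v).
  apply: measurable_funM => //; apply: (@measurable_sum _ T) => x; exact: mI.
have mE : measurable_fun (T := T) setT (benergy B g n M H b v).
  apply: measurable_funM => //; apply: (@measurable_sum _ T) => x.
  apply: (@measurable_sum _ T) => y.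
  by apply: measurable_funM => //; apply: measurable_funM; exact: mI.
have : @measurable _ T (bgood B g n M H b v c C).
  rewrite [bgood _ _ _ _ _ _ _ _ _](_ : _ = [set w | c <= bmass B n M H b v w] `&`
    [set w | benergy B g n M H b v w <= C])//.
  apply: measurableI; rewrite -[X in measurable X]setTI.
    exact: (@measurable_fun_ler _ T).
  exact: (@measurable_fun_ler _ T).
by [].
Qed.

Lemma bgood_measurable (g : R) n M H b (v c C : R) : (1 <= M)%N ->
  measurable (bgood B g n M H b v c C).
Proof.
move=> M1; have := @bgood_sigma g n _ M H b v c C M1 (leqnn _).
by apply: sigX_measurable => x; exact: (gridI_measurable hB).
Qed.

Lemma bgood_indep (g : R) n M H K (v c C p : R) : (1 <= M)%N -> 
  (forall b, p <= prob P (bgood B g n M H b v c C)) ->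
  prob P (\bigcap_(k < K) ~` bgood B g n M H (k * (M.+1 * H)) v c C) <= (1 - p) ^+ K.
Proof.
move=> M1 hp; pose L := (M.+1 * H)%N; pose N := (K * L)%N.
(* Blocks of index at least [K] leave the grid of size [N]; their events are made trivial. *)
pose E k := if (k < K)%N then ~` bgood B g n M H (k * L) v c C else setT.
pose X := @gridI R _ _ d B n N.
pose J k := gridJ (d := d) N (fun _ i => k * L <= i < k * L + L)%N.
have sE k : <<s sigX X (J k) >> (E k).
  rewrite /E; case: ifPn => kK.
    apply: (@measurableC _ (g_sigma_algebraType (sigX X (J k)))).
    apply: bgood_sigma => //; rewrite -/L /N -mulSnr leq_mul2r kK orbT//.
  exact: (@measurableT _ (g_sigma_algebraType (sigX X (J k)))).
have dJ k l : (k < l)%N -> forall i, i \in J k -> i \notin J l.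
  move=> kl [c' i]; rewrite !inE/= => /andP[_ ilt]; rewrite negb_and -ltnNge.
  apply/orP; left; apply: leq_trans ilt _.
  by rewrite -mulSnr leq_mul2r kl orbT.
have -> : \bigcap_(k < K) ~` bgood B g n M H (k * (M.+1 * H)) v c C = \bigcap_(k < K) E k.
  by apply: eq_bigcapr => k /= kK; rewrite /E kK.
have mX i : measurable_fun setT (X i) by exact: (gridI_measurable hB).
have mE k : measurable (E k) by exact: (sigX_measurable mX (sE k)).
have := indep_sigX_family K mX (gridI_indep hB (n := n) (N := N)) dJ sE.
rewrite probE; last first.
  by apply: fin_bigcap_measurable => [|k _]; [exact: finite_II|exact: mE].
under eq_bigr do rewrite probE//.
rewrite prodEFin => h; rewrite (EFin_inj h).
rewrite -[X in _ ^+ X]card_ord -prodr_const; apply: ler_prod => k _.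
rewrite prob_ge0 /E ltn_ord prob_setC; last exact: bgood_measurable.
by rewrite lerD2l lerN2 hp.
Qed.

(** [K] depends on the path but not on the scale. The event that the first [K] blocks fail at every
    scale beyond [n0] increases with [n0] and has probability at most [(1 - p) ^ K], and so has its
    union over [n0]; the intersection over [K] is null. Independence is used only inside one
    scale. *)
Lemma bgood_io (g : R) (q M : nat) : (2 <= M)%N -> 0 <= g -> g <= d%:R / 2 ->
  g < 2 - d%:R / 2 ->
  exists c C : R, [/\ 0 < c, 0 < C & {ae P, forall w, exists K, forall n0, exists n k,
    [/\ (n0 <= n)%N, (q <= n)%N, (k < K)%N &
    bgood B g n M (2 ^ (n - q)) (k * (M.+1 * 2 ^ (n - q)))
      ((2 ^ (n - q))%:R `^ (d%:R / 2 - 2)) c C w]}].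
Proof.
move=> M2 g0 gd g2.
have [c [C [p [c0 C0 p0 hp]]]] := bgood_prob hB M2 g0 gd g2.
have M1 : (1 <= M)%N by exact: ltnW.
exists c, C; split => //.
pose G n k := bgood B g n M (2 ^ (n - q)) (k * (M.+1 * 2 ^ (n - q)))
      ((2 ^ (n - q))%:R `^ (d%:R / 2 - 2)) c C.
pose F K n := \bigcap_(k < K) ~` G n k.
have mG n k : measurable (G n k) by exact: bgood_measurable.
have mF K n : measurable (F K n).
  apply: fin_bigcap_measurable => [|k _]; first exact: finite_II.
  by apply: measurableC.
have pF K n : prob P (F K n) <= (1 - p) ^+ K.
  by apply: bgood_indep => // b; apply: hp; rewrite expn_gt0.
pose A K n0 := \bigcap_(n in [set n | (n0 <= n)%N /\ (q <= n)%N]) F K n.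
have mA K n0 : measurable (A K n0).
  apply: bigcap_measurable => //; exists (maxn n0 q).
  by split; rewrite ?leq_maxl ?leq_maxr.
have pA K n0 : prob P (A K n0) <= (1 - p) ^+ K.
  apply: le_trans (pF K (maxn n0 q)); apply: le_prob => // w.
  by apply; split; rewrite ?leq_maxl ?leq_maxr.
pose D K := \bigcup_n0 A K n0.
have mD K : measurable (D K) by exact: bigcupT_measurable.
have pD K : (P (D K) <= ((1 - p) ^+ K)%:E)%E.
  have cv : P \o A K @ \oo --> P (D K).
    apply: nondecreasing_cvg_mu => //; first exact: mD.
    move=> m n mn; apply/subsetPset => w Aw i [/= ni qi]; apply: Aw; split => //.
    exact: leq_trans ni.
  rewrite -(cvg_lim _ cv)//; apply: lime_le; first by apply/cvg_ex; exists (P (D K)).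
  by near=> n; rewrite /= probE// lee_fin.
exists (\bigcap_K D K); split.
- exact: bigcapT_measurable.
- have : prob P (\bigcap_K D K) <= 0.
    have p1 : p <= 1.
      apply: le_trans (hp 0%N 1%N 0%N isT) _; apply: prob_le1; exact: bgood_measurable.
    have cv : (1 - p) ^+ K @[K --> \oo] --> (0 : R).
      by apply: cvg_expr; rewrite ger0_norm; lra.
    rewrite -(cvg_lim _ cv)//; apply: limr_ge; first by apply/cvg_ex; exists 0.
    near=> K; rewrite -lee_fin -probE; last exact: bigcapT_measurable.
    apply: le_trans (pD K); apply: le_measure; rewrite ?inE//.
      exact: bigcapT_measurable.
    by move=> w; exact.
  move=> h; rewrite probE; last exact: bigcapT_measurable.
  by congr (_%:E); apply/eqP; rewrite eq_le h prob_ge0.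
- move=> w /= nw K _; apply: contrapT => nD; apply: nw.
  exists K => n0; apply: contrapT => hn; apply: nD; exists n0 => // n [/= n0n qn] k kK Gk.
  by apply: hn; exists n, k.
Unshelve. all: by end_near.
Qed.

Lemma Span_hausdorff (g a b : R) : 0 < g -> g <= 1 -> g <= d%:R / 2 ->
  g < 2 - d%:R / 2 -> 0 <= a -> a < b ->
  {ae P, forall w, hausdorff_measure g (Span B w `&` [set u | a <= u <= b]) <> 0%E}.
Proof.
move=> g0 g1 gd g2 a0 ab.
have [q hq] : exists q, 3 * 2 ^- q <= b - a.
  have ba3 : 0 < (b - a) / 3 by rewrite divr_gt0// subr_gt0.
  have [q hq] := exp2V_small ba3.
  by exists q; have := hq q (leqnn _); lra.
(* [(M - 1) / 2 ^ q] is the first grid point beyond [a]. The durations of a block fill two steps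
   from there, which together with the rounding makes the three steps allowed by [hq]. Adding 2 also
   ensures [2 <= M]. *)
pose M := (Num.truncn (a * 2 ^+ q)).+2.
have aq0 : 0 <= a * 2 ^+ q by rewrite mulr_ge0// exprn_ge0.
have h1 : a <= (M - 1)%:R / 2 ^+ q.
  by rewrite ler_pdivlMr ?exprn_gt0// /M subSS subn0 ltW// truncnS_gt.
have h2 : M.+1%:R / 2 ^+ q <= b.
  have : (Num.truncn (a * 2 ^+ q))%:R / 2 ^+ q <= a.
    by rewrite ler_pdivrMr ?exprn_gt0// truncn_le.
  have -> : M.+1 = (Num.truncn (a * 2 ^+ q) + 3)%N by rewrite /M addn3.
  by rewrite natrD mulrDl; lra.
have M2 : (2 <= M)%N by [].
have [c [C [c0 C0 hio]]] := bgood_io q M2 (ltW g0) gd g2.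
apply: filterS hio => w [K hK] H0.
have lo0 : 0 <= (M - 1)%:R / 2 ^+ q :> R by rewrite divr_ge0// exprn_ge0.
have := @frostman _ (loops B w ((K * M.+1)%:R / 2 ^+ q) ((M - 1)%:R / 2 ^+ q) (M.+1%:R / 2 ^+ q)) g c ((2 ^+ q) `^ g * C).
apply => //.
- exact: (loops_compact hB).
- by rewrite mulr_gt0// powR_gt0// exprn_gt0.
- exact: (bgood_spread hB g0 (ltnW M2) hK).
apply: hausdorff_measure_sub H0 => u [/andP[u1 u2] [s [/andP[s0 sS] e]]]; split.
  exists s, (s + u); split => //; last by rewrite addrAC subrr add0r.
  by rewrite lerDl (le_trans a0)// (le_trans h1).
by rewrite /= (le_trans h1 u1) (le_trans u2 h2).
Qed.

End LowerBound.

(** * Upper bounds *)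

Section BorelCantelli.
Context {R : realType} {disp : measure_display} {Omega : measurableType disp}.
Variable P : probability Omega R.

(** The probabilities need only be small along a subsequence. This suffices for null Hausdorff
    measure, which asks for good covers at infinitely many scales only. *)
Lemma ae_io_not (E : nat -> set Omega) : (forall n, measurable (E n)) ->
  (forall e : R, 0 < e -> forall n0, exists2 n, (n0 <= n)%N & prob P (E n) <= e) ->
  {ae P, forall w, forall n0, exists2 n, (n0 <= n)%N & ~ E n w}.
Proof.
move=> mE hE; apply: ae_foralln => n0.
pose A := \bigcap_(n in [set n | (n0 <= n)%N]) E n.
have mA : measurable A by apply: bigcap_measurable => //; exists n0 => /=.
exists A; split => //.
- apply: prob_eq0 => //; apply/ler_addgt0Pr => e e0; rewrite add0r.
  have [n n0n hn] := hE e e0 n0; apply: le_trans hn.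
  by apply: le_prob => // w; apply.
- by move=> w /= h n /= n0n; apply: contrapT => nE; apply: h; exists n.
Qed.

Lemma ae_eventually_not (E : nat -> set Omega) (a : R) (m0 : nat) :
  (forall n, measurable (E n)) -> 0 <= a ->
  (forall n, (m0 <= n)%N -> prob P (E n) <= a / 2 ^+ n) ->
  {ae P, forall w, exists n0, forall n, (n0 <= n)%N -> ~ E n w}.
Proof.
move=> mE a0 hE.
pose A m := \bigcup_n E (n + m)%N.
have mA m : measurable (A m) by exact: bigcupT_measurable.
have pA m : (m0 <= m)%N -> prob P (A m) <= 2 * a / 2 ^+ m.
  move=> m0m; rewrite -lee_fin -probE//.
  apply: (@le_trans _ _ (\big[+%E/0%R]_(0 <= n <oo) P (E (n + m)%N))%E).
    exact: measure_sigma_subadditive.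
  apply: lime_le; first by apply: is_cvg_nneseries => n _ _; exact: measure_ge0.
  near=> N; rewrite big_mkord.
  under eq_bigr do rewrite probE//.
  rewrite sumEFin lee_fin.
  apply: (@le_trans _ _ (\sum_(i < N) a / 2 ^+ (i + m))).
    by apply: ler_sum => i _; apply: hE; exact: leq_trans (leq_addl _ _).
  have -> : \sum_(i < N) a / 2 ^+ (i + m) = 2 * a / 2 ^+ m - 2 * a / 2 ^+ (N + m) :> R.
    elim: (N) => [|k IH]; first by rewrite big_ord0 add0n subrr.
    rewrite big_ord_recr/= IH addSn exprS invfM.
    by move: (2 ^- m) (2 ^- (k + m)) => u1 u2; lra.
  by rewrite gerBl divr_ge0 ?exprn_ge0// mulr_ge0.
exists (\bigcap_m A m); split.
- exact: bigcapT_measurable.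
- apply: prob_eq0; first exact: bigcapT_measurable.
  apply/ler_addgt0Pr => e e0; rewrite add0r.
  have e1 : 0 < e / (2 * a + 1) by rewrite divr_gt0// ltr_wpDl// mulr_ge0.
  have [n1 hn1] := exp2V_small e1.
  have h1 := hn1 (maxn n1 m0) (leq_maxl _ _).
  apply: (@le_trans _ _ (prob P (A (maxn n1 m0)))).
    by apply: le_prob => //; [exact: bigcapT_measurable|move=> w; apply].
  apply: le_trans (pA _ (leq_maxr _ _)) _.
  rewrite ltr_pdivlMr in h1; last by rewrite ltr_wpDl// mulr_ge0.
  have : 0 <= 2 ^- (maxn n1 m0) :> R by rewrite invr_ge0 exprn_ge0.
  by move: (2 ^- _) h1 => u; lra.
- move=> w /= h m _; apply: contrapT => nA; apply: h.
  exists m => n mn En; apply: nA; exists (n - m)%N => //.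
  by rewrite subnK.
Unshelve. all: by end_near.
Qed.

End BorelCantelli.

(** * Dyadic modulus of continuity *)

Section Modulus.
Context {R : realType} {disp : measure_display} {Omega : measurableType disp}.
Variable P : probability Omega R.
Variables (d : nat) (B : R -> Omega -> 'rV[R]_d).
Hypothesis hB : brownian_motion P B.

(** The threshold is [n] standard deviations: its tail, of order [expR (- (n ^ 2 / 4))], beats the
    [T * 2 ^ n] grid steps, and only a factor [n] is lost. *)
Definition gooddy (T n0 : nat) (w : Omega) := forall n, (n0 <= n)%N ->
  forall c j, (j < T * 2 ^ n)%N -> `|gridD B n c j j.+1 w| <= n%:R * rad n.

Lemma expR_sqr_le (n : nat) : (8 <= n)%N -> expR (- (n%:R ^+ 2 / 4)) <= 4 ^- n :> R.
Proof.
move=> n8; have -> : 4 ^- n = (4^-1) ^+ n :> R by rewrite exprVn.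
apply: (@le_trans _ _ ((expR (- 2) : R) ^+ n)).
  rewrite -expRM_natl ler_expR mulrN lerN2.
  have : 8 <= n%:R :> R by rewrite ler_nat.
  have : 0 <= n%:R :> R by [].
  rewrite expr2; nra.
rewrite lerXn2r ?nnegrE ?expR_ge0 ?invr_ge0//.
rewrite expRN lef_pV2 ?posrE ?expR_gt0//.
have h := @expR_ge1Dx R 1.
rewrite (_ : 2 = 1 + 1)// expRD; nra.
Qed.

Lemma gooddy_ae T : {ae P, forall w, exists n0, gooddy T n0 w}.
Proof.
pose E n := \bigcup_(x in [set: 'I_d * 'I_(T * 2 ^ n)])
  [set w | n%:R * rad n < `|gridD B n x.1 x.2 x.2.+1 w|].
have mE1 n c j : measurable [set w | n%:R * rad n < `|gridD B n c j j.+1 w|].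
  rewrite -[X in measurable X]setTI; apply: measurable_fun_ltr => //.
  by apply: measurableT_comp; [exact: normr_measurable|exact: (gridD_measurable hB)].
have mE n : measurable (E n).
  by apply: fin_bigcup_measurable => // x _; exact: mE1.
have pE1 n c j : prob P [set w | n%:R * rad n < `|gridD B n c j j.+1 w|] <=
    2 * expR (- (n%:R ^+ 2 / 4)).
  have r0 := rad_gt0 (R := R) n.
  rewrite -lee_fin -probE//.
  have mA : measurable [set x : R | (n%:R * rad n < `|x|)%R].
    rewrite -[X in measurable X]setTI; exact: measurable_fun_ltr.
  have := gridB_gauss hB n c (ltnSn j) mA.
  rewrite subSnn sqrt_rad sqrtr1 mul1r => e.
  rewrite [X in (X <= _)%E](_ : _ = normal_prob 0 (rad n) [set x : R | (n%:R * rad n < `|x|)%R]); last exact: e.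
  exact: normal_prob_tail_le.
have := @ae_eventually_not _ _ _ P E (2 * d%:R * T%:R) 8 mE.
have h0 : 0 <= 2 * d%:R * T%:R :> R by rewrite !mulr_ge0.
move=> /(_ h0); have hE n : (8 <= n)%N -> prob P (E n) <= 2 * d%:R * T%:R / 2 ^+ n.
  move=> n8; apply: (@le_trans _ _ (\sum_(x : 'I_d * 'I_(T * 2 ^ n)) 2 * 4 ^- n)).
    apply: (@le_trans _ _ (\sum_(x : 'I_d * 'I_(T * 2 ^ n)) prob P [set w | n%:R * rad n < `|gridD B n x.1 x.2 x.2.+1 w|])).
      by apply: prob_bigcup_le => // w [x _ hx]; exists x.
    apply: ler_sum => x _; apply: le_trans (pE1 _ _ _) _.
    by rewrite ler_wpM2l// expR_sqr_le.
  rewrite sumr_const card_prod !card_ord -[X in X <= _]mulr_natr !natrM natrX.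
  rewrite le_eqVlt; apply/orP; left; apply/eqP.
  have -> : 4 ^- n = 2 ^- n * 2 ^- n :> R.
    by rewrite -invfM -exprMn -natrM.
  have : 2 ^+ n != 0 :> R by rewrite expf_neq0.
  by move: (2 ^+ n) => u u0; field.
move=> /(_ hE); apply: filterS => w [n0 hn0]; exists n0 => n n0n c j jT.
rewrite leNgt; apply/negP => h; apply: (hn0 n n0n).
by exists (c, Ordinal jT).
Qed.

Lemma rad_S n : rad n.+1 = rad 1 * rad n :> R.
Proof. by rewrite /rad -sqrtrM ?invr_ge0// -invfM -exprD add1n. Qed.

Lemma rad1_le : rad 1 <= 3 / 4 :> R.
Proof.
have <- : Num.sqrt ((3 / 4) ^+ 2) = 3 / 4 :> R by rewrite sqrtr_sqr ger0_norm.
by rewrite /rad; apply: ler_wsqrtr; rewrite expr1 expr2; lra.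
Qed.

(* Dominates [\sum_(k > n) k * rad k], the error of dyadic chaining below the
   scale [n], see [modl_step]. *)
Definition modl n : R := 3 * (n + 4)%:R * rad n.

(** With [p = rad 1] this reads [(4 * n + 16) * p <= 3 * n + 12], that is [p <= 3 / 4]: hence the
    constants 3 and 4 in [modl]. *)
Lemma modl_step n : n.+1%:R * rad n.+1 <= modl n - modl n.+1.
Proof.
rewrite /modl rad_S; have := rad_gt0 (R := R) n; have := rad1_le.
have := rad_gt0 (R := R) 1.
have -> : (n.+1 + 4)%:R = n%:R + 5 :> R by rewrite -natrD addSnnS.
have -> : (n + 4)%:R = n%:R + 4 :> R by rewrite natrD.
have -> : n.+1%:R = n%:R + 1 :> R by rewrite natr1.
have : 0 <= n%:R :> R by [].
move: (n%:R : R) (rad 1 : R) (rad n : R) => x p q x0 p0 p1 q0.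
have : 0 <= q * ((x + 1) * (3 / 4 - p)) by rewrite mulr_ge0 ?mulr_ge0//; lra.
have : 0 <= q * (3 / 4 - p) by rewrite mulr_ge0//; lra.
nra.
Qed.

Definition dyf (t : R) n := Num.truncn (t * 2 ^+ n).

Lemma dyf_itv t n : 0 <= t -> gridt n (dyf t n) <= t < gridt n (dyf t n).+1.
Proof.
move=> t0; rewrite /gridt /dyf ler_pdivrMr ?exprn_gt0// ltr_pdivlMr ?exprn_gt0//.
by rewrite truncnS_gt truncn_le ?mulr_ge0 ?exprn_ge0.
Qed.

Lemma dyf_S t n : 0 <= t -> dyf t n.+1 = (2 * dyf t n)%N \/ dyf t n.+1 = (2 * dyf t n).+1.
Proof.
move=> t0; have /andP[h1 h2] := dyf_itv n t0; have /andP[h3 h4] := dyf_itv n.+1 t0.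
have e k : gridt n k = gridt n.+1 (2 * k) :> R.
  rewrite /gridt exprS natrM -mulf_div divff ?mul1r//.
rewrite e in h1; rewrite e in h2.
have lt1 j k : gridt n.+1 j < gridt n.+1 k :> R -> (j < k)%N.
  by rewrite /gridt ltr_pM2r ?invr_gt0 ?exprn_gt0// ltr_nat.
have := lt1 _ _ (le_lt_trans h1 h4); have := lt1 _ _ (le_lt_trans h3 h2).
lia.
Qed.

(** Consecutive dyadic approximations of [t] differ by at most one step of the finer grid; the
    errors telescope through [modl_step], and continuity of the path gives the limit. *)
Lemma chaining T n0 w c t n : gooddy T n0 w -> 0 <= t -> t < T%:R -> (n0 <= n)%N ->
  `|B t w ord0 c - gridB B n c (dyf t n) w| <= modl n.
Proof.
move=> gw t0 tT n0n.
have step m : (n0 <= m)%N ->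
    `|gridB B m.+1 c (dyf t m.+1) w - gridB B m c (dyf t m) w| <= m.+1%:R * rad m.+1.
  move=> n0m; have e : gridB B m c (dyf t m) w = gridB B m.+1 c (2 * dyf t m) w.
    congr (B _ w ord0 c); rewrite /gridt exprS natrM -mulf_div divff ?mul1r//.
  rewrite e; have [->|E] := dyf_S m t0.
    by rewrite subrr normr0 mulr_ge0// ltW// rad_gt0.
  rewrite E; apply: (gw m.+1 (leq_trans n0m (leqnSn _)) c).
  have /andP[h _] := dyf_itv m t0; have {h} := le_lt_trans h tT.
  rewrite /gridt ltr_pdivrMr ?exprn_gt0// -natrX -natrM ltr_nat expnS => h.
  by rewrite mulnCA ltn_pmul2l.
have part L : `|gridB B (n + L) c (dyf t (n + L)) w - gridB B n c (dyf t n) w| <=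
    modl n - modl (n + L)%N.
  elim: L => [|L IH]; first by rewrite addn0 !subrr normr0.
  rewrite addnS (_ : _ - _ = (gridB B (n + L).+1 c (dyf t (n + L).+1) w -
    gridB B (n + L) c (dyf t (n + L)) w) + (gridB B (n + L) c (dyf t (n + L)) w -
    gridB B n c (dyf t n) w)); last by ring.
  apply: le_trans (ler_normD _ _) _.
  have := step (n + L)%N (leq_trans n0n (leq_addr _ _)).
  have := modl_step (n + L)%N; lra.
apply/ler_addgt0Pr => e e0.
have : \forall y \near t, `|B (posp t) w ord0 c - B (posp y) w ord0 c| < e.
  have := @coord_continuous _ _ _ _ _ _ hB w c t.
  by move=> /cvgrPdist_lt /(_ e e0).
move=> [z /= z0 hz].
have [L hL] : exists L, 2 ^- (n + L) < z.
  by have [L hL] := exp2V_small z0; exists L; apply: hL; exact: leq_addl.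
have := hz (gridt (n + L) (dyf t (n + L))).
rewrite !posp_id ?gridt_ge0//.
have /andP[h1 h2] := dyf_itv (n + L) t0.
have h3 : ball_ Num.norm t z (gridt (n + L) (dyf t (n + L))).
  rewrite /ball_/= ger0_norm ?subr_ge0//; apply: lt_trans hL.
  rewrite ltrBlDl; apply: lt_le_trans h2 _.
  by rewrite gridt_S.
move=> /(_ h3) h4; have := part L.
have : 0 <= modl (n + L)%N by rewrite !mulr_ge0// ltW// rad_gt0.
rewrite -/(gridB B (n + L) c (dyf t (n + L)) w) in h4.
move=> m0 h5.
rewrite (_ : _ - gridB B n c _ w = (B t w ord0 c - gridB B (n + L) c (dyf t (n + L)) w) +
  (gridB B (n + L) c (dyf t (n + L)) w - gridB B n c (dyf t n) w)); last by ring.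
apply: le_trans (ler_normD _ _) _; lra.
Qed.

Lemma loop_hit T n0 w s u n : gooddy T n0 w -> 0 <= s -> 0 <= u -> s + u < T%:R ->
  (n0 <= n)%N -> B (s + u) w = B s w ->
  exists j k, [/\ (j <= k)%N, (k < T * 2 ^ n)%N,
    hit B n (2 * modl n) j k w & `|u - (k - j)%:R / 2 ^+ n| <= 2 ^- n].
Proof.
move=> gw s0 u0 suT n0n e.
have su0 : 0 <= s + u by exact: addr_ge0.
have sT : s < T%:R by apply: le_lt_trans suT; rewrite lerDl.
have jk : (dyf s n <= dyf (s + u) n)%N.
  by rewrite /dyf le_truncn// ler_wpM2r ?exprn_ge0// lerDl.
exists (dyf s n), (dyf (s + u) n); split => //.
- have /andP[h _] := dyf_itv n su0; have := le_lt_trans h suT.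
  by rewrite /gridt ltr_pdivrMr ?exprn_gt0// -natrX -natrM ltr_nat.
- move=> c _; rewrite /hit1/= /gridD.
  have h1 := chaining c gw su0 suT n0n; have h2 := chaining c gw s0 sT n0n.
  rewrite e in h1.
  rewrite (_ : _ - _ = (B s w ord0 c - gridB B n c (dyf s n) w) -
    (B s w ord0 c - gridB B n c (dyf (s + u) n) w)); last by ring.
  apply: le_trans (ler_normB _ _) _; lra.
- have /andP[h1 h2] := dyf_itv n su0; have /andP[h3 h4] := dyf_itv n s0.
  rewrite gridt_S in h2; rewrite gridt_S in h4; rewrite /gridt in h1 h2 h3 h4.
  rewrite natrB// mulrBl ler_norml.
  move: (_%:R / 2 ^+ n) h1 h2 => x1 h1 h2; move: (_%:R / 2 ^+ n) h3 h4 => x2 h3 h4.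
  move: (2 ^- n) h2 h4 => x3 h2 h4; apply/andP; split; lra.
Qed.

End Modulus.

Section UpperBound.
Context {R : realType}.

Lemma hausdorff_cover (I : finType) (S : {set I}) (x : I -> R) (s e delta : R)
    (A : set R) : 0 <= s -> 0 < e -> 2 * e <= delta ->
  (forall y, A y -> exists2 i, i \in S & `|y - x i| <= e) ->
  (hausdorff_premeasure s delta A <= (#|S|%:R * (2 * e) `^ s)%:E)%E.
Proof.
move=> s0 e0 ed AS.
(* The cover is numbered by the enumeration of [S]; from [#|S|] on its sets are empty and count for
   0, even when [s = 0]. *)
pose U k := [set y | exists2 i, i \in S & index i (enum S) = k /\ `|y - x i| <= e].
have U2 k y z : U k y -> U k z -> `|y - z| <= 2 * e.
  move=> [i iS [<- yi]] [j jS [ij zj]].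
  have eij : j = i.
    by rewrite -(nth_index i (_ : j \in enum S)) ?mem_enum// ij nth_index ?mem_enum.
  rewrite eij in zj; rewrite (_ : y - z = (y - x i) - (z - x i)); last by ring.
  by apply: le_trans (ler_normB _ _) _; lra.
have dU k : (diam (U k) <= (2 * e)%:E)%E.
  by apply: ub_ereal_sup => _ [y Uy [z Uz <-]]; rewrite lee_fin; exact: (U2 k).
have pU k : (diam_pow s (U k) <= (if (k < #|S|)%N then (2 * e) `^ s else 0)%:E)%E.
  rewrite /diam_pow; case: ifPn => [_|/set0P[y Uy]].
    by case: ifP => // _; rewrite lee_fin powR_ge0.
  have [i iS [ik _]] := Uy; rewrite -ik cardE index_mem mem_enum iS.
  have := dU k; have := diam_ub Uy Uy; rewrite subrr normr0 ik.
  case: (diam (U k)) => // r; rewrite !lee_fin => r0 r2.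
  by apply: ge0_ler_powR; rewrite ?nnegrE// (le_trans r0).
apply: (@le_trans _ _ (\big[+%E/0%R]_(0 <= k <oo) diam_pow s (U k))%E).
  apply: ereal_inf_lbound; exists U => //; split.
    by move=> y /AS[i iS yi]; exists (index i (enum S)) => //; exists i.
  by move=> k; apply: le_trans (dU k) _; rewrite lee_fin.
apply: lime_le; first by apply: is_cvg_nneseries => k _ _; exact: diam_pow_ge0.
near=> N; rewrite big_mkord.
apply: (@le_trans _ _ (\sum_(k < N) (if (k < #|S|)%N then (2 * e) `^ s else 0)%:E)%E).
  by apply: lee_sum.
rewrite sumEFin lee_fin.
have -> : \sum_(k < N) (if (k < #|S|)%N then (2 * e) `^ s else 0) =
    (minn N #|S|)%:R * (2 * e) `^ s.
  move: ((2 * e) `^ s) #|S| => c M; clear; elim: N => [|N IH].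
    by rewrite big_ord0 min0n mul0r.
  rewrite big_ord_recr/= IH; case: ltnP => h.
    by rewrite (minn_idPl h) -natr1 mulrDl mul1r.
  by rewrite (minn_idPr (leqW h)) addr0.
by rewrite ler_wpM2r ?powR_ge0// ler_nat geq_minr.
Unshelve. all: by end_near.
Qed.

(** With [th] cut into [m.+1] equal parts [k], the product is at most [C * y ^+ m.+1], where
    [y = (n + 4) * (2 ^ n) ^ (- k)]. That [y] is small follows from [(2 ^ n) ^ k >= c * n ^ 2], the
    square of [1 + x <= expR x]. *)
Lemma poly_exp_small (C th : R) (m : nat) : 0 <= C -> 0 < th ->
  forall e, 0 < e -> forall n0, exists2 n, (n0 <= n)%N &
    C * (n + 4)%:R ^+ m * (2 ^+ n) `^ (- th) <= e.
Proof.
move=> C0 th0 e e0 n0.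
pose k := th / m.+1%:R.
have k0 : 0 < k by rewrite divr_gt0 ?ltr0n.
pose L := k * ln 2.
have L0 : 0 < L by rewrite mulr_gt0// ln_gt0// ltr1n.
pose c := L ^+ 2 / 4.
have c0 : 0 < c by rewrite divr_gt0// exprn_gt0.
have low n : c * n%:R ^+ 2 <= (2 ^+ n) `^ k :> R.
  have -> : (2 ^+ n) `^ k = expR (n%:R * L / 2) ^+ 2 :> R.
    rewrite expr2 -expRD /powR gt_eqF ?exprn_gt0// lnXn// /L -[ln 2 *+ n]mulr_natl.
    by congr expR; move: (ln 2) (n%:R) => u1 u2; field.
  rewrite (_ : c * _ = (n%:R * L / 2) ^+ 2); last by rewrite /c; field.
  rewrite lerXn2r ?nnegrE ?expR_ge0//; first by rewrite divr_ge0// mulr_ge0// ltW.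
  by apply: le_trans (expR_ge1Dx _); lra.
pose dl := Num.min 1 (e / (C + 1)).
have C1 : 0 < C + 1 by rewrite ltr_wpDl.
have dl0 : 0 < dl by rewrite lt_min ltr01 divr_gt0.
pose N := (maxn n0 (Num.truncn (5 / (c * dl))).+1).
exists N; first exact: leq_maxl.
have N0 : 0 < N%:R :> R by rewrite ltr0n leq_max orbT.
have hN : 5 / (c * dl) <= N%:R.
  by rewrite ltW// (lt_le_trans (truncnS_gt _))// ler_nat leq_maxr.
pose y := (N + 4)%:R * (2 ^+ N) `^ (- k) : R.
have y0 : 0 <= y by rewrite mulr_ge0// powR_ge0.
have ydl : y <= dl.
  rewrite /y powRN ler_pdivrMr ?powR_gt0 ?exprn_gt0//.
  apply: (@le_trans _ _ (dl * (c * N%:R ^+ 2))); last by rewrite ler_wpM2l ?low// ltW.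
  have cdl : 0 < c * dl by exact: mulr_gt0.
  rewrite ler_pdivrMr// in hN.
  have N1 : 1 <= N%:R :> R by rewrite -[1]/(1%:R) ler_nat -(ltr0n R).
  rewrite natrD; apply: (@le_trans _ _ (5 * N%:R)); first by lra.
  rewrite expr2; have := ler_wpM2r (ltW N0) hN; lra.
have -> : C * (N + 4)%:R ^+ m * (2 ^+ N) `^ (- th) =
   C * ((N + 4)%:R ^+ m * ((2 ^+ N) `^ (- k)) ^+ m.+1).
  rewrite -mulrA; congr (C * (_ * _)).
  rewrite -[RHS]powR_mulrn ?powR_ge0// -[RHS]powRrM.
  congr (powR _ _); rewrite /k mulNr divfK// pnatr_eq0.
apply: (@le_trans _ _ (C * y)).
  rewrite ler_wpM2l//; apply: (@le_trans _ _ (y ^+ m.+1)).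
    rewrite exprMn ler_wpM2r ?exprn_ge0 ?powR_ge0// exprS ler_peMl ?exprn_ge0//.
    by rewrite ler1n addn_gt0 orbT.
  rewrite exprS ler_piMr//; apply: exprn_ile1 => //.
  by apply: le_trans ydl _; rewrite ge_min lexx.
have : y <= e / (C + 1) by apply: le_trans ydl _; rewrite ge_min lexx orbT.
rewrite ler_pdivlMr//; lra.
Qed.

End UpperBound.

(** * Counting near-loops *)

Section SpanNull.
Context {R : realType} {disp : measure_display} {Omega : measurableType disp}.
Variable P : probability Omega R.
Variables (d : nat) (B : R -> Omega -> 'rV[R]_d).
Hypothesis hB : brownian_motion P B.

Lemma prob_hit_le n (r : R) j m : 0 <= r -> (0 < m)%N ->
  prob P (hit B n r j (j + m)) <= (2 * r / (Num.sqrt m%:R * rad n)) ^+ d.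
Proof.
move=> r0 m0; rewrite (prob_coord hB); last by move=> c; exact: hit1_process.
rewrite -[X in _ ^+ X]card_ord -prodr_const; apply: ler_prod => c _.
rewrite prob_ge0/= -lee_fin -probE; last exact: (hit1_measurable hB).
have -> : hit1 B n r c j (j + m) = gridD B n c j (j + m) @^-1` `[(- r)%R, (- r + 2 * r)%R]%classic.
  apply/seteqP; split => w; rewrite /hit1/= in_itv/= ler_norml => /andP[? ?];
    apply/andP; split; lra.
by apply: (gridD_itv_le hB) => //; [left|rewrite mulr_ge0].
Qed.

(** Durations are kept away from 0, where hits are too likely to be counted, and times are bounded,
    which leaves finitely many grid pairs. *)
Definition spart (a : R) (T : nat) (w : Omega) : set R :=
  [set u | a <= u /\ exists s, [/\ 0 <= s, s + u < T%:R & B (s + u) w = B s w]].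

(** Half of [a] absorbs the rounding of the duration by [2 ^- n], as soon as [2 <= a * 2 ^ n]. *)
Definition cand (a : R) n N (x : 'I_N * 'I_N) : bool :=
  (x.1 <= x.2)%N && (a * 2 ^+ n / 2 <= (x.2 - x.1)%:R).

Lemma spart_hit a T n0 w n u : 0 < a -> gooddy B T n0 w -> (n0 <= n)%N ->
  2 <= a * 2 ^+ n -> spart a T w u ->
  exists x : 'I_(T * 2 ^ n) * 'I_(T * 2 ^ n),
    [/\ cand a n x, hit B n (2 * modl n) x.1 x.2 w &
     `|u - (x.2 - x.1)%:R / 2 ^+ n| <= 2 ^- n].
Proof.
move=> a0 gw n0n a2 [au [s [s0 sT e]]].
have u0 : 0 <= u by apply: le_trans au; exact: ltW.
have [j [k [jk kT hjk ujk]]] := loop_hit hB gw s0 u0 sT n0n e.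
exists (Ordinal (leq_ltn_trans jk kT), Ordinal kT); split => //.
rewrite /cand/= jk/=; move: ujk; rewrite ler_norml => /andP[h1 h2].
have p0 : 0 < 2 ^+ n :> R by rewrite exprn_gt0.
have : u * 2 ^+ n <= (k - j)%:R + 1.
  rewrite -ler_pdivlMr// mulrDl mul1r; lra.
have : a * 2 ^+ n <= u * 2 ^+ n by rewrite ler_wpM2r// ltW.
lra.
Qed.

Lemma cand_prob_le a n N (x : 'I_N * 'I_N) : 0 < a -> cand a n x ->
  prob P (hit B n (2 * modl n) x.1 x.2) <=
  (12 * (n + 4)%:R) ^+ d * (a * 2 ^+ n / 2) `^ (- (d%:R / 2)).
Proof.
move=> a0 /andP[x12 xa].
have p0 : 0 < a * 2 ^+ n / 2 :> R by rewrite divr_gt0// mulr_gt0// exprn_gt0.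
have m0 : (0 < x.2 - x.1)%N by rewrite -(ltr0n R); exact: lt_le_trans xa.
have ml0 : 0 <= modl n :> R by rewrite !mulr_ge0// ltW// rad_gt0.
have m20 : 0 <= 2 * modl n :> R by exact: mulr_ge0.
have := @prob_hit_le n (2 * modl n) x.1 _ m20 m0.
rewrite subnKC// => h; apply: le_trans h _.
have r0 := rad_gt0 (R := R) n.
have sm : 0 < Num.sqrt (x.2 - x.1)%:R :> R by rewrite sqrtr_gt0 ltr0n.
have -> : (12 * (n + 4)%:R) ^+ d * (a * 2 ^+ n / 2) `^ (- (d%:R / 2)) =
    (12 * (n + 4)%:R / Num.sqrt (a * 2 ^+ n / 2)) ^+ d.
  rewrite [RHS]exprMn; congr (_ ^+ d * _).
  rewrite -powR12_sqrt ?(ltW p0)// -powRN -[RHS]powR_mulrn ?powR_ge0// -[RHS]powRrM.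
  by congr (powR _ _); rewrite mulNr mulrC.
rewrite lerXn2r ?nnegrE//.
- by rewrite divr_ge0 ?mulr_ge0 ?sqrtr_ge0// ltW.
have -> : 2 * (2 * modl n) / (Num.sqrt (x.2 - x.1)%:R * rad n) =
    12 * (n + 4)%:R / Num.sqrt (x.2 - x.1)%:R :> R.
  have A (u1 u2 u3 : R) : 0 < u1 -> 0 < u2 ->
    2 * (2 * (3 * u3 * u1)) / (u2 * u1) = 12 * u3 / u2.
    by move=> u10 u20; field; rewrite !gt_eqF.
  by rewrite /modl A.
rewrite ler_wpM2l ?mulr_ge0// lef_pV2 ?posrE ?sqrtr_gt0 ?ltr0n//.
exact: ler_wsqrtr.
Qed.

(** The expected sum of a cover is at most [T ^ 2 * 4 ^ n] pairs, times [2 ^ (- n * d / 2)], times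
    [2 ^ (- n * s)], up to a power of [n + 4]: it is small because [th = s + d / 2 - 2] is positive.
    [E m n] is the Markov event that this sum exceeds [m.+1%:R^-1]. *)
Lemma spart_null (a s : R) (T : nat) : 0 < a -> 0 <= s -> 2 - d%:R / 2 < s ->
  {ae P, forall w, hausdorff_measure s (spart a T w) = 0%E}.
Proof.
move=> a0 s0 sd.
pose Z n w : R := \sum_(x : 'I_(T * 2 ^ n) * 'I_(T * 2 ^ n))
  ((2 * 2 ^- n) `^ s * (cand a n x)%:R) * \1_(hit B n (2 * modl n) x.1 x.2) w.
have mh n j k : measurable (hit B n (2 * modl n) j k) by exact: (hit_measurable hB).
have mZ n : measurable_fun setT (Z n).
  apply: measurable_sum => x; apply: measurable_funM => //.
pose E (m n : nat) := [set w | m.+1%:R^-1 <= Z n w].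
have mE m n : measurable (E m n).
  rewrite -[E m n]setTI; exact: measurable_fun_ler.
pose C := T%:R ^+ 2 * 2 `^ s * 12 ^+ d * (a / 2) `^ (- (d%:R / 2)).
have C0 : 0 <= C by rewrite !mulr_ge0 ?powR_ge0 ?exprn_ge0.
pose th := s + d%:R / 2 - 2.
have th0 : 0 < th by rewrite /th; lra.
have pE m n : m.+1%:R^-1 * prob P (E m n) <= C * (n + 4)%:R ^+ d * (2 ^+ n) `^ (- th).
  have p0 : 0 < 2 ^+ n :> R by rewrite exprn_gt0.
  apply: (@le_trans _ _ (\sum_(x : 'I_(T * 2 ^ n) * 'I_(T * 2 ^ n))
     ((2 * 2 ^- n) `^ s * (cand a n x)%:R) * prob P (hit B n (2 * modl n) x.1 x.2))).
    apply: prob_sum_le => // x; rewrite mulr_ge0 ?powR_ge0//.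
  apply: (@le_trans _ _ (\sum_(x : 'I_(T * 2 ^ n) * 'I_(T * 2 ^ n))
     (2 * 2 ^- n) `^ s * ((12 * (n + 4)%:R) ^+ d * (a * 2 ^+ n / 2) `^ (- (d%:R / 2))))).
    apply: ler_sum => x _; rewrite -mulrA ler_wpM2l ?powR_ge0//.
    case: (boolP (cand a n x)) => cx; first by rewrite mul1r; exact: cand_prob_le.
    by rewrite mul0r mulr_ge0 ?powR_ge0// exprn_ge0// mulr_ge0.
  rewrite sumr_const card_prod !card_ord -[X in X <= _]mulr_natr !natrM natrX.
  have a20 : 0 <= a / 2 by rewrite divr_ge0// ltW.
  rewrite (_ : a * 2 ^+ n / 2 = a / 2 * 2 ^+ n); last by ring.
  rewrite (powRM _ a20 (ltW p0)) exprMn.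
  have p1 : 0 <= 2 ^- n :> R by rewrite invr_ge0 ltW.
  rewrite (powRM s (ler0n R 2) p1).
  have -> : (2 ^- n) `^ s = (2 ^+ n) `^ (- s) :> R.
    by rewrite -powR_inv1 ?(ltW p0)// -powRrM mulN1r.
  have -> : (2 ^+ n) `^ (- th) = (2 ^+ n) `^ (- s) * (2 ^+ n) `^ (- (d%:R / 2)) * 2 ^+ n * 2 ^+ n :> R.
    rewrite (_ : - th = (- s) + (- (d%:R / 2)) + 1 + 1); last by rewrite /th; ring.
    by rewrite !gt0_powRD// powRr1// ltW.
  rewrite /C; have A (u1 u2 u3 u4 u5 u6 u7 u8 : R) :
     u1 * u2 * (u3 * u4 * (u5 * u6)) * (u7 * u8 * (u7 * u8)) =
     u7 ^+ 2 * u1 * u3 * u5 * u4 * (u2 * u6 * u8 * u8) by ring.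
  by rewrite A.
have io : {ae P, forall w, forall m n0, exists2 n, (n0 <= n)%N & ~ E m n w}.
  apply: ae_foralln => m; apply: ae_io_not; first exact: mE.
  move=> e e0 n0; have e1 : 0 < m.+1%:R^-1 * e by rewrite mulr_gt0 ?invr_gt0 ?ltr0n.
  have [n n0n hn] := poly_exp_small d C0 th0 e1 n0.
  exists n => //; have := le_trans (pE m n) hn.
  by rewrite ler_pM2l ?invr_gt0 ?ltr0n.
apply: filterS2 io (gooddy_ae hB T) => w hio [n1 gw].
apply/hausdorff_measure_eq0 => delta d0; apply/eqP.
rewrite eq_le hausdorff_premeasure_ge0 andbT.
apply/lee_addgt0Pr => e e0; rewrite add0e.
have [m hm] : exists m : nat, m.+1%:R^-1 <= e.
  exists (Num.truncn e^-1); rewrite -[leRHS]invrK lef_pV2 ?posrE ?invr_gt0 ?ltr0n//.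
  exact/ltW/truncnS_gt.
have d20 : 0 < delta / 2 by rewrite divr_gt0.
have [n2 h2] := exp2V_small d20.
have a20 : 0 < a / 2 by rewrite divr_gt0.
have [n3 h3] := exp2V_small a20.
have [n hn nE] := hio m (maxn n1 (maxn n2 n3)).
move: hn; rewrite !geq_max => /and3P[n1n n2n n3n].
have p0 : 0 < 2 ^+ n :> R by rewrite exprn_gt0.
have a2 : 2 <= a * 2 ^+ n.
  have := ltW (h3 n n3n); rewrite -div1r ler_pdivrMr//; lra.
pose S := [set x : 'I_(T * 2 ^ n) * 'I_(T * 2 ^ n) | cand a n x && (w \in hit B n (2 * modl n) x.1 x.2)]%SET.
have : (hausdorff_premeasure s delta (spart a T w) <= (#|S|%:R * (2 * 2 ^- n) `^ s)%:E)%E.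
  apply: (@hausdorff_cover _ _ S (fun x => (x.2 - x.1)%:R / 2 ^+ n)) => //.
  - have := h2 n n2n; lra.
  - move=> u hu; have [x [cx hx ux]] := spart_hit a0 gw n1n a2 hu.
    by exists x => //; rewrite inE cx/=; apply/mem_set.
move=> h; apply: le_trans h _; rewrite lee_fin; apply: le_trans hm.
apply: ltW; rewrite ltNge; apply/negP => h; apply: nE; apply: le_trans h _.
rewrite /Z -sum1_card natr_sum mulr_suml big_mkcond/=; apply: ler_sum => x _.
rewrite inE indicE; case: (cand a n x) => /=; last by rewrite mulr0 mul0r.
by case: (w \in _); rewrite ?mul1r ?mulr1 ?mulr0.
Qed.

End SpanNull.

Section HausdorffUnion.
Context {R : realType}.
Implicit Types (A : set R) (s delta : R).

Lemma hausdorff_measure_bigcup s (A : nat -> set R) :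
  (forall i, hausdorff_measure s (A i) = 0%E) ->
  hausdorff_measure s (\bigcup_i A i) = 0%E.
Proof.
move=> A0; apply/hausdorff_measure_eq0 => delta d0; apply/eqP.
rewrite eq_le hausdorff_premeasure_ge0 andbT.
apply/lee_addgt0Pr => e e0; rewrite add0e.
pose Q n (G : (set R)^nat) := (A n `<=` \bigcup_k G k /\ forall k, (diam (G k) <= delta%:E)%E) /\
  (\sum_(0 <= k <oo) diam_pow s (G k) <= (e / (2 ^ n.+1)%:R)%:E)%E.
have [G QG] : {G : ((set R)^nat)^nat & forall n, Q n (G n)}.
  apply: (@choice _ _ Q) => n.
  have en : 0 < e / (2 ^ n.+1)%:R by rewrite divr_gt0// ltr0n expn_gt0.
  have := (hausdorff_measure_eq0 s (A n)).1 (A0 n) delta d0 => h.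
  have /(lb_ereal_inf_adherent en) : hausdorff_premeasure s delta (A n) \is a fin_num by rewrite h.
  move=> [x [G [AG Gd] <-]]; rewrite -/(hausdorff_premeasure s delta (A n)) h add0e => /ltW xe.
  by exists G.
have v0 x : (0 <= (diam_pow s \o uncurry G) x)%E by exact: diam_pow_ge0.
apply: (@le_trans _ _ (\esum_(i in setT) (diam_pow s \o uncurry G) i)%E).
  apply: ereal_inf_lbound => /=.
  have /card_esym/ppcard_eqP[f] := card_nat2.
  exists (uncurry G \o f).
    split => [t [i _ /(QG i).1.1 [j _ Gj]]|k].
      by exists (f^-1%FUN (i, j)) => //=; rewrite invK ?inE.
    by rewrite /=; case: (f k) => i j; exact: (QG i).1.2.
  rewrite -(esum_pred_image (diam_pow s \o uncurry G) _ xpredT) ?[fun=> _]set_true//.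
  by rewrite image_eq.
have -> : (\esum_(i in setT) (diam_pow s \o uncurry G) i =
   \sum_(0 <= i <oo) \sum_(0 <= j <oo) diam_pow s (G i j))%E.
  rewrite nneseries_esumT; last by move=> i; apply: nneseries_ge0 => j _ _; exact: diam_pow_ge0.
  have -> : \esum_(i in [set: nat]) (\sum_(0 <= j <oo) diam_pow s (G i j))%E =
      \esum_(i in [set: nat]) \esum_(j in [set: nat]) diam_pow s (G i j).
    by apply: eq_esum => i _; rewrite nneseries_esumT// => j; exact: diam_pow_ge0.
  rewrite (@esum_esum _ _ _ setT (fun=> setT) (fun i j => diam_pow s (G i j))).
    have -> : [set: nat] `*`` (fun=> [set: nat]) = [set: nat * nat].
      by apply/seteqP; split.
    by apply: eq_esum => -[i j].
  by move=> i j _ _; exact: diam_pow_ge0.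
apply: le_trans (epsilon_trick0 xpredT (ltW e0)).
apply: lee_nneseries => [i _ _|i _]; last exact: (QG i).2.
by apply: nneseries_ge0 => j _ _; exact: diam_pow_ge0.
Qed.

Lemma hausdorff_measure_set1 s x : 0 < s -> hausdorff_measure s [set x] = 0%E.
Proof.
move=> s0; apply/hausdorff_measure_eq0 => delta d0.
have D0 : diam [set x] = 0%E.
  apply/eqP; rewrite eq_le; apply/andP; split.
    by apply: ub_ereal_sup => _ [y -> [z -> <-]]; rewrite subrr normr0.
  by have := @diam_ub _ [set x] x x erefl erefl; rewrite subrr normr0.
apply/eqP; rewrite eq_le hausdorff_premeasure_ge0 andbT.
apply: ereal_inf_lbound; exists (fun=> [set x]).
  by split => [y ->|k]; [exists 0%N|rewrite D0 lee_fin ltW].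
rewrite eseries0// => k _ _; rewrite /diam_pow D0; case: ifP => // _.
by rewrite poweR_EFin powR0// gt_eqF.
Qed.

End HausdorffUnion.

(** * Dimension and density of the set of durations *)

Section SpanDimension.
Context {R : realType} {disp : measure_display} {Omega : measurableType disp}.
Variable P : probability Omega R.
Variables (d : nat) (B : R -> Omega -> 'rV[R]_d).
Hypothesis hB : brownian_motion P B.

Lemma Span_spart w : Span B w `<=`
  [set 0] `|` \bigcup_m spart B m.+1%:R^-1 m w.
Proof.
move=> u [s [t [s0 st e ->]]].
have [->|st'] := eqVneq t s; first by left; rewrite /= subrr.
right; have u0 : 0 < t - s by rewrite subr_gt0 lt_neqAle eq_sym st'.
pose m := maxn (Num.truncn t).+1 (Num.truncn (t - s)^-1).
exists m => //; split.
  rewrite -[leRHS]invrK lef_pV2 ?posrE ?invr_gt0 ?ltr0n//.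
  by apply: le_trans (ltW (truncnS_gt _)) _; rewrite ler_nat ltnS leq_maxr.
exists s; split; rewrite // addrC subrK//.
by apply: lt_le_trans (truncnS_gt _) _; rewrite ler_nat leq_maxl.
Qed.

Lemma Span_null (s : R) : 0 < s -> 2 - d%:R / 2 < s ->
  {ae P, forall w, hausdorff_measure s (Span B w) = 0%E}.
Proof.
move=> s0 sd.
have : {ae P, forall w, forall m, hausdorff_measure s (spart B m.+1%:R^-1 m w) = 0%E}.
  apply: ae_foralln => m; apply: (spart_null hB) => //; exact: ltW.
apply: filterS => w h; apply: hausdorff_measure_sub (@Span_spart w) _.
rewrite -bigcup2E; apply: hausdorff_measure_bigcup => -[|[|i]]; rewrite /bigcup2/=.
- exact: hausdorff_measure_set1.
- exact: hausdorff_measure_bigcup.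
- exact: hausdorff_measure_set0.
Qed.

Lemma Span_dim : (1 < d)%N -> (d < 4)%N ->
  {ae P, forall w, hausdorff_dim (Span B w) = (2 - d%:R / 2)%:E}.
Proof.
move=> d1 d4; pose D : R := 2 - d%:R / 2; rewrite -/D.
have d2 : 2 <= d%:R :> R by rewrite ler_nat.
have d3 : d%:R <= 3 :> R by rewrite ler_nat.
have D0 : 0 < D by rewrite /D; lra.
have hN m : 0 < m.+1%:R^-1 :> R by rewrite invr_gt0 ltr0n.
have up : {ae P, forall w, forall m, hausdorff_measure (D + m.+1%:R^-1) (Span B w) = 0%E}.
  by apply: ae_foralln => m; apply: Span_null; rewrite ?ltrDl// addr_gt0.
(* The shift to [m.+2] keeps the exponent positive for every [m]. *)
have low : {ae P, forall w, forall m,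
    hausdorff_measure (D - D / m.+2%:R) (Span B w `&` [set u | 0 <= u <= 1]) <> 0%E}.
  apply: ae_foralln => m.
  have hm : D / m.+2%:R < D by rewrite gtr_pMr// invf_lt1 ?ltr1n ?ltr0n.
  have hm0 : 0 < D / m.+2%:R by rewrite divr_gt0.
  by apply: (Span_hausdorff hB) => //; move: hm hm0; rewrite /D; move: (_ / m.+2%:R) => q; lra.
apply: filterS2 up low => w up low; apply/eqP; rewrite eq_le; apply/andP; split.
  apply/lee_addgt0Pr => e e0.
  pose m := Num.truncn e^-1.
  have me : m.+1%:R^-1 <= e.
    rewrite -[leRHS]invrK lef_pV2 ?posrE ?invr_gt0 ?ltr0n//.
    exact/ltW/truncnS_gt.
  apply: (@le_trans _ _ (D + m.+1%:R^-1)%:E); last by rewrite -EFinD lee_fin lerD2l.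
  apply: ereal_inf_lbound; exists (D + m.+1%:R^-1) => //=; split => //.
  by rewrite addr_ge0// ltW.
apply/ereal_infP => _ [s [s0 hs] <-]; rewrite lee_fin leNgt; apply/negP => sD.
pose m := Num.truncn (D / (D - s)).
have Ds : 0 < D - s by rewrite subr_gt0.
have hm : D / m.+2%:R <= D - s.
  rewrite ler_pdivrMr ?ltr0n// mulrC -ler_pdivrMr//.
  by apply: le_trans (ltW (truncnS_gt _)) _; rewrite ler_nat.
apply: (low m); apply: (@hausdorff_measure_sub _ _ (Span B w)) => [u []//|].
by apply: hausdorff_measure_exp hs => //; rewrite lerBrDr -lerBrDl.
Qed.

(** A set of nonzero measure is not empty. The exponent [4^-1] is admissible in all three
    dimensions, the tightest bound being [2 - 3 / 2]; countably many rational intervals suffice. *)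
Lemma Span_dense : (0 < d)%N -> (d < 4)%N ->
  {ae P, forall w, dense_in [set t : R | 0 <= t] (Span B w)}.
Proof.
move=> d0 d4.
have d1 : 1 <= d%:R :> R by rewrite (ler_nat R 1).
have d3 : d%:R <= 3 :> R by rewrite ler_nat.
have : {ae P, forall w, forall n i,
    hausdorff_measure 4^-1 (Span B w `&` [set u | i%:R / n.+1%:R <= u <= i.+1%:R / n.+1%:R]) <> 0%E}.
  apply: ae_foralln => n; apply: ae_foralln => i.
  apply: (Span_hausdorff hB); try lra.
  - by rewrite divr_ge0.
  - by rewrite ltr_pM2r ?invr_gt0 ?ltr0n// ltr_nat.
apply: filterS => w h; split => [u [s [t [s0 st _ ->]]]|t /= t0]; first by rewrite /= subr_ge0.
move=> O /nbhs_ballP[e /= e0 eO].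
pose n := Num.truncn e^-1.
have ne : n.+1%:R^-1 < e.
  by rewrite -[ltRHS]invrK ltf_pV2 ?posrE ?invr_gt0 ?ltr0n// truncnS_gt.
have n0 : 0 < n.+1%:R :> R by rewrite ltr0n.
pose i := Num.truncn (t * n.+1%:R).
have /andP[i1 i2] : i%:R <= t * n.+1%:R < i.+1%:R.
  by apply: truncn_itv; rewrite mulr_ge0.
have [u [Su /andP[u1 u2]]] : (Span B w `&` [set u | i%:R / n.+1%:R <= u <= i.+1%:R / n.+1%:R]) !=set0.
  by apply/set0P/eqP => S0; apply: (h n i); rewrite S0 hausdorff_measure_set0.
exists u; split => //; apply: eO; rewrite /ball/=.
move: u1 u2; rewrite ler_pdivrMr// ler_pdivlMr// => u1 u2.
apply: le_lt_trans ne.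
rewrite -(ler_pM2r n0) mulVf ?gt_eqF// -[X in `|_| * X]ger0_norm ?(ltW n0)// -normrM.
by rewrite ler_norml mulrBl; move: i2 u2; rewrite -natr1 => i2 u2; apply/andP; split; lra.
Qed.

End SpanDimension.

(** * Dimension one *)

Section OneDimension.
Context {R : realType} {disp : measure_display} {Omega : measurableType disp}.
Variable P : probability Omega R.

(* By the intermediate value theorem [f (t + u) - f t] has a constant sign, so
   [f] is bounded below by its minimum over the first period. *)
Lemma no_loop_bounded_below (f : R -> R) (u : R) : continuous f -> 0 < u ->
  (forall t, 0 <= t -> f (t + u) <> f t) -> f 0 < f u ->
  exists M, forall t, 0 <= t -> M <= f t.
Proof.
move=> cf u0 fu f0u.
have inc t : 0 <= t -> f t < f (t + u).
  move=> t0; rewrite ltNge; apply/negP => h.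
  pose g x := f (x + u) - f x.
  have cg : {within `[0, t]%classic, continuous g}.
    apply: continuous_subspaceT => x; apply: cvgB; last exact: cf.
    apply: (@continuous_comp _ _ _ (fun x => x + u) f); last exact: cf.
    by apply: cvgD; [exact: cvg_id|exact: cvg_cst].
  have [|c c0t gc] := IVT t0 cg (v := 0).
    by rewrite /g add0r ge_min le_max !subr_ge0 !subr_le0 h (ltW f0u) orbT.
  apply: (fu c); first by move: c0t; rewrite in_itv/= => /andP[].
  by apply/eqP; rewrite -subr_eq0; apply/eqP.
have cfw : {within `[0, u]%classic, continuous f} by exact: continuous_subspaceT.
have [m _ hm] := EVT_min (ltW u0) cfw.
exists (f m).
suff H k t : 0 <= t -> t <= k.+1%:R * u -> f m <= f t.
  move=> t t0; apply: (H (Num.truncn (t / u))) => //.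
  by rewrite -ler_pdivrMr//; exact/ltW/truncnS_gt.
elim: k t => [|k IH] t t0 tk.
  by apply: hm; rewrite in_itv/= t0/=; rewrite mul1r in tk.
have [tu|ut] := leP t u; first by apply: hm; rewrite in_itv/= t0.
have tu0 : 0 <= t - u by rewrite subr_ge0 ltW.
have := inc (t - u) tu0; rewrite subrK => /ltW; apply: le_trans.
apply: IH => //; move: tk; rewrite -[k.+2%:R]natr1 mulrDl mul1r; lra.
Qed.

(** The times [T k] grow so fast that one increment outweighs the past: its deviation is
    [L * Num.sqrt (T k)], while [|X (T k)| <= N * Num.sqrt (T k)] for all [k < K] with high
    probability. As [L = M + N + 1], one increment of at least a standard deviation in the right
    direction leads beyond [M]. Each does so with probability at least [c], independently. [K] is
    chosen first, then [N]. *)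
Lemma unbounded1 (X : R -> Omega -> R) (b : bool) (M : nat) :
  brownian_motion1 P X ->
  {ae P, forall w, exists n : nat, (-1) ^+ b * X n%:R w < - M%:R}.
Proof.
move=> hX.
have mX (n : nat) : measurable_fun setT (X n%:R) by exact: (bm1_measurable hX).
pose A := [set w | forall n : nat, - M%:R <= (-1) ^+ b * X n%:R w].
have mA : measurable A.
  rewrite (_ : A = \bigcap_n [set w | - M%:R <= (-1) ^+ b * X n%:R w]).
    apply: bigcapT_measurable => n; rewrite -[X in measurable X]setTI.
    by apply: measurable_fun_ler => //; exact: measurable_funM.
  by apply/seteqP; split => w h n; [move=> _; exact: h|exact: (h n)].
exists A; split => //; last first.
  move=> w /= h n; rewrite leNgt; apply/negP => hn; apply: h; by exists n.
apply: prob_eq0 => //; apply/ler_addgt0Pr => e e0; rewrite add0r.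
pose c : R := expR (-2) / 3.
have c0 : 0 < c by rewrite divr_gt0 ?expR_gt0.
have c1 : c < 1.
  by rewrite /c ltr_pdivrMr// mul1r (@lt_trans _ _ 1)// ?ltr1n// -expR0 ltr_expR oppr_lt0.
have [K hK] : exists K, (1 - c) ^+ K <= e / 2.
  have e20 : 0 < e / 2 by rewrite divr_gt0.
  have cv : (1 - c) ^+ K @[K --> \oo] --> (0 : R).
    by apply: cvg_expr; rewrite ger0_norm; lra.
  have /cvgrPdist_le/(_ _ e20)[K _ hK] := cv.
  exists K; have := hK K (leqnn K); rewrite /= sub0r normrN ger0_norm//.
  by rewrite exprn_ge0// subr_ge0 ltW.
have [N hN] : exists N : nat, K%:R * (2 * expR (- (N%:R ^+ 2 / 4))) <= e / 2 :> R.
  pose N := (maxn 4 (Num.truncn (4 * K%:R / e)).+1).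
  exists N.
  have N4 : 4 <= N%:R :> R by rewrite (ler_nat R 4) leq_maxl.
  have N0 : 0 < N%:R :> R by apply: lt_le_trans N4.
  have NK : 4 * K%:R / e <= N%:R.
    by apply: le_trans (ltW (truncnS_gt _)) _; rewrite ler_nat leq_maxr.
  have NK' : 4 * K%:R <= N%:R * e by move: NK; rewrite ler_pdivrMr.
  have E1 : expR (- (N%:R ^+ 2 / 4)) <= N%:R^-1 :> R.
    rewrite expRN lef_pV2 ?posrE ?expR_gt0//; apply: le_trans (expR_ge1Dx _).
    have := ler_wpM2r (ltW N0) N4; rewrite expr2; lra.
  apply: (@le_trans _ _ (K%:R * (2 * N%:R^-1))); first by rewrite ler_wpM2l// ler_wpM2l.
  rewrite mulrA ler_pdivrMr//; lra.
pose L := (M + N).+1.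
pose T k := ((1 + L ^ 2) ^ k)%N.
have T1 k : 1 <= (T k)%:R :> R by rewrite (ler_nat R 1) expn_gt0.
have T0 k : 0 < (T k)%:R :> R by apply: lt_le_trans (T1 k).
have TS k : (T k.+1)%:R = (T k)%:R + L%:R ^+ 2 * (T k)%:R :> R.
  by rewrite -natrX -natrM -natrD /T expnS mulnDl mul1n.
have L0 : 0 < L%:R :> R by rewrite ltr0n.
pose s k : R := Num.sqrt ((T k.+1)%:R - (T k)%:R).
have sE k : s k = L%:R * Num.sqrt (T k)%:R.
  rewrite /s TS addrAC subrr add0r sqrtrM ?exprn_ge0 ?(ltW L0)//.
  by rewrite sqrtr_sqr ger0_norm// ltW.
have q1 k : 1 <= Num.sqrt (T k)%:R :> R by rewrite -[leLHS]sqrtr1 ler_wsqrtr.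
have s0 k : 0 < s k by rewrite sE mulr_gt0// (lt_le_trans _ (q1 k)).
have TT k : (T k)%:R < (T k.+1)%:R :> R.
  by rewrite -subr_gt0 TS addrAC subrr add0r mulr_gt0// exprn_gt0.
pose y k : R := if b then s k else - (2 * s k).
pose F k : set Omega :=
  (fun w => X (T k.+1)%:R w - X (T k)%:R w) @^-1` (~` `[y k, (y k + s k)%R]%classic).
have mI k : measurable (`[y k, (y k + s k)%R]%classic) by exact: measurable_itv.
have mG k : measurable ((fun w => X (T k.+1)%:R w - X (T k)%:R w) @^-1`
    `[y k, (y k + s k)%R]%classic).
  by rewrite -[_ @^-1` _]setTI; apply: (measurable_funB (mX _) (mX _)).
have mF k : measurable (F k) by rewrite /F -preimage_setC; exact: measurableC.
have pF k : (P (F k) <= (1 - c)%:E)%E.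
  rewrite /F -preimage_setC probability_setC//.
  rewrite (bm1_gaussian_increments hX) ?(ltW (T0 k))//.
  rewrite -/(s k) EFinB; apply: leeB => //.
  have := @normal_prob_itv_ge R (s k) (y k) (s k) (s0 k) (ltW (s0 k)).
  rewrite -mulrA divff ?gt_eqF// mulr1 => h.
  apply: h; have := s0 k; rewrite /y; case: (b); lra.
have pFF : prob P (\bigcap_(k in [set` finset.setTfor 'I_K]) F k) <= (1 - c) ^+ K.
  rewrite -lee_fin -probE; last by apply: fin_bigcap_measurable.
  rewrite (bm1_independent_increments hX (n := K) (t := fun k => (T k)%:R)).
  - under eq_bigr do rewrite probE//.
    rewrite prodEFin lee_fin -[X in _ ^+ X]card_ord -prodr_const.
    rewrite big_mkcond [leRHS]big_mkcond/=.
    apply: ler_prod => k _; rewrite finset.in_setT prob_ge0.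
    by rewrite -lee_fin -probE//; exact: pF.
  - by rewrite ltW.
  - by apply/nondecreasing_seqP => k; exact: ltW.
  - move=> k _; exists (~` `[y k, (y k + s k)%R]%classic); last by rewrite setTI.
    exact: measurableC.
pose tail k : set Omega := (fun w => X (T k)%:R w - X 0 w) @^-1`
  [set x | N%:R * Num.sqrt ((T k)%:R - 0) < `|x|].
have mt (a : R) : measurable [set x : R | a < `|x|].
  by rewrite -[X in measurable X]setTI; apply: measurable_fun_ltr => //; exact: normr_measurable.
have mtail k : measurable (tail k).
  by rewrite -[tail k]setTI; apply: (measurable_funB (mX _) (mX 0%N)).
have pt k : prob P (tail k) <= 2 * expR (- (N%:R ^+ 2 / 4)).
  rewrite -lee_fin -probE// (bm1_gaussian_increments hX)//.
  by apply: normal_prob_tail_le; rewrite ?sqrtr_gt0 ?subr0.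
pose E (x : 'I_1 + 'I_K) := match x with
  | inl _ => \bigcap_(k in [set` finset.setTfor 'I_K]) F k | inr k => tail k end.
apply: (@le_trans _ _ (\sum_x prob P (E x))).
  apply: prob_bigcup_le => //.
    by move=> [i|k]//=; apply: fin_bigcap_measurable.
  move=> w Aw; apply: contrapT => /forallNP hE.
  apply: (hE (inl ord0)) => /= k _ hk.
  have : ~ tail k w by exact: (hE (inr k)).
  rewrite /tail/= (bm1_start hX) !subr0 => /negP; rewrite -leNgt => h.
  have := Aw (T k.+1).
  move: hk; rewrite /= in_itv/= /y => /andP[].
  have := ler_wpM2l (ler0n R M) (q1 k).
  have := q1 k; move: h; rewrite ler_norml sE /L -natr1 natrD => /andP[].
  move: (X _ w) (X _ w) (Num.sqrt _) => x1 x2 q h1 h2 h3 h4.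
  case: (b); rewrite ?expr0 ?expr1 => h5 h6 h7; lra.
rewrite big_sumType big_ord1/= [leRHS](_ : _ = e / 2 + e / 2); last by field.
apply: lerD; first exact: le_trans hK.
apply: le_trans hN; apply: (@le_trans _ _ (\sum_(k < K) (2 * expR (- (N%:R ^+ 2 / 4))))).
  by apply: ler_sum.
by rewrite sumr_const card_ord -[leLHS]mulr_natl.
Qed.

Lemma Span1_full (B : R -> Omega -> 'rV[R]_1) : brownian_motion P B ->
  {ae P, forall w, Span B w = [set t : R | 0 <= t]}.
Proof.
move=> hB.
have hX := bm_coordinates hB ord0.
have h (b : bool) : {ae P, forall w, forall M : nat, exists n : nat, (-1) ^+ b * B n%:R w ord0 ord0 < - M%:R}.
  by apply: ae_foralln => M; exact: (unbounded1 b M hX).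
apply: filterS2 (h false) (h true) => w h0 h1.
apply/seteqP; split => [u [s [t [s0 st _ ->]]]|u /= u0]; first by rewrite /= subr_ge0.
have [->|un0] := eqVneq u 0; first by exists 0, 0; split; rewrite ?subr0.
have {un0}u0 : 0 < u by rewrite lt_def un0.
apply: contrapT => Su.
pose f t := B (posp t) w ord0 ord0.
have cf : continuous f by exact: (coord_continuous hB).
have fE t : 0 <= t -> f t = B t w ord0 ord0 by move=> t0; rewrite /f posp_id.
have fu t : 0 <= t -> f (t + u) <> f t.
  move=> t0 e; apply: Su; exists t, (t + u); split => //.
  - by rewrite lerDl ltW.
  - by apply/rowP => i; rewrite ord1; move: e; rewrite !fE// addr_ge0// ltW.
  - by rewrite addrAC subrr add0r.
have [f0|f0|f0] := ltgtP (f 0) (f u); last first.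
- by apply: (fu 0) => //; rewrite add0r.
- have [M hM] : exists M, forall t, 0 <= t -> M <= - f t.
    apply: (@no_loop_bounded_below (fun t => - f t) u) => //.
    + by move=> t; apply: cvgN; exact: cf.
    + by move=> t t0 /oppr_inj; exact: fu.
    + by rewrite ltrN2.
  have [n hn] := h1 (Num.truncn `|M|).+1.
  move: hn; rewrite expr1 mulN1r -fE// => hn.
  have := hM n%:R; rewrite ler0n => /(_ isT) hn'.
  have := lt_le_trans (truncnS_gt `|M|) (lexx _); have := ler_norm (- M); rewrite normrN.
  lra.
have [M hM] := no_loop_bounded_below cf u0 fu f0.
have [n hn] := h0 (Num.truncn `|M|).+1.
move: hn; rewrite expr0 mul1r -fE// => hn.
have := hM n%:R; rewrite ler0n => /(_ isT) hn'.
have := lt_le_trans (truncnS_gt `|M|) (lexx _); have := ler_norm (- M); rewrite normrN.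
lra.
Qed.

End OneDimension.

(** * Lebesgue measure in the plane *)

Section Range.
Context {R : realType} {disp : measure_display} {Omega : measurableType disp}.
Variable P : probability Omega R.
Variables (d : nat) (B : R -> Omega -> 'rV[R]_d).
Hypothesis hB : brownian_motion P B.

Lemma sum_prob_le (I : finType) (E : I -> set Omega) (C : R) : 0 <= C ->
  (forall i, measurable (E i)) -> (forall w, \sum_i \1_(E i) w <= C) ->
  \sum_i prob P (E i) <= C.
Proof.
move=> C0 mE h.
have := @integral_sum_indic _ _ _ P I E (fun=> 1) mE (fun=> ler01).
under [in X in _ = X -> _]eq_bigr do rewrite mul1r.
move=> e; rewrite -lee_fin -e.
apply: (@le_trans _ _ (\int[P]_w (cst C%:E w))%E); last first.
  by rewrite integral_cst//= probability_setT mule1.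
apply: ge0_le_integral => //.
- by move=> w _; rewrite lee_fin sumr_ge0// => i _; rewrite mul1r.
- by apply/measurable_EFinP; apply: measurable_sum => i; apply: measurable_funM.
- by move=> w _; rewrite lee_fin; under eq_bigr do rewrite mul1r; exact: h.
Qed.

Variables (n j0 m H : nat) (rho : R).
Hypotheses (Hm : (2 * H <= m)%N) (H0 : (0 < H)%N) (rho0 : 0 < rho).
Let N := (j0 + m + 2 * H)%N.
Notation sg Q := (g_sigma_algebraType (sigX (@gridI R _ _ d B n N) (gridJ N Q))).

(* The loop increment from [j0 + l] to [j0 + m + l] is [walk l] plus the
   increments over [j0, j0 + H) and over the gap [j0 + H, j0 + m); the latter is
   independent of the others when [l <= H]. *)
Definition walk c l w : R :=
  gridD B n c (j0 + m) (j0 + m + l) w - gridD B n c j0 (j0 + l) w.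

Definition ncell c l w : int := Num.floor (walk c l w / rho).

(* [l] is the first visit of the walk to its cell of side [rho]. *)
Definition newcell l : set Omega :=
  [set w | forall l', (l' < l)%N -> exists c, ncell c l' w != ncell c l w].

Definition ret i l : set Omega :=
  [set w | forall c, `|walk c (l + i) w - walk c l w| <= rho].

Lemma walk_measurable_fun (Q : 'I_d -> nat -> bool) c l : (l <= 2 * H)%N ->
  (forall i, (j0 <= i < j0 + l)%N || (j0 + m <= i < j0 + m + l)%N -> Q c i) ->
  measurable_fun (T := sg Q) setT (walk c l).
Proof.
move=> lH hQ; apply: measurable_funB; apply: gridD_measurable_fun; rewrite /N; try lia.
- by move=> i hi; apply: hQ; lia.
- by move=> i hi; apply: hQ; lia.
Qed.

Lemma walkB c l i w : walk c (l + i) w - walk c l w =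
  gridD B n c (j0 + m + l) (j0 + m + l + i) w - gridD B n c (j0 + l) (j0 + l + i) w.
Proof. by rewrite /walk /gridD !addnA; ring. Qed.

Lemma newcell_sigma (Q : 'I_d -> nat -> bool) l : (l <= 2 * H)%N ->
  (forall c i, (j0 <= i < j0 + l)%N || (j0 + m <= i < j0 + m + l)%N -> Q c i) ->
  @measurable _ (sg Q) (newcell l).
Proof.
move=> lH hQ.
rewrite (_ : newcell l = \bigcap_(l' in `I_l) \bigcup_(c in setT)
   ~` [set w | (ncell c l' w)%:~R == (ncell c l w)%:~R :> R]); last first.
  apply/seteqP; split => w h l' /= l'l.
    by have [c hc] := h l' l'l; exists c => //=; rewrite eqr_int; apply/negP.
  by have [c _ /=] := h l' l'l; rewrite eqr_int => /negP hc; exists c.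
apply: (@fin_bigcap_measurable _ (sg Q)) => [|l' /= l'l]; first exact: finite_II.
apply: (@fin_bigcup_measurable _ (sg Q)) => // c _.
apply: (@measurableC _ (sg Q)).
have mn k : (k <= l)%N -> measurable_fun (T := sg Q) setT (fun w => (ncell c k w)%:~R : R).
  move=> kl.
  have mf : measurable_fun setT (fun x : R => (Num.floor x)%:~R : R).
    by apply: nondecreasing_measurable => // x y xy; rewrite ler_int; exact: le_floor.
  have mq : measurable_fun (T := sg Q) setT (fun w => walk c k w / rho).
    apply: measurable_funM => //; apply: walk_measurable_fun; first lia.
    by move=> i hi; apply: hQ; lia.
  exact: (measurableT_comp mf mq).
rewrite -[[set w | _]](@setTI (sg Q)).
by apply: (@measurable_fun_eqr _ (sg Q)) => //; apply: mn => //; exact: ltnW.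
Qed.

Lemma ret_sigma (Q : 'I_d -> nat -> bool) i l : (l + i <= 2 * H)%N ->
  (forall c k, (j0 + l <= k < j0 + l + i)%N || (j0 + m + l <= k < j0 + m + l + i)%N -> Q c k) ->
  @measurable _ (sg Q) (ret i l).
Proof.
move=> lH hQ.
rewrite (_ : ret i l = \bigcap_(c in setT) [set w | `|walk c (l + i) w - walk c l w| <= rho]).
  apply: (@fin_bigcap_measurable _ (sg Q)) => // c _.
  rewrite -[[set w | _]](@setTI (sg Q)); apply: (@measurable_fun_ler _ (sg Q)) => //.
  apply: measurableT_comp; first exact: normr_measurable.
  rewrite (_ : (fun w => _) = (fun w => gridD B n c (j0 + m + l) (j0 + m + l + i) w -
    gridD B n c (j0 + l) (j0 + l + i) w)); last by apply/funext => w; exact: walkB.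
  apply: measurable_funB; apply: gridD_measurable_fun; rewrite /N; try lia.
  - by move=> k hk; apply: hQ; lia.
  - by move=> k hk; apply: hQ; lia.
by apply/seteqP; split => w h c; [move=> _; exact: h|exact: h].
Qed.

(* Each of the [3 ^ d] cells around that of [walk t] has at most one first
   visit. *)
Lemma ret_new_count w t : \sum_(l < H | (l <= t)%N) \1_(newcell l `&` ret (t - l) l) w <= (3 ^ d)%:R :> R.
Proof.
pose S := [set l : 'I_H | (l <= t)%N && (w \in newcell l `&` ret (t - l) l)]%SET.
have -> : \sum_(l < H | (l <= t)%N) \1_(newcell l `&` ret (t - l) l) w = #|S|%:R :> R.
  rewrite -sum1_card natr_sum big_mkcond [RHS]big_mkcond/=; apply: eq_bigr => l _.
  by rewrite inE indicE; case: (l <= t)%N => //=; case: (_ \in _).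
rewrite ler_nat -[3%N]card_ord -[X in (_ ^ X)%N]card_ord -card_ffun.
(* Adding 1 sends the offsets -1, 0, 1 to ['I_3]. Two members of [S] with equal offsets share a
   cell, and only one of them can be its first visit. *)
pose off (l : 'I_H) : {ffun 'I_d -> 'I_3} :=
  [ffun c => inord (absz (ncell c l w - ncell c t w + 1)%R)].
rewrite -(card_in_imset (f := off) (D := S)); first exact: max_card.
have near l c : l \in S -> -1 <= ncell c l w - ncell c t w <= 1.
  rewrite inE => /andP[lt /set_mem[_ hr]].
  have := hr c; rewrite subnKC// => {}hr.
  have : `|walk c t w / rho - walk c l w / rho| <= 1.
    by rewrite -mulrBl normrM normfV (gtr0_norm rho0) ler_pdivrMr// mul1r.
  rewrite /ncell; move: (_ / rho) (_ / rho) => x y.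
  rewrite ler_norml => /andP[h1 h2].
  have /andP[x1 x2] := real_floor_itv (num_real x).
  have /andP[y1 y2] := real_floor_itv (num_real y).
  move: (Num.floor x) (Num.floor y) x1 x2 y1 y2 => p q x1 x2 y1 y2.
  have : p%:~R < (q + 1 + 1)%:~R :> R by move: x1 x2 y1 y2; rewrite !intrD; lra.
  have : q%:~R < (p + 1 + 1)%:~R :> R by move: x1 x2 y1 y2; rewrite !intrD; lra.
  by rewrite !ltr_int; lia.
have cellE l l' c : l \in S -> l' \in S -> off l = off l' -> ncell c l w = ncell c l' w.
  move=> /near hl /near hl' /ffunP/(_ c); rewrite !ffunE => /(congr1 val)/=.
  by have := hl c; have := hl' c => h1 h2; rewrite !inordK; lia.
have sym l l' : l \in S -> l' \in S -> off l = off l' -> ~~ (l < l')%N.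
  move=> lS l'S e; apply/negP => ll'.
  have := l'S; rewrite inE => /andP[_ /set_mem[hn _]].
  by have [c /eqP] := hn l ll'; apply; exact: cellE.
move=> l l' lS l'S e; apply: val_inj => /=; apply/eqP; rewrite eqn_leq.
by apply/andP; split; rewrite leqNgt; apply: sym.
Qed.


(* Returns after a first visit are independent of it, and a given time is a return
   from at most [3 ^ d] first visits. For [d = 2] this bounds the expected number
   of visited cells by [H] over a logarithm. *)
Lemma new_ret_sum (g : nat -> R) : (forall i l, (l + i <= 2 * H)%N -> g i <= prob P (ret i l)) ->
  (\sum_(l < H) prob P (newcell l)) * (\sum_(i < H) g i) <= (2 * H * 3 ^ d)%:R.
Proof.
move=> hg.
have mX (x : 'I_d * 'I_N) : measurable_fun setT (@gridI R _ _ d B n N x) by exact: (gridI_measurable hB).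
have sN l : (l < H)%N -> @measurable _ (sg (fun _ i => (i < j0 + l) || (j0 + m <= i < j0 + m + l))%N) (newcell l).
  by move=> lH; apply: newcell_sigma => [|c i]; lia.
have mN l : (l < H)%N -> measurable (newcell l).
  by move=> lH; apply: (sigX_measurable mX (sN l lH)).
have sR i l : (l + i <= 2 * H)%N -> @measurable _
   (sg (fun _ i => (j0 + l <= i < j0 + m) || (j0 + m + l <= i))%N) (ret i l).
  by move=> lH; apply: ret_sigma => // c k; lia.
have mR i l : (l + i <= 2 * H)%N -> measurable (ret i l).
  by move=> lH; apply: (sigX_measurable mX (sR i l lH)).
have pNR i l : (l < H)%N -> (l + i <= 2 * H)%N ->
    prob P (newcell l `&` ret i l) = prob P (newcell l) * prob P (ret i l).
  move=> lH liH; apply: EFin_inj; rewrite EFinM -!probE; try (by apply: mN); try (by apply: mR).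
    apply: (indep_sigX mX (gridI_indep hB (n := n) (N := N)) _ (sN l lH) (sR i l liH)).
    by move=> [c k]; rewrite !inE/=; lia.
  by apply: measurableI; [exact: mN|exact: mR].
rewrite mulr_suml.
apply: (@le_trans _ _ (\sum_(l < H) \sum_(i < H) prob P (newcell l `&` ret i l))).
  apply: ler_sum => l _; rewrite mulr_sumr; apply: ler_sum => i _.
  have h1 := ltn_ord l; have h2 := ltn_ord i.
  by rewrite pNR ?ler_wpM2l ?prob_ge0 ?hg//; lia.
rewrite pair_big/=.
apply: (@sum_prob_le _ (fun x : 'I_H * 'I_H => newcell x.1 `&` ret x.2 x.1)) => //.
  move=> [l i]/=; have h1 := ltn_ord l; have h2 := ltn_ord i.
  by apply: measurableI; [exact: mN|apply: mR; lia].
move=> w.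
rewrite -(pair_big xpredT xpredT (fun l i : 'I_H => \1_(newcell l `&` ret i l) w))/=.
(* Pairs are reindexed by the return time [t = l + i], for which [ret_new_count] bounds the number
   of first visits. *)
apply: (@le_trans _ _ (\sum_(l < H) \sum_(t < 2 * H | (l <= t)%N) \1_(newcell l `&` ret (t - l) l) w)).
  apply: ler_sum => l _.
  rewrite -(big_mkord xpredT (fun i => \1_(newcell l `&` ret i l) w : R)).
  rewrite -(big_mkord (fun t => l <= t)%N (fun t => \1_(newcell l `&` ret (t - l) l) w : R)).
  have lH := ltn_ord l.
  rewrite [leRHS](@big_cat_nat _ _ _ (l + H))/=; [|lia|lia].
  rewrite [X in _ <= X + _](@big_cat_nat _ _ _ l)/=; [|lia|lia].
  rewrite [X in _ <= X + _ + _](_ : _ = 0); last by rewrite big_nat_cond big_pred0// => i; lia.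
  rewrite add0r -[leLHS]addr0; apply: lerD; last by rewrite sumr_ge0.
  have shift (F : nat -> R) (a : nat) :
      \sum_(a <= i < a + H | (a <= i)%N) F (i - a)%N = \sum_(0 <= i < H) F i.
    rewrite -{1}[a]add0n (addnC a) big_addn addnK.
    by apply: eq_big => [i|i _]; rewrite ?leq_addl ?addnK.
  by rewrite (shift (fun i => \1_(newcell l `&` ret i l) w)).
rewrite (exchange_big_dep xpredT)//=.
apply: (@le_trans _ _ (\sum_(t < 2 * H) (3 ^ d)%:R)).
  by apply: ler_sum => t _; exact: ret_new_count.
by rewrite sumr_const card_ord -[leLHS]mulr_natl -natrM.
Qed.

End Range.

Section HitBlock.
Context {R : realType} {disp : measure_display} {Omega : measurableType disp}.
Variable P : probability Omega R.
Variables (d : nat) (B : R -> Omega -> 'rV[R]_d).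
Hypothesis hB : brownian_motion P B.
Variables (n j0 m H : nat) (rho : R).
Hypotheses (Hm : (2 * H <= m)%N) (H0 : (0 < H)%N) (rho0 : 0 < rho).
Let N := (j0 + m + 2 * H)%N.
Notation sg Q := (g_sigma_algebraType (sigX (@gridI R _ _ d B n N) (gridJ N Q))).
Let mX (x : 'I_d * 'I_N) : measurable_fun setT (@gridI R _ _ d B n N x).
Proof. exact: (gridI_measurable hB). Qed.

(** The walk moves by the difference of two independent Gaussian increments of deviation [s]. One
    lies in [[- s, s]] with probability at least [2 * expR (-2) / 3]; the other must then fall in an
    interval of length [2 * rho], contained in [[- 2 s, 2 s]] because [rho <= s]. *)
Lemma ret_prob_ge i l : (0 < i)%N -> (l + i <= 2 * H)%N ->
  rho <= Num.sqrt i%:R * rad n ->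
  ((2 * expR (-2) / 3) ^+ 2 * rho / (Num.sqrt i%:R * rad n)) ^+ d <=
  prob P (ret B n j0 m rho i l).
Proof.
move=> i0 liH rs; set s : R := Num.sqrt i%:R * rad n in rs *.
have s0 : 0 < s by rewrite mulr_gt0 ?rad_gt0// sqrtr_gt0 ltr0n.
pose a := (j0 + m + l)%N; pose b := (j0 + l)%N.
pose E c := [set w | `|gridD B n c a (a + i) w + gridD B n c (b + i) b w| <= rho].
have -> : ret B n j0 m rho i l = \bigcap_(c in setT) E c.
  have e c w : gridD B n c a (a + i) w + gridD B n c (b + i) b w =
      walk B n j0 m c (l + i) w - walk B n j0 m c l w.
    by rewrite walkB /gridD -/a -/b; ring.
  by apply/seteqP; split => w h c; [move=> _|]; have := h c; rewrite /E/= e; apply.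
have mE c : measurable (E c).
  rewrite -[E c]setTI; apply: measurable_fun_ler => //.
  apply: measurableT_comp; first exact: normr_measurable.
  by apply: measurable_funD; exact: (gridD_measurable hB).
rewrite (prob_coord hB); last first.
  move=> c.
  pose T := g_sigma_algebraType [set E | exists2 t : R, 0 <= t &
         preimage_set_system setT (fun w => B t w ord0 c) measurable E].
  have msg (t : R) : 0 <= t ->
      measurable_fun (T := T) setT (fun w => B t w ord0 c).
    by move=> t0 _ A mA; apply: sub_sigma_algebra; exists t => //; exists A.
  have : @measurable _ T (E c).
    rewrite -[E c]setTI; apply: measurable_fun_ler => //.
    apply: measurableT_comp; first exact: normr_measurable.
    by apply: measurable_funD; apply: measurable_funB; exact: msg (gridt_ge0 _ _).
  by [].
rewrite -[X in _ ^+ X]card_ord -prodr_const; apply: ler_prod => c _.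
apply/andP; split.
  exact: divr_ge0 (mulr_ge0 (sqr_ge0 _) (ltW rho0)) (ltW s0).
pose q1 : R := expR (-2) / 3 * (2 * rho) / s.
pose q2 : R := expR (-2) / 3 * (2 * s) / s.
pose D : set R := `[- s, - s + 2 * s]%classic.
have -> : (2 * expR (-2) / 3) ^+ 2 * rho / s = q1 * q2.
  by rewrite /q1 /q2; field; rewrite gt_eqF.
have q10 : 0 <= q1.
  have e0 : 0 <= expR (-2) / 3 :> R by rewrite divr_ge0 ?expR_ge0.
  by apply: divr_ge0 (ltW s0); rewrite !mulr_ge0// ltW.
pose Q1 : 'I_d -> nat -> bool := fun _ i => (a <= i)%N.
pose Q2 : 'I_d -> nat -> bool := fun _ i => (i < a)%N.
have := @concentration_ge _ _ _ P _ (@gridI R _ _ d B n N) (gridJ N Q1) (gridJ N Q2) mX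
  (gridI_indep hB (n := n) (N := N)) _ (gridD B n c a (a + i)) (gridD B n c (b + i) b) setT rho.
rewrite !setTI => h; rewrite -lee_fin -probE//.
have {}h : (q1%:E * P (gridD B n c (b + i) b @^-1` D) <= P (E c))%E.
  rewrite -[_ @^-1` D]setTI; apply: h => //.
  - by move=> [x y]; rewrite !inE /Q1 /Q2/=; lia.
  - by apply: gridD_measurable_fun; rewrite /N /a; try lia; move=> k; rewrite /Q1; lia.
  - by apply: gridD_measurable_fun; rewrite /N /b; try lia; move=> k; rewrite /Q2 /a; lia.
  - exact: (@measurableT _ (sg Q2)).
  - exact: measurable_itv.
  - move=> y; rewrite /D/= in_itv/= => /andP[y1 y2].
    have key (u v z : R) : v <= u -> - u <= z -> z <= - u + 2 * u -> 0 < v ->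
      [/\ 0 <= 2 * v, - (2 * u) <= - z - v & - z - v + 2 * v <= 2 * u].
      by move=> *; split; lra.
    by have [k1 k2 k3] := key _ _ _ rs y1 y2 rho0; apply: (gridD_itv_ge hB).
apply: le_trans h; rewrite EFinM; apply: lee_wpmul2l => //.
have -> : gridD B n c (b + i) b @^-1` D = gridD B n c b (b + i) @^-1` D.
  by apply/seteqP; split => w; rewrite /D /gridD/= !in_itv/= => /andP[? ?]; apply/andP; split; lra.
have key (u : R) : 0 < u -> [/\ 0 <= 2 * u, - (2 * u) <= - u & - u + 2 * u <= 2 * u].
  by move=> *; split; lra.
by have [k1 k2 k3] := key _ s0; apply: (gridD_itv_ge hB).
Qed.

(** [G] may mix the coordinates, so the probability does not split at once. The coordinates are
    removed one by one: the gap increment of [c] is independent of [G], of every [Y] and of the gap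
    increments of the other coordinates. *)
Lemma coords_concentration (Y : 'I_d -> Omega -> R) (G : set Omega) (r q : R) (s : seq 'I_d) :
  let Q (c : 'I_d) i := ((i < j0 + H) || (j0 + m <= i))%N in
  (forall c, measurable_fun (T := sg Q) setT (Y c)) ->
  @measurable _ (sg Q) G -> 0 <= q ->
  (forall c x, P (gridD B n c (j0 + H) (j0 + m) @^-1` `[x, (x + 2 * r)%R]%classic) <= q%:E)%E ->
  uniq s ->
  (P (G `&` [set w | forall c, c \in s -> (`|gridD B n c (j0 + H) (j0 + m) w + Y c w| <= r)%R])
   <= (q ^+ size s)%:E * P G)%E.
Proof.
move=> Q mY mG q0 hq; elim: s => [_|c s IH /= /andP[cs us]].
  rewrite expr0 mul1e (_ : [set w | _] = setT) ?setIT//.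
  by apply/seteqP; split.
pose Q1 (c' : 'I_d) i := ((c' == c) && (j0 + H <= i < j0 + m))%N.
pose Q2 (c' : 'I_d) i := ~~ Q1 c' i.
pose G' := G `&` [set w | forall c, c \in s -> `|gridD B n c (j0 + H) (j0 + m) w + Y c w| <= r].
have QQ2 : gridJ N Q \subset gridJ N Q2.
  by apply/fintype.subsetP => -[c' i]; rewrite !inE /Q /Q2 /Q1/= => /orP h; lia.
have mw (F : set Omega) : @measurable _ (sg Q) F -> @measurable _ (sg Q2) F.
  exact: (sigX_sub QQ2).
have mY2 c' : measurable_fun (T := sg Q2) setT (Y c').
  by move=> _ A mA; apply: mw; exact: mY.
have mG' : @measurable _ (sg Q2) G'.
  apply: (@measurableI _ (sg Q2)); first exact: mw.
  rewrite (_ : [set w | _] = \bigcap_(c' in [set` s])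
     [set w | `|gridD B n c' (j0 + H) (j0 + m) w + Y c' w| <= r]); last first.
    by apply/seteqP; split.
  apply: (@fin_bigcap_measurable _ (sg Q2)); first exact: finite_seq.
  move=> c' /= c's; rewrite -[[set w | _]](@setTI (sg Q2)).
  apply: (@measurable_fun_ler _ (sg Q2)) => //.
  apply: measurableT_comp; first exact: normr_measurable.
  apply: measurable_funD => //.
  apply: gridD_measurable_fun; rewrite /N; try (clear -Hm H0; lia).
  move=> k _; rewrite /Q2 /Q1; case: eqP => // e.
  by move: cs; rewrite -e c's.
have := @concentration_le _ _ _ P _ (@gridI R _ _ d B n N) (gridJ N Q1) (gridJ N Q2) mX
  (gridI_indep hB (n := n) (N := N)) _ (gridD B n c (j0 + H) (j0 + m)) (Y c) G' r _ (mY2 c) mG' q (hq c).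
move=> h.
rewrite (_ : _ `&` _ = G' `&` [set w | `|gridD B n c (j0 + H) (j0 + m) w + Y c w| <= r]); last first.
  apply/seteqP; split => w.
    move=> [Gw hw]; split; last by apply: hw; rewrite inE eqxx.
    by split => // c' c's; apply: hw; rewrite inE c's orbT.
  move=> [[Gw hw] hc]; split => // c'; rewrite inE => /orP[/eqP->//|]; exact: hw.
apply: le_trans (h _ _) _.
- by move=> [c' i]; rewrite !inE /Q2 negbK.
- apply: gridD_measurable_fun; rewrite /N; try (clear -Hm H0; lia).
  by move=> k; rewrite /Q1 eqxx/=; clear -Hm H0; lia.
by rewrite exprS EFinM -muleA; apply: lee_wpmul2l => //; exact: IH.
Qed.

(* Going back to the first visit of the cell of [walk l] moves the walk by at most
   [rho], so it suffices to look for hits within [2 * rho] at first visits. *)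
Lemma hit_block_le :
  prob P (\bigcup_(l in `I_H) hit B n rho (j0 + l) (j0 + l + m)) <=
  (4 * rho / (Num.sqrt (m - H)%:R * rad n)) ^+ d *
    \sum_(l < H) prob P (newcell B n j0 m rho l).
Proof.
set q := 4 * rho / _.
have mH : (0 < m - H)%N by lia.
have q0 : 0 <= q by rewrite divr_ge0 ?mulr_ge0 ?sqrtr_ge0 ?(ltW (rad_gt0 _))// ltW.
pose Y l c w := gridD B n c j0 (j0 + H) w + walk B n j0 m c l w.
pose F l c : set Omega := [set w | `|gridD B n c (j0 + H) (j0 + m) w + Y l c w| <= 2 * rho].
have eD l c w : gridD B n c (j0 + H) (j0 + m) w + Y l c w = gridD B n c (j0 + l) (j0 + l + m) w.
  by rewrite /Y /walk /gridD (_ : j0 + m + l = j0 + l + m)%N; [ring|lia].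
pose Q (c : 'I_d) i := ((i < j0 + H) || (j0 + m <= i))%N.
have mN l : (l < H)%N -> @measurable _ (sg Q) (newcell B n j0 m rho l).
  by move=> lH; apply: newcell_sigma => // [|c i]; rewrite /Q; lia.
pose E (l : nat) := newcell B n j0 m rho l `&` [set w | forall c, c \in enum 'I_d -> F l c w].
have mE l : (l < H)%N -> measurable (E l).
  move=> lH; apply: measurableI; first exact: (sigX_measurable mX (mN l lH)).
  rewrite (_ : [set w | _] = \bigcap_(c in setT) F l c); last first.
    by apply/seteqP; split => w h c => [_|_]; apply: h => //; rewrite mem_enum.
  apply: fin_bigcap_measurable => // c _.
  rewrite (_ : F l c = hit1 B n (2 * rho) c (j0 + l) (j0 + l + m)).
    exact: (hit1_measurable hB).
  by apply/seteqP; split => w; rewrite /F /hit1/= eD.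
rewrite mulr_sumr.
apply: (@le_trans _ _ (\sum_(l < H) prob P (E l))); last first.
  apply: ler_sum => l _; rewrite -lee_fin -probE; last exact: mE.
  rewrite EFinM -probE; last exact: (sigX_measurable mX (mN l (ltn_ord l))).
  rewrite -{1}(card_ord d) cardE.
  apply: coords_concentration => //.
  - move=> c; apply: measurable_funD.
      by apply: gridD_measurable_fun; rewrite /N; try lia; move=> k; rewrite /Q; lia.
    have lH := ltn_ord l.
    by apply: walk_measurable_fun => //; [lia|move=> k; rewrite /Q; lia].
  - exact: mN.
  - move=> c x; rewrite /q (_ : 4 * rho = 2 * (2 * rho)); last by ring.
    apply: (gridD_itv_le hB) => //; first by left; lia.
    by rewrite !mulr_ge0// ltW.
  - exact: enum_uniq.
apply: prob_bigcup_le => //.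
- by apply: fin_bigcup_measurable => [|l _]; [exact: finite_II|exact: (hit_measurable hB)].
- by move=> l; exact: mE.
move=> w [l /= lH hl].
pose A l' := [forall c, ncell B n j0 m rho c l' w == ncell B n j0 m rho c l w].
have exA : exists l', A l' by exists l; apply/forallP.
have l1A := ex_minnP exA; case: l1A => l1 /forallP l1A l1min.
have l1l : (l1 <= l)%N by apply: l1min; apply/forallP.
have l1H := leq_ltn_trans l1l lH.
exists (Ordinal l1H) => /=; split.
  move=> l' l'l1; apply: contrapT => /forallNP h.
  suff : A l' by move/l1min; rewrite leqNgt l'l1.
  apply/forallP => c; rewrite -(eqP (l1A c)).
  by have := h c; move/negP; rewrite negbK.
move=> c _; rewrite /F/= /Y.
have := hl c I; rewrite /hit1/= -eD /Y => h.
have : `|walk B n j0 m c l1 w - walk B n j0 m c l w| <= rho.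
  have /eqP := l1A c; rewrite /ncell.
  have r1 : `|walk B n j0 m c l1 w / rho - walk B n j0 m c l w / rho| <= 1 ->
    `|walk B n j0 m c l1 w - walk B n j0 m c l w| <= rho.
    by rewrite -mulrBl normrM normfV (gtr0_norm rho0) ler_pdivrMr// mul1r.
  move=> e; apply: r1; move: e; move: (_ / rho) (_ / rho) => x y e.
  have /andP[x1 x2] := real_floor_itv (num_real x).
  have /andP[y1 y2] := real_floor_itv (num_real y).
  rewrite e in y1 y2; rewrite intrD in x2 y2.
  by rewrite ler_norml; apply/andP; split; lra.
move: h; rewrite !ler_norml => /andP[? ?] /andP[? ?]; apply/andP; split; lra.
Qed.

End HitBlock.

(** * Critical exponent in the plane *)

Section PlanarNull.
Context {R : realType} {disp : measure_display} {Omega : measurableType disp}.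
Variable P : probability Omega R.
Variable B : R -> Omega -> 'rV[R]_2.
Hypothesis hB : brownian_motion P B.

(** Each of the [k] dyadic blocks contributes at least one half. *)
Lemma dyadic_harmonic (p k : nat) :
  k%:R / 2 <= \sum_(i < 2 ^ (p + k) | (2 ^ p <= i)%N) i%:R^-1 :> R.
Proof.
rewrite -(big_mkord (fun i => 2 ^ p <= i)%N (fun i => i%:R^-1 : R)).
elim: k => [|k IH]; first by rewrite mul0r sumr_ge0.
rewrite (@big_cat_nat _ _ _ (2 ^ (p + k)))//=; last by rewrite leq_exp2l// addnS.
rewrite -natr1 mulrDl; apply: lerD => //.
have e2 : (2 ^ (p + k.+1) = 2 ^ (p + k) + 2 ^ (p + k))%N by rewrite addnS expnS mul2n addnn.
have h0 : 0 < (2 ^ (p + k))%:R :> R by rewrite ltr0n expn_gt0.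
apply: (@le_trans _ _ (\sum_(2 ^ (p + k) <= i < 2 ^ (p + k.+1)) (2 ^ (p + k.+1))%:R^-1)).
  rewrite sumr_const_nat -[leRHS]mulr_natl e2 addnK natrD.
  by move: (2 ^ (p + k))%:R h0 => u u0; rewrite ler_pdivlMr ?addr_gt0//; lra.
rewrite [leRHS]big_mkcond/= [leLHS]big_nat [leRHS]big_nat; apply: ler_sum => i /andP[i1 i2].
rewrite ifT; last by apply: leq_trans i1; rewrite leq_exp2l// leq_addr.
have i0 : (0 < i)%N by apply: leq_trans i1; rewrite expn_gt0.
by rewrite lef_pV2 ?posrE ?ltr0n ?expn_gt0// ler_nat ltnW.
Qed.

Definition kap2 : R := (2 * expR (-2) / 3) ^+ 2.

Lemma kap2_gt0 : 0 < kap2.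
Proof. by rewrite exprn_gt0// divr_gt0// mulr_gt0// expR_gt0. Qed.

(* The factor [b ^ 2] of the hitting probability is compensated by the same
   factor in the return probabilities, which leaves the inverse logarithm
   [1 / k]. *)
Lemma planar_hit_block n j0 m (b : R) p k : (2 * 2 ^ (p + k) <= m)%N -> 0 < b ->
  b ^+ 2 <= (2 ^ p)%:R ->
  prob P (\bigcup_(l in `I_(2 ^ (p + k))) hit B n (b * rad n) (j0 + l) (j0 + l + m)) *
    (kap2 ^+ 2 * k%:R) <= 576.
Proof.
move=> Hm b0 bp.
have H0 : (0 < 2 ^ (p + k))%N by rewrite expn_gt0.
have harm := dyadic_harmonic p k.
move: (2 ^ (p + k))%N Hm H0 harm => H Hm H0 harm.
have r0 := rad_gt0 (R := R) n.
have rho0 : 0 < b * rad n by exact: mulr_gt0.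
have K0 := kap2_gt0.
(* Returns before [2 ^ p] are dropped: from there on [b ^ 2 <= i], so that the radius is at most the
   deviation, as [ret_prob_ge] requires. *)
pose g (i : nat) : R := if (2 ^ p <= i)%N then (kap2 * b) ^+ 2 / i%:R else 0.
have hg i l : (l + i <= 2 * H)%N -> g i <= prob P (ret B n j0 m (b * rad n) i l).
  move=> liH; rewrite /g; case: ifPn => [pi|_]; last exact: prob_ge0.
  have i0 : (0 < i)%N by apply: leq_trans pi; rewrite expn_gt0.
  have i0R : 0 < i%:R :> R by rewrite ltr0n.
  have s0 : 0 < Num.sqrt i%:R :> R by rewrite sqrtr_gt0.
  have bs : b <= Num.sqrt i%:R.
    rewrite -[b]ger0_norm ?(ltW b0)// -sqrtr_sqr ler_wsqrtr//.
    by apply: le_trans bp _; rewrite ler_nat.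
  have := @ret_prob_ge _ _ _ _ _ _ hB n j0 m H (b * rad n) Hm H0 rho0 i l i0 liH.
  rewrite ler_pM2r// => /(_ bs); apply: le_trans.
  have -> : (kap2 * b) ^+ 2 / i%:R = (kap2 * b / Num.sqrt i%:R) ^+ 2.
    by rewrite [RHS]expr_div_n sqr_sqrtr// ltW.
  rewrite -/kap2; have A (u1 u2 u3 u4 : R) : 0 < u3 -> 0 < u4 ->
     u1 * (u2 * u4) / (u3 * u4) = u1 * u2 / u3.
    by move=> u30 u40; field; rewrite !gt_eqF.
  by rewrite A.
have S1 := new_ret_sum hB Hm H0 rho0 hg.
have S2 := @hit_block_le _ _ _ _ _ _ hB n j0 m H (b * rad n) Hm H0 rho0.
have Sge0 : 0 <= \sum_(l < H) prob P (newcell B n j0 m (b * rad n) l).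
  by apply: sumr_ge0 => l _; exact: prob_ge0.
move: (\sum_(l < H) prob P (newcell B n j0 m (b * rad n) l))
  (prob P (\bigcup_(l in `I_H) _)) S1 S2 Sge0 => S Q S1 S2 Sge0.
have S3 : S * ((kap2 * b) ^+ 2 * (k%:R / 2)) <= 18 * H%:R.
  apply: (@le_trans _ _ (S * \sum_(i < H) g i)).
    by rewrite ler_wpM2l// /g -big_mkcond/= -mulr_sumr ler_wpM2l ?sqr_ge0.
  by apply: le_trans S1 _; rewrite -natrM ler_nat; lia.
have HR : 0 < H%:R :> R by rewrite ltr0n.
have mHR : H%:R <= (m - H)%:R :> R by rewrite ler_nat; move: Hm; clear; lia.
have S4 : Q <= 16 * b ^+ 2 / H%:R * S.
  apply: le_trans S2 _; rewrite ler_wpM2r//.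
  have mH0 : 0 < (m - H)%:R :> R by exact: lt_le_trans mHR.
  have s0 : 0 < Num.sqrt (m - H)%:R :> R by rewrite sqrtr_gt0.
  have A (u1 u3 u4 : R) : 0 < u3 -> 0 < u4 -> 4 * (u1 * u4) / (u3 * u4) = 4 * u1 / u3.
    by move=> u30 u40; field; rewrite !gt_eqF.
  rewrite A// [leLHS]expr_div_n sqr_sqrtr ?(ltW mH0)// exprMn (_ : 4 ^+ 2 = 16); last by ring.
  apply: ler_wpM2l; first by rewrite mulr_ge0 ?sqr_ge0.
  by rewrite lef_pV2 ?posrE.
apply: (@le_trans _ _ (16 * b ^+ 2 / H%:R * S * (kap2 ^+ 2 * k%:R))).
  by rewrite ler_wpM2r// mulr_ge0// sqr_ge0.
(* [576 = 16 * 2 * 18]: 16 is the square of the 4 in [hit_block_le], 2 comes from [k / 2] in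
   [dyadic_harmonic], and [18 = 2 * 3 ^ 2] from [new_ret_sum]. *)
have -> : 16 * b ^+ 2 / H%:R * S * (kap2 ^+ 2 * k%:R) =
    32 / H%:R * (S * ((kap2 * b) ^+ 2 * (k%:R / 2))).
  have A (u1 u2 u3 u4 u5 : R) : 0 < u2 -> 16 * u1 ^+ 2 / u2 * u3 * (u4 ^+ 2 * u5) =
    32 / u2 * (u3 * ((u4 * u1) ^+ 2 * (u5 / 2))).
    by move=> u20; field; rewrite gt_eqF.
  exact: A.
apply: (@le_trans _ _ (32 / H%:R * (18 * H%:R))); first by rewrite ler_wpM2l// divr_ge0// ltW.
have A (u : R) : 0 < u -> 32 / u * (18 * u) = 576 by move=> u0; field; rewrite gt_eqF.
by rewrite A.
Qed.

(** The condition [b ^+ 2 <= 2 ^ p] of [planar_hit_block] for [p = t], at the scale [2 * t] and with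
    [b = 6 * (2 * t + 4)], the ratio of [2 * modl] to [rad]. *)
Lemma pow2_ge_sqr t : (18 <= t)%N -> (6 * (2 * t + 4)%:R) ^+ 2 <= (2 ^ t)%:R :> R.
Proof.
elim: t => // t IH; rewrite leq_eqVlt => /orP[/eqP <-|].
  rewrite natrX natrD natrM; lra.
rewrite ltnS => t18; have := IH t18; rewrite expnS natrM !natrD !natrM -[t.+1%:R]natr1.
have : 18 <= t%:R :> R by rewrite (ler_nat R 18).
move: (t%:R) ((2 ^ t)%:R) => u v u18 h.
nra.
Qed.

(** A covering interval is paid once per lag and not once per pair, so the union over the starting
    times is the event to estimate. *)
Definition loopm T n m : set Omega := \bigcup_(j in `I_(T * 2 ^ n)) hit B n (2 * modl n) j (j + m).

Lemma loopm_measurable T n m : measurable (loopm T n m).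
Proof.
by apply: fin_bigcup_measurable => [|l _]; [exact: finite_II|exact: (hit_measurable hB)].
Qed.

(** The starting times are cut into [T * 2 ^ e] blocks of [2 ^ (t + (t - e))] indices. At an even
    scale half of the exponent pays for the squared radius, and the rest is the logarithmic gain
    [t - e]. *)
Lemma loopm_prob T t e m : (18 <= t)%N -> (e <= t)%N -> (2 * 2 ^ (2 * t - e) <= m)%N ->
  prob P (loopm T (2 * t) m) * (kap2 ^+ 2 * (t - e)%:R) <= 576 * (T * 2 ^ e)%:R.
Proof.
move=> t18 et; have bt : (6 * (2 * t + 4)%:R) ^+ 2 <= (2 ^ t)%:R :> R by exact: pow2_ge_sqr.
have nE : (2 * t - e = t + (t - e))%N by lia.
have nE2 : (2 * t = e + (t + (t - e)))%N by lia.
rewrite nE; move: (2 * t)%N nE2 bt => n nE2 bt hm.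
pose H := (2 ^ (t + (t - e)))%N.
pose b : R := 6 * (n + 4)%:R.
have b0 : 0 < b by rewrite mulr_gt0// ltr0n addn_gt0 orbT.
have bE : 2 * modl n = b * rad n by rewrite /modl /b; ring.
pose Bl j0 := \bigcup_(l in `I_H) hit B n (b * rad n) (j0 + l) (j0 + l + m).
have mBl j0 : measurable (Bl j0).
  by apply: fin_bigcup_measurable => [|l _]; [exact: finite_II|exact: (hit_measurable hB)].
have H0 : (0 < H)%N by rewrite expn_gt0.
have TH : (T * 2 ^ n = T * 2 ^ e * H)%N by rewrite -mulnA -expnD -nE2.
have h : prob P (loopm T n m) <= \sum_(x < T * 2 ^ e) prob P (Bl (x * H)%N).
  apply: prob_bigcup_le => //; first exact: loopm_measurable.
  move=> w [j /= jT hj].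
  have jH : (j %/ H < T * 2 ^ e)%N by rewrite ltn_divLR// -TH.
  exists (Ordinal jH); exists (j %% H)%N => /=; first exact: ltn_pmod.
  by rewrite -divn_eq -bE.
apply: (@le_trans _ _ ((\sum_(x < T * 2 ^ e) prob P (Bl (x * H)%N)) * (kap2 ^+ 2 * (t - e)%:R))).
  by rewrite ler_wpM2r// mulr_ge0// sqr_ge0.
rewrite mulr_suml; apply: (@le_trans _ _ (\sum_(x < T * 2 ^ e) 576)).
  by apply: ler_sum => x _; exact: planar_hit_block.
by rewrite sumr_const card_ord -[leLHS]mulr_natr.
Qed.


(** [T * 2 ^ n] lags, each with weight [2 * 2 ^- n] and probability at most [K / (t - e)]: the
    expected sum tends to 0 along the even scales [n = 2 * t]. *)
Lemma spart_null2 (a : R) (T : nat) : 0 < a ->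
  {ae P, forall w, hausdorff_measure 1 (spart B a T w) = 0%E}.
Proof.
move=> a0.
pose big n m := (a * 2 ^+ n / 2 <= m%:R :> R).
pose Z n w : R := \sum_(m < T * 2 ^ n) (2 * 2 ^- n * (big n m)%:R) * \1_(loopm T n m) w.
have mZ n : measurable_fun setT (Z n).
  apply: measurable_sum => x; apply: measurable_funM => //.
  by apply: measurable_indic; exact: loopm_measurable.
pose E (q n : nat) := [set w | q.+1%:R^-1 <= Z n w].
have mE q n : measurable (E q n).
  rewrite -[E q n]setTI; exact: measurable_fun_ler.
(* [e] depends only on [a]: blocks are short enough for [planar_hit_block] to apply to all lags
   considered, while their number stays bounded as the scale is refined. *)
have [e he] : exists e, forall n, (e <= n)%N -> 2 * 2 ^+ (n - e) <= a * 2 ^+ n / 2.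
  have a8 : 0 < a / 4 by rewrite divr_gt0.
  have [e he] := exp2V_small a8; exists e => n en.
  have p0 : 0 < 2 ^+ n :> R by rewrite exprn_gt0.
  have -> : 2 ^+ (n - e) = 2 ^+ n * 2 ^- e :> R.
    by rewrite -{2}(subnK en) exprD mulfK// gt_eqF// exprn_gt0.
  have h := ltW (he e (leqnn e)).
  have := ler_wpM2l (ltW p0) h; lra.
have k0 : 0 < kap2 ^+ 2 by rewrite exprn_gt0// kap2_gt0.
have [K K0 KE] : exists2 K : R, 0 <= K & 576 * (T * 2 ^ e)%:R = K * kap2 ^+ 2.
  exists (576 * (T * 2 ^ e)%:R / kap2 ^+ 2); last by rewrite divfK// gt_eqF.
  exact: divr_ge0 (mulr_ge0 (ler0n _ _) (ler0n _ _)) (ltW k0).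
have pE q t : (18 <= t)%N -> (e < t)%N ->
    q.+1%:R^-1 * prob P (E q (2 * t)%N) <= 2 * T%:R * (K / (t - e)%:R).
  move=> t18 et; have et' := ltnW et.
  have te0 : 0 < (t - e)%:R :> R by rewrite ltr0n subn_gt0.
  have enn : (e <= 2 * t)%N by lia.
  have hn := he _ enn.
  have pl m : big (2 * t)%N m -> prob P (loopm T (2 * t) m) <= K / (t - e)%:R.
    move=> bm; rewrite ler_pdivlMr// -(ler_pM2r k0) -KE -mulrA [_ * kap2 ^+ 2]mulrC.
    apply: loopm_prob => //; rewrite -(ler_nat R) natrM natrX.
    exact: le_trans bm.
  move: (2 * t)%N enn hn pl => n enn hn pl.
  have p0 : 0 < 2 ^+ n :> R by rewrite exprn_gt0.
  apply: (@le_trans _ _ (\sum_(m < T * 2 ^ n) (2 * 2 ^- n * (big n m)%:R) * prob P (loopm T n m))).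
    by apply: prob_sum_le => // m; exact: loopm_measurable.
  have Kt0 : 0 <= K / (t - e)%:R by rewrite divr_ge0// ltW.
  apply: (@le_trans _ _ (\sum_(m < T * 2 ^ n) 2 * 2 ^- n * (K / (t - e)%:R))).
    apply: ler_sum => m _; rewrite -mulrA ler_wpM2l ?mulr_ge0 ?invr_ge0 ?(ltW p0)//.
    by have := pl m; case: (big n m) => [/(_ isT)|_]; rewrite ?mul1r ?mul0r.
  rewrite sumr_const card_ord -[leLHS]mulr_natr natrM natrX.
  have A (u1 u2 u3 : R) : 0 < u1 -> 2 * u1^-1 * u2 * (u3 * u1) = 2 * u3 * u2.
    by move=> u10; field; rewrite gt_eqF.
  by rewrite A.
have io : {ae P, forall w, forall q n0, exists2 n, (n0 <= n)%N & ~ E q n w}.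
  apply: ae_foralln => q; apply: ae_io_not; first exact: mE.
  move=> eps eps0 n0.
  pose x := 2 * T%:R * K * q.+1%:R / eps.
  pose t := (e + maxn (maxn 18 n0) (Num.truncn x).+1)%N.
  have te : (t - e = maxn (maxn 18 n0) (Num.truncn x).+1)%N by rewrite addKn.
  have h18 : (maxn 18 n0 <= t)%N by rewrite /t; lia.
  have et : (e < t)%N by rewrite /t; lia.
  exists (2 * t)%N; first by lia.
  have t18 : (18 <= t)%N by lia.
  have te0 : 0 < (t - e)%:R :> R by rewrite ltr0n subn_gt0.
  have hx : x <= (t - e)%:R.
    by apply: le_trans (ltW (truncnS_gt _)) _; rewrite ler_nat te leq_maxr.
  have q0 : 0 < q.+1%:R :> R by rewrite ltr0n.
  have := pE q t t18 et; rewrite mulrC ler_pdivrMr// => h1; apply: le_trans h1 _.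
  move: hx; rewrite /x ler_pdivrMr// => hx.
  have A (u1 u2 u3 u4 : R) : u1 * (u2 / u4) * u3 = u1 * u2 * u3 / u4 by ring.
  by rewrite A ler_pdivrMr// [leRHS]mulrC.
apply: filterS2 io (gooddy_ae hB T) => w hio [n1 gw].
apply/hausdorff_measure_eq0 => delta d0; apply/eqP.
rewrite eq_le hausdorff_premeasure_ge0 andbT.
apply/lee_addgt0Pr => eps eps0; rewrite add0e.
have [q hq] : exists q : nat, q.+1%:R^-1 <= eps.
  exists (Num.truncn eps^-1); rewrite -[leRHS]invrK lef_pV2 ?posrE ?invr_gt0 ?ltr0n//.
  exact/ltW/truncnS_gt.
have d20 : 0 < delta / 2 by rewrite divr_gt0.
have [n2 h2] := exp2V_small d20.
have a20 : 0 < a / 2 by rewrite divr_gt0.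
have [n3 h3] := exp2V_small a20.
have [n hn nE] := hio q (maxn n1 (maxn n2 n3)).
move: hn; rewrite !geq_max => /and3P[n1n n2n n3n].
have p0 : 0 < 2 ^+ n :> R by rewrite exprn_gt0.
have a2 : 2 <= a * 2 ^+ n.
  have := ltW (h3 n n3n); rewrite -div1r ler_pdivrMr//; lra.
pose S := [set m : 'I_(T * 2 ^ n) | big n m && (w \in loopm T n m)]%SET.
have : (hausdorff_premeasure 1 delta (spart B a T w) <= (#|S|%:R * (2 * 2 ^- n) `^ 1)%:E)%E.
  apply: (@hausdorff_cover _ _ S (fun m => m%:R / 2 ^+ n)) => //.
  - have := h2 n n2n; lra.
  - move=> u hu; have [x [/andP[x12 xa] hx ux]] := spart_hit hB a0 gw n1n a2 hu.
    have mT : (x.2 - x.1 < T * 2 ^ n)%N by apply: leq_ltn_trans (ltn_ord x.2); exact: leq_subr.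
    exists (Ordinal mT) => //; rewrite inE /big/= xa/=; apply/mem_set.
    by exists x.1; rewrite /= ?subnKC.
move=> h; apply: le_trans h _; rewrite lee_fin; apply: le_trans hq.
rewrite powRr1; last by rewrite mulr_ge0// invr_ge0 ltW.
apply: ltW; rewrite ltNge; apply/negP => h; apply: nE; apply: le_trans h _.
rewrite /Z -sum1_card natr_sum mulr_suml big_mkcond/=; apply: ler_sum => m _.
rewrite inE indicE; case: (big n m) => /=; last by rewrite mulr0 mul0r.
by case: (w \in _); rewrite ?mul1r ?mulr1 ?mulr0.
Qed.

(** Covering sets may fail to be measurable: each is enclosed in an interval centred at one of its
    points, of length twice its diameter. *)
Lemma hausdorff1_lebesgue0 (A : set R) : measurable A ->
  hausdorff_measure 1 A = 0%E -> lebesgue_measure A = 0%E.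
Proof.
move=> mA /hausdorff_measure_eq0/(_ 1 ltr01) A0.
apply/eqP; rewrite eq_le measure_ge0 andbT.
apply/lee_addgt0Pr => e e0; rewrite add0e.
have e20 : 0 < e / 2 by rewrite divr_gt0.
have : hausdorff_premeasure 1 1 A \is a fin_num by rewrite A0.
move=> /(lb_ereal_inf_adherent e20)[_ [U [AU Ud] <-]].
rewrite -/(hausdorff_premeasure 1 1 A) A0 add0e => /ltW h.
have [V hV] : {V : nat -> set R & forall k, [/\ measurable (V k), U k `<=` V k &
    (lebesgue_measure (V k) <= 2%:E * diam_pow 1 (U k))%E]}.
  apply: (@choice _ _ (fun k V => [/\ measurable V, U k `<=` V &
    (lebesgue_measure V <= 2%:E * diam_pow 1 (U k))%E])) => k.
  rewrite /diam_pow; case: ifPn => [/eqP ->|/set0P[x Ux]].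
    by exists set0; split; rewrite ?measure0 ?mule0.
  have dfin := diam_fin Ux (Ud k).
  have [r dE] : exists r, diam (U k) = r%:E by exists (fine (diam (U k))); rewrite fineK.
  have r0 : 0 <= r by rewrite -lee_fin -dE; have := diam_ub Ux Ux; rewrite subrr normr0.
  exists (`[x - r, x + r]%classic); split; first exact: measurable_itv.
    move=> y Uy; have := diam_ub Ux Uy; rewrite dE lee_fin ler_norml => /andP[? ?].
    by rewrite /= in_itv/=; apply/andP; split; lra.
  rewrite dE poweR_EFin powRr1// lebesgue_measure_itv/= lte_fin.
  by case: ifP => _; rewrite -?EFinB -EFinM lee_fin; lra.
apply: (@le_trans _ _ (\sum_(0 <= k <oo) lebesgue_measure (V k))%E).
  apply: measure_sigma_subadditive => //; first by move=> k; have [] := hV k.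
  by move=> x /AU[k _ Ux]; exists k => //; have [_ hs _] := hV k; exact: hs.
apply: (@le_trans _ _ (\sum_(0 <= k <oo) (2%:E * diam_pow 1 (U k)))%E).
  by apply: lee_nneseries => [k _ _|k _]; [exact: measure_ge0|have [] := hV k].
rewrite nneseriesZl; last by move=> k _; exact: diam_pow_ge0.
apply: (@le_trans _ _ (2%:E * (e / 2)%:E)%E); first by apply: lee_wpmul2l.
by rewrite -EFinM lee_fin; lra.
Qed.

Lemma Span2_null : {ae P, forall w, lebesgue_measure (Span B w) = 0%E}.
Proof.
have : {ae P, forall w, forall m, hausdorff_measure 1 (spart B m.+1%:R^-1 m w) = 0%E}.
  by apply: ae_foralln => m; apply: spart_null2; rewrite invr_gt0 ltr0n.
apply: filterS => w h; apply: hausdorff1_lebesgue0.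
  have [K [cK ->]] := sigma_compact_Span hB w.
  apply: bigcupT_measurable => k; apply: closed_measurable.
  by apply: compact_closed; [exact: Rhausdorff|exact: cK].
apply: hausdorff_measure_sub (@Span_spart _ _ _ _ B w) _.
rewrite -bigcup2E; apply: hausdorff_measure_bigcup => -[|[|i]]; rewrite /bigcup2/=.
- exact: hausdorff_measure_set1.
- exact: hausdorff_measure_bigcup.
- exact: hausdorff_measure_set0.
Qed.

End PlanarNull.

Theorem theorem1p1 (R : realType) (disp : measure_display)
    (Omega : measurableType disp) (P : probability Omega R)
    (d : nat) (B : R -> Omega -> 'rV[R]_d)
    (hd : d \in [:: 1%N; 2%N; 3%N]) (hB : brownian_motion P B) :
  {ae P, forall w, sigma_compact (Span B w) /\
                   dense_in [set t : R | 0 <= t] (Span B w)} /\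
  (d = 1%N -> {ae P, forall w, Span B w = [set t : R | 0 <= t]}) /\
  (d = 2%N -> {ae P, forall w, lebesgue_measure (Span B w) = 0%E} /\
              {ae P, forall w, hausdorff_dim (Span B w) = 1%E}) /\
  (d = 3%N -> {ae P, forall w, hausdorff_dim (Span B w) = (2^-1)%:E}).
Proof.
have d0 : (0 < d)%N by move: hd; rewrite !inE => /or3P[] /eqP ->.
have d4 : (d < 4)%N by move: hd; rewrite !inE => /or3P[] /eqP ->.
have dim : (1 < d)%N -> {ae P, forall w, hausdorff_dim (Span B w) = (2 - d%:R / 2)%:E}.
  by move=> d1; exact: (Span_dim hB).
split; [|split; [|split]].
- apply: filterS (Span_dense hB d0 d4) => w dw; split => //.
  exact: (sigma_compact_Span hB).
- by move=> d1; subst d; exact: (Span1_full hB).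
- move=> d2; split.
    by subst d; exact: (Span2_null hB).
  by apply: filterS (dim _) => [w ->|]; rewrite d2//; congr _%:E; field.
- by move=> d3; apply: filterS (dim _) => [w ->|]; rewrite d3//; congr _%:E; field.
Qed.
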